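(* Let $k$ be a commutative field and let $\mathcal{A}$ be an essentially small additive category which is $k$-trivial. 1. If $A$ is an object of finite length of $\mathbf{Rep}(\mathcal{A})$ and $M$ is a simple $k[\mathrm{Aut}(A)]$-module, then $\mathrm{Q}(A,M)$ is a simple object of $\mathcal{F}(\mathcal{A};k)$. 2. For every $d\in\mathbb{N}$ there is a bijection $$\bigsqcup_{n\le d,\ A\in\mathcal{L}_n(\mathcal{A})}\mathrm{Irr}(k[\mathrm{Aut}(A)])\xrightarrow{\ \simeq\ }\mathrm{Irr}(\mathcal{F}_d(\mathcal{A};k)),\qquad (n,A,[M])\mapsto[\mathrm{Q}(A,M)].$$ 3. Suppose that every object of $\mathbf{Rep}(\mathcal{A})$ which is both finitely generated and finitely cogenerated has finite length (for example, that $\mathbf{Rep}(\mathcal{A})$ is locally finite). Then there is a bijection $$\bigsqcup_{n\in\mathbb{N},\ A\in\mathcal{L}_n(\mathcal{A})}\mathrm{Irr}(k[\mathrm{Aut}(A)])\xrightarrow{\ \simeq\ }\mathrm{Irr}(\mathcal{F}(\mathcal{A};k)),\qquad (n,A,[M])\mapsto[\mathrm{Q}(A,M)].$$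
   Context: $\mathbf{Rep}(\mathcal{A})$ is the abelian category of additive functors $\mathcal{A}\to\mathbf{Ab}$; $\mathcal{F}(\mathcal{A};k)$ is the abelian category of all functors from $\mathcal{A}$ to $k$-vector spaces. Exactness is pointwise in both. For $A\in\mathbf{Rep}(\mathcal{A})$, $k[A]$ is the functor $x\mapsto k[A(x)]$ ($k$-linearization of sets). $\mathcal{A}$ is $k$-trivial if for all objects $x,y$ the abelian group $\mathcal{A}(x,y)$ is finite of order invertible in $k$. An object $X$ is finitely generated if every upward-filtered family of subobjects with supremum $X$ contains $X$; finitely cogenerated (''de type cofini'') if every downward-filtered family of subobjects with intersection $0$ contains $0$. A Grothendieck category is locally finite if it is generated by its objects of finite length. For $F\in\mathcal{F}(\mathcal{A};k)$ and $x\in\mathrm{Ob}\,\mathcal{A}$: $\tau_x(F)(a)=F(x\oplus a)$. The group $\mathcal{A}(x,a)$ acts on $F(x\oplus a)$ through $u\mapsto F\begin{pmatrix}\mathrm{Id}_x&0\\ u&\mathrm{Id}_a\end{pmatrix}$, and $\bar\tau_x(F)(a):=F(x\oplus a)_{\mathcal{A}(x,a)}$ (coinvariants), a quotient functor of $\tau_x(F)$. The canonical inclusions $a\to x\oplus a$ induce a natural morphism $F\to\bar\tau_x(F)$, whose cokernel is $\bar\delta_x(F)$. For $d\ge -1$, $\mathcal{F}_d(\mathcal{A};k)$ is the full subcategory of functors $F$ with $\bar\delta_{a_0}\cdots\bar\delta_{a_d}\tau_x(F)=0$ for all objects $a_0,\dots,a_d,x$. For $A\in\mathbf{Rep}(\mathcal{A})$,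 $\mathrm{Q}_A$ is the cokernel of $\bigoplus_{B\subsetneq A}k[B]\to k[A]$ and $\mathrm{Q}^A$ is the kernel of $k[A]\to\prod_{0\neq B\subset A}k[A/B]$; both carry canonical actions of $\mathrm{Aut}(A)$. For a $k[\mathrm{Aut}(A)]$-module $M$, $\mathrm{Q}(A,M)$ is the image of the composite $$M\underset{k[\mathrm{Aut}(A)]}{\otimes}\mathrm{Q}^A\to M\underset{k[\mathrm{Aut}(A)]}{\otimes}k[A]\to M\underset{k[\mathrm{Aut}(A)]}{\otimes}\mathrm{Q}_A$$ induced by $\mathrm{Q}^A\hookrightarrow k[A]\twoheadrightarrow\mathrm{Q}_A$, where $M\otimes_{k[G]}X$ means the coinvariants $(M\otimes_k X)_G$ for the diagonal action. $\mathcal{L}_n(\mathcal{A})$ is a complete set of representatives of isomorphism classes of objects of length $n$ in $\mathbf{Rep}(\mathcal{A})$. $\mathrm{Irr}(\mathcal{E})$ is the set of isomorphism classes $[S]$ of simple objects $S$ of $\mathcal{E}$; for a ring $R$, $\mathrm{Irr}(R)$ means $\mathrm{Irr}(R\text{-}\mathbf{Mod})$. *)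

(* Defs.v *)
From HB Require Import structures.
From mathcomp Require Import all_boot all_algebra.
From mathcomp Require Import generic_quotient ring_quotient.
From mathcomp Require Import finmap boolp.
From mathcomp Require Import monalg.

Set Implicit Arguments.
Unset Strict Implicit.
Unset Printing Implicit Defensive.

Import GRing.Theory.

Local Open Scope ring_scope.

Record subgrp (V : zmodType) := SubGrp {
  sg_mem :> V -> Prop;
  sg0 : sg_mem 0;
  sgB : forall u v, sg_mem u -> sg_mem v -> sg_mem (u - v) }.

Record subspc (k : fieldType) (V : lmodType k) := SubSpc {
  ss_grp :> subgrp V;
  ssZ : forall (a : k) v, ss_grp v -> ss_grp (a *: v) }.

Section SubQuotient.
Variables (V : zmodType) (S : subgrp V).

Lemma sgN v : S v -> S (- v).
Proof. by move=> Sv; rewrite -sub0r; apply: sgB => //; apply: sg0. Qed.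

Lemma sgD u v : S u -> S v -> S (u + v).
Proof. by move=> Su Sv; rewrite -[v]opprK; apply/sgB/sgN. Qed.

Definition sg_pred : {pred V} := fun v => `[< S v >].

Lemma sg_predP v : reflect (S v) (v \in sg_pred).
Proof. exact: asboolP. Qed.

Fact sg_zmod_closed : zmod_closed sg_pred.
Proof.
split; first by apply/sg_predP/sg0.
by move=> u v /sg_predP Su /sg_predP Sv; apply/sg_predP/sgB.
Qed.
HB.instance Definition _ := GRing.isZmodClosed.Build V sg_pred sg_zmod_closed.

Record zsub := ZSub { zval :> V; zvalP : zval \in sg_pred }.
HB.instance Definition _ := [isSub for zval].
HB.instance Definition _ := [Choice of zsub by <:].
HB.instance Definition _ := [SubChoice_isSubZmodule of zsub by <:].

Definition zquot : Type := Quotient.quot (GRing.ZmodClosed.clone V sg_pred _).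
HB.instance Definition _ := GRing.Zmodule.on zquot.

Definition zpi (v : V) : zquot := (\pi_(zquot) v)%qT.

Fact zpi_additive : zmod_morphism zpi.
Proof. by move=> u v; rewrite /zpi; exact: raddfB. Qed.
HB.instance Definition _ := GRing.isZmodMorphism.Build V zquot zpi zpi_additive.

Lemma zpi_eq0 v : (zpi v = 0) <-> S v.
Proof.
rewrite -(raddf0 zpi) /zpi; split.
  by move/eqP; rewrite -Quotient.idealrBE subr0 => /sg_predP.
by move=> /sg_predP Sv; apply/eqP; rewrite -Quotient.idealrBE subr0.
Qed.

Lemma zpi_surj (q : zquot) : exists v, q = zpi v.
Proof. by exists (repr q); rewrite /zpi reprK. Qed.

Lemma zpi_eq u v : (zpi u = zpi v) <-> S (u - v).
Proof.
rewrite -zpi_eq0 (raddfB (zpi)) /=; split=> [->|]; first by rewrite subrr.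
by move/eqP; rewrite subr_eq0 => /eqP.
Qed.

End SubQuotient.

Section QuotientMaps.
Variables (V W : zmodType) (S : subgrp V) (T : subgrp W).

Variables (f : {additive V -> W}) (fST : forall v, S v -> T (f v)).

Definition zquot_map of (forall v, S v -> T (f v)) :=
  fun q : zquot S => zpi T (f (repr q)).
Local Notation zqf := (zquot_map fST).

Lemma zquot_mapE v : zqf (zpi S v) = zpi T (f v).
Proof.
by rewrite /zquot_map; apply/zpi_eq; rewrite -raddfB; apply/fST/zpi_eq; rewrite /zpi reprK.
Qed.

Fact zquot_map_additive : zmod_morphism zqf.
Proof.
move=> p q; have [u ->] := zpi_surj p; have [v ->] := zpi_surj q.
by rewrite -raddfB !zquot_mapE !raddfB.
Qed.
HB.instance Definition _ :=
  GRing.isZmodMorphism.Build (zquot S) (zquot T) zqf zquot_map_additive.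

Definition zsub_map := fun v : zsub S =>
  @ZSub W T (f (zval v)) (introT (sg_predP T _) (fST (elimT (sg_predP S _) (zvalP v)))).
Local Notation zsf := zsub_map.

Fact zsub_map_additive : zmod_morphism zsf.
Proof. by move=> u v; apply: val_inj; rewrite /= raddfB. Qed.
HB.instance Definition _ :=
  GRing.isZmodMorphism.Build (zsub S) (zsub T) zsf zsub_map_additive.

End QuotientMaps.

Section LinSubQuotient.
Variables (k : fieldType) (V : lmodType k) (S : subspc V).

Definition lsub : Type := zsub S.
HB.instance Definition _ := GRing.Zmodule.on lsub.

Definition lsub_scale (a : k) (v : lsub) : lsub :=
  @ZSub V S (a *: zval v)
    (introT (sg_predP S _) (ssZ a (elimT (sg_predP S _) (zvalP v)))).

Fact lsub_scaleA a b v : lsub_scale a (lsub_scale b v) = lsub_scale (a * b) v.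
Proof. by apply: val_inj; rewrite /= scalerA. Qed.
Fact lsub_scale1 : left_id 1 lsub_scale.
Proof. by move=> v; apply: val_inj; rewrite /= scale1r. Qed.
Fact lsub_scaleDr : right_distributive lsub_scale +%R.
Proof. by move=> a u v; apply: val_inj; rewrite /= scalerDr. Qed.
Fact lsub_scaleDl v : {morph lsub_scale^~ v : a b / a + b}.
Proof. by move=> a b; apply: val_inj; rewrite /= scalerDl. Qed.
HB.instance Definition _ := GRing.Zmodule_isLmodule.Build k lsub
  lsub_scaleA lsub_scale1 lsub_scaleDr lsub_scaleDl.

Definition lval (v : lsub) : V := zval v.
Fact lval_linear : linear lval.
Proof. by []. Qed.
HB.instance Definition _ := GRing.isLinear.Build k lsub V *:%R lval lval_linear.

Lemma lval_inj : injective lval.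
Proof. exact: val_inj. Qed.

Lemma lvalP v : S (lval v).
Proof. exact: (elimT (sg_predP S _) (zvalP v)). Qed.

Definition lquot : Type := zquot S.
HB.instance Definition _ := GRing.Zmodule.on lquot.

Definition lpi (v : V) : lquot := zpi S v.
HB.instance Definition _ :=
  GRing.isZmodMorphism.Build V lquot lpi (@zpi_additive V S).

Definition lquot_scale (a : k) (q : lquot) : lquot := lpi (a *: repr q).

Fact lquot_scaleE a v : lquot_scale a (lpi v) = lpi (a *: v).
Proof.
apply/zpi_eq; rewrite -scalerBr; apply/ssZ/zpi_eq.
by rewrite /lpi /zpi reprK.
Qed.

Lemma lpi_surj (q : lquot) : exists v, q = lpi v.
Proof. exact: zpi_surj. Qed.

Lemma lpi_eq0 v : (lpi v = 0) <-> S v.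
Proof. exact: zpi_eq0. Qed.

Fact lquot_scaleA a b v : lquot_scale a (lquot_scale b v) = lquot_scale (a * b) v.
Proof. by have [u ->] := lpi_surj v; rewrite !lquot_scaleE scalerA. Qed.
Fact lquot_scale1 : left_id 1 lquot_scale.
Proof. by move=> v; have [u ->] := lpi_surj v; rewrite lquot_scaleE scale1r. Qed.
Fact lquot_scaleDr : right_distributive lquot_scale +%R.
Proof.
move=> a v w; have [u ->] := lpi_surj v; have [t ->] := lpi_surj w.
by rewrite !lquot_scaleE -(raddfD lpi) lquot_scaleE scalerDr (raddfD lpi).
Qed.
Fact lquot_scaleDl v : {morph lquot_scale^~ v : a b / a + b}.
Proof.
move=> a b; have [u ->] := lpi_surj v.
by rewrite !lquot_scaleE scalerDl (raddfD lpi).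
Qed.
HB.instance Definition _ := GRing.Zmodule_isLmodule.Build k lquot
  lquot_scaleA lquot_scale1 lquot_scaleDr lquot_scaleDl.

Fact lpi_scalable : scalable lpi.
Proof. by move=> a v; rewrite -[LHS]lquot_scaleE. Qed.
HB.instance Definition _ := GRing.isScalable.Build k V lquot *:%R lpi lpi_scalable.

End LinSubQuotient.

Section LinQuotientMaps.
Variables (k : fieldType) (V W : lmodType k) (S : subspc V) (T : subspc W).
Variables (f : {linear V -> W}) (fST : forall v, S v -> T (f v)).

Definition lquot_map : lquot S -> lquot T :=
  zquot_map fST.
Local Notation lqf := lquot_map.

Lemma lquot_mapE v : lqf (lpi S v) = lpi T (f v).
Proof. exact: zquot_mapE. Qed.

Fact lquot_map_linear : linear lqf.
Proof.
move=> a p q; have [u ->] := lpi_surj p; have [v ->] := lpi_surj q.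
by rewrite -linearP !lquot_mapE !linearP.
Qed.
HB.instance Definition _ :=
  GRing.isLinear.Build k (lquot S) (lquot T) *:%R lqf lquot_map_linear.

Definition lsub_map : lsub S -> lsub T :=
  zsub_map fST.
Local Notation lsf := lsub_map.

Lemma lsub_mapE v : lval (lsf v) = f (lval v).
Proof. by []. Qed.

Fact lsub_map_linear : linear lsf.
Proof. by move=> a u v; apply: lval_inj; rewrite !(linearP, lsub_mapE). Qed.
HB.instance Definition _ :=
  GRing.isLinear.Build k (lsub S) (lsub T) *:%R lsf lsub_map_linear.

End LinQuotientMaps.

Definition span_mem (k : fieldType) (V : lmodType k) (P : V -> Prop) (v : V) : Prop :=
  forall S : subspc V, (forall w, P w -> S w) -> S v.

Section Span.
Variables (k : fieldType) (V : lmodType k) (P : V -> Prop).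
Local Notation sp := (span_mem P).

Fact span0 : sp 0. Proof. by move=> S _; apply: sg0. Qed.
Fact spanB u v : sp u -> sp v -> sp (u - v).
Proof. by move=> hu hv S hS; apply: sgB; [apply: hu|apply: hv]. Qed.
Fact spanZ a v : sp v -> sp (a *: v).
Proof. by move=> hv S hS; apply/ssZ/hv. Qed.
Definition span : subspc V := SubSpc (ss_grp := SubGrp span0 spanB) spanZ.

Lemma span_in v : P v -> span v.
Proof. by move=> Pv S; apply. Qed.

End Span.

Section Preimage.
Variables (k : fieldType) (V W : lmodType k) (f : {linear V -> W}) (T : subspc W).
Fact pre0 : T (f 0). Proof. by rewrite raddf0; apply: sg0. Qed.
Fact preB u v : T (f u) -> T (f v) -> T (f (u - v)).
Proof. by rewrite raddfB; apply: sgB. Qed.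
Fact preZ a v : T (f v) -> T (f (a *: v)).
Proof. by rewrite linearZ; apply: ssZ. Qed.
Definition subspc_pre : subspc V := SubSpc (ss_grp := SubGrp pre0 preB) preZ.
End Preimage.

Lemma span_map (k : fieldType) (V W : lmodType k) (f : {linear V -> W})
    (P : V -> Prop) (Q : W -> Prop) :
  (forall v, P v -> span Q (f v)) -> forall v, span P v -> span Q (f v).
Proof. by move=> h v /(_ (subspc_pre f (span Q))); apply. Qed.

Section FreeModule.
Variables (k : fieldType) (K : choiceType) (V : lmodType k) (h : K -> V).

Definition mlift (g : {malg k[K]}) : V := \sum_(x <- msupp g) g@_x *: h x.

Lemma mliftEw (d : {fset K}) g :
  (msupp g `<=` d)%fset -> mlift g = \sum_(x <- d) g@_x *: h x.
Proof.
move=> le; rewrite /mlift [RHS](big_fsetID _ (mem (msupp g))) /=.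
rewrite [X in _ + X]big1_fset ?addr0; last first.
  by move=> x; rewrite !inE => /andP[_ /mcoeff_outdom->]; rewrite scale0r.
apply: eq_fbigl => x; rewrite !inE /=.
by apply/idP/andP => [hx|[]//]; split=> //; apply: (fsubsetP le).
Qed.

Fact mlift_linear : linear mlift.
Proof.
move=> a u v; pose d := (msupp u `|` msupp v `|` msupp (a *: u + v))%fset.
rewrite (@mliftEw d (a *: u + v)); last exact: fsubsetUr.
rewrite (@mliftEw d u); last by rewrite /d -fsetUA fsubsetUl.
rewrite (@mliftEw d v); last by rewrite /d fsetUAC fsubsetUr.
rewrite scaler_sumr -big_split; apply: eq_bigr => x _ /=.
by rewrite mcoeffD mcoeffZ scalerDl scalerA.
Qed.
HB.instance Definition _ := GRing.isLinear.Build k {malg k[K]} V *:%R mlift mlift_linear.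

Lemma mliftU x : mlift << x >> = h x.
Proof. by rewrite /mlift msuppU oner_eq0 big_seq_fset1 mcoeffUU scale1r. Qed.

End FreeModule.

Lemma malg_ext (k : fieldType) (K : choiceType) (V : lmodType k)
    (f g : {linear {malg k[K]} -> V}) :
  (forall x, f << x >> = g << x >>) -> f =1 g.
Proof.
move=> fg v; rewrite [v]monalgE !linear_sum; apply: eq_bigr => x _.
have -> : << v@_x *g x >> = v@_x *: (<< x >> : {malg k[K]}).
  by apply/malgP=> y; rewrite mcoeffZ !mcoeffU mulrnAr mulr1.
by rewrite !linearZ fg.
Qed.

Section Linearize.
Variables (k : fieldType) (K L : choiceType) (f : K -> L).
Definition malg_map : {malg k[K]} -> {malg k[L]} := mlift (fun x => << f x >>).
HB.instance Definition _ := GRing.Linear.on malg_map.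
Lemma malg_mapU x : malg_map << x >> = << f x >>.
Proof. exact: mliftU. Qed.
End Linearize.

Section Tensor.
Variables (k : fieldType) (V W : lmodType k).

Local Notation ten0 v w := (<< (v, w) >> : {malg k[(V * W)%type]}).

Inductive bilin_rel : {malg k[(V * W)%type]} -> Prop :=
| BilinDl v v' w : bilin_rel (ten0 (v + v') w - ten0 v w - ten0 v' w)
| BilinDr v w w' : bilin_rel (ten0 v (w + w') - ten0 v w - ten0 v w')
| BilinZl a v w : bilin_rel (ten0 (a *: v) w - a *: ten0 v w)
| BilinZr a v w : bilin_rel (ten0 v (a *: w) - a *: ten0 v w).

Definition tensor : Type := lquot (span bilin_rel).
HB.instance Definition _ := GRing.Lmodule.on tensor.

Definition ten_pi : {malg k[(V * W)%type]} -> tensor := lpi _.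
HB.instance Definition _ := GRing.Linear.on ten_pi.

Definition ten (v : V) (w : W) : tensor := ten_pi << (v, w) >>.

Lemma tensor_ext (U : lmodType k) (f g : {linear tensor -> U}) :
  (forall v w, f (ten v w) = g (ten v w)) -> f =1 g.
Proof.
move=> fg t; have [u ->] := lpi_surj t.
by apply: (malg_ext (f := f \o ten_pi) (g := g \o ten_pi)) => -[v w]; apply: fg.
Qed.

End Tensor.

Section TensorMap.
Variables (k : fieldType) (V V' W W' : lmodType k).
Variables (f : {linear V -> V'}) (g : {linear W -> W'}).

Local Notation fg := (malg_map (k := k) (fun p : V * W => (f p.1, g p.2))).

Fact tensor_map_proof u : span (@bilin_rel k V W) u -> span (@bilin_rel k V' W') (fg u).
Proof.
apply: span_map => {u} _ [v v' w|v w w'|a v w|a v w].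
- by rewrite !linearB /= !malg_mapU /= linearD; apply/span_in/BilinDl.
- by rewrite !linearB /= !malg_mapU /= linearD; apply/span_in/BilinDr.
- by rewrite linearB linearZ /= !malg_mapU /= linearZ; apply/span_in/BilinZl.
- by rewrite linearB linearZ /= !malg_mapU /= linearZ; apply/span_in/BilinZr.
Qed.

Definition tensor_map : tensor V W -> tensor V' W' := lquot_map tensor_map_proof.
HB.instance Definition _ := GRing.Linear.on tensor_map.

Lemma tensor_mapE v w : tensor_map (ten v w) = ten (f v) (g w).
Proof. by rewrite /tensor_map /ten /ten_pi lquot_mapE /= malg_mapU. Qed.

End TensorMap.

#[local] Obligation Tactic := idtac.

Record addcat := AddCat {
  obj :> Type;
  hom : obj -> obj -> zmodType;
  idm : forall x, hom x x;
  cmp : forall x y z, hom y z -> hom x y -> hom x z;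
  cmpA : forall x y z t (h : hom z t) (g : hom y z) (f : hom x y),
    cmp h (cmp g f) = cmp (cmp h g) f;
  cmp1m : forall x y (f : hom x y), cmp (idm y) f = f;
  cmpm1 : forall x y (f : hom x y), cmp f (idm x) = f;
  cmpDl : forall x y z (g g' : hom y z) (f : hom x y),
    cmp (g + g') f = cmp g f + cmp g' f;
  cmpDr : forall x y z (g : hom y z) (f f' : hom x y),
    cmp g (f + f') = cmp g f + cmp g f';
  zob : obj;
  zobP : idm zob = 0;
  bip : obj -> obj -> obj;
  in1 : forall x a, hom x (bip x a);
  in2 : forall x a, hom a (bip x a);
  pr1 : forall x a, hom (bip x a) x;
  pr2 : forall x a, hom (bip x a) a;
  pr1_in1 : forall x a, cmp (pr1 x a) (in1 x a) = idm x;
  pr2_in2 : forall x a, cmp (pr2 x a) (in2 x a) = idm a;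
  pr1_in2 : forall x a, cmp (pr1 x a) (in2 x a) = 0;
  pr2_in1 : forall x a, cmp (pr2 x a) (in1 x a) = 0;
  bipE : forall x a,
    cmp (in1 x a) (pr1 x a) + cmp (in2 x a) (pr2 x a) = idm (bip x a) }.

Arguments idm {_} _.
Arguments in1 {_} _ _.
Arguments in2 {_} _ _.
Arguments pr1 {_} _ _.
Arguments pr2 {_} _ _.

Notation "g '\oc' f" := (cmp g f) (at level 40, left associativity) : ring_scope.

Definition isom (C : addcat) (x y : C) : Prop :=
  exists (f : hom x y) (g : hom y x), g \oc f = idm x /\ f \oc g = idm y.

(* Small sets are the carriers of a choiceType, among which the groups [hom x y];
   the universe of [obj C] is not bounded by theirs. *)
Definition essentially_small (C : addcat) : Prop :=
  exists (I : choiceType) (r : I -> C), forall x : C, exists i, isom (r i) x.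

Definition k_trivial (k : fieldType) (C : addcat) : Prop :=
  forall x y : C, exists (n : nat) (e : 'I_n -> hom x y),
    bijective e /\ (n%:R : k) \is a GRing.unit.

Section Matrices.
Variable C : addcat.
Implicit Types x y z a b c : C.

Lemma cmp0m x y z (f : hom x y) : (0 : hom y z) \oc f = 0.
Proof. by apply: (addrI (0 \oc f)); rewrite -cmpDl !addr0. Qed.

Lemma cmpm0 x y z (f : hom y z) : f \oc (0 : hom x y) = 0.
Proof. by apply: (addrI (f \oc 0)); rewrite -cmpDr !addr0. Qed.

(* The morphism x (+) a -> y (+) b with matrix [p q; r s], acting on columns. *)
Definition bmat x a y b (p : hom x y) (q : hom a y) (r : hom x b) (s : hom a b) :
    hom (bip x a) (bip y b) :=
  in1 y b \oc (p \oc pr1 x a) + in1 y b \oc (q \oc pr2 x a)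
  + (in2 y b \oc (r \oc pr1 x a) + in2 y b \oc (s \oc pr2 x a)).

Lemma pr1_bmat x a y b (p : hom x y) (q : hom a y) (r : hom x b) (s : hom a b) :
  pr1 y b \oc bmat p q r s = p \oc pr1 x a + q \oc pr2 x a.
Proof.
by rewrite /bmat !cmpDr !cmpA pr1_in1 pr1_in2 !cmp1m !cmp0m !addr0.
Qed.

Lemma pr2_bmat x a y b (p : hom x y) (q : hom a y) (r : hom x b) (s : hom a b) :
  pr2 y b \oc bmat p q r s = r \oc pr1 x a + s \oc pr2 x a.
Proof.
by rewrite /bmat !cmpDr !cmpA pr2_in1 pr2_in2 !cmp1m !cmp0m !add0r.
Qed.

Lemma bmat_ext z y b (f g : hom z (bip y b)) :
  pr1 y b \oc f = pr1 y b \oc g -> pr2 y b \oc f = pr2 y b \oc g -> f = g.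
Proof.
move=> h1 h2; rewrite -(cmp1m f) -(cmp1m g) -bipE !cmpDl.
by rewrite -!cmpA h1 h2.
Qed.

Lemma bmat_cmp x a y b z c (p : hom x y) (q : hom a y) (r : hom x b) (s : hom a b)
    (p' : hom y z) (q' : hom b z) (r' : hom y c) (s' : hom b c) :
  bmat p' q' r' s' \oc bmat p q r s =
  bmat (p' \oc p + q' \oc r) (p' \oc q + q' \oc s)
       (r' \oc p + s' \oc r) (r' \oc q + s' \oc s).
Proof.
apply: bmat_ext; rewrite cmpA.
  by rewrite !pr1_bmat !cmpDl -!cmpA pr1_bmat pr2_bmat !cmpDr !cmpA addrACA.
by rewrite !pr2_bmat !cmpDl -!cmpA pr1_bmat pr2_bmat !cmpDr !cmpA addrACA.
Qed.

Lemma bmat_in2 x a y b (p : hom x y) (q : hom a y) (r : hom x b) (s : hom a b) :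
  bmat p q r s \oc in2 x a = in1 y b \oc q + in2 y b \oc s.
Proof.
rewrite /bmat !cmpDl -!cmpA pr1_in2 pr2_in2 !cmpm1 !cmpm0.
by rewrite !add0r.
Qed.

Lemma bmat1 x a : bmat (idm x) 0 0 (idm a) = idm (bip x a).
Proof. by rewrite /bmat !cmp1m !cmp0m !cmpm0 addr0 add0r bipE. Qed.

End Matrices.

Record rep (C : addcat) := Rep {
  rob :> C -> zmodType;
  rmap : forall x y, hom x y -> {additive rob x -> rob y};
  rmap1 : forall x v, rmap (idm x) v = v;
  rmapM : forall x y z (g : hom y z) (f : hom x y) v,
    rmap (g \oc f) v = rmap g (rmap f v);
  rmapD : forall x y (f g : hom x y) v, rmap (f + g) v = rmap f v + rmap g v }.

Record rhom (C : addcat) (A B : rep C) := RHom {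
  rcomp :> forall x, {additive A x -> B x};
  rnat : forall x y (f : hom x y) v, rcomp y (rmap A f v) = rmap B f (rcomp x v) }.

Definition rhom_id (C : addcat) (A : rep C) : rhom A A :=
  @RHom C A A (fun x => (idfun : {additive A x -> A x})) (fun x y f v => erefl).

Program Definition rhom_cmp (C : addcat) (A B D : rep C) (g : rhom B D) (f : rhom A B) :
    rhom A D :=
  @RHom C A D (fun x => (g x \o f x : {additive A x -> D x})) _.
Next Obligation. by move=> C A B D g f x y u v; rewrite /= !rnat. Qed.

Definition rep_iso (C : addcat) (A B : rep C) : Prop :=
  exists (f : rhom A B) (g : rhom B A), forall x, cancel (f x) (g x) /\ cancel (g x) (f x).

Record aut (C : addcat) (A : rep C) := Aut {
  afun :> rhom A A;
  ainv : rhom A A;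
  autK : forall x, cancel (afun x) (ainv x);
  autVK : forall x, cancel (ainv x) (afun x) }.

Definition aut1 (C : addcat) (A : rep C) : aut A :=
  @Aut C A (rhom_id A) (rhom_id A) (fun x v => erefl) (fun x v => erefl).

Program Definition autM (C : addcat) (A : rep C) (g h : aut A) : aut A :=
  @Aut C A (rhom_cmp g h) (rhom_cmp (ainv h) (ainv g)) _ _.
Next Obligation. by move=> C A g h x v; rewrite /= autK autK. Qed.
Next Obligation. by move=> C A g h x v; rewrite /= autVK autVK. Qed.

Record rsub (C : addcat) (A : rep C) := RSub {
  rsgrp :> forall x, subgrp (A x);
  rsub_map : forall x y (f : hom x y) v, rsgrp x v -> rsgrp y (rmap A f v) }.

Definition rsub_zero (C : addcat) (A : rep C) (B : rsub A) : Prop :=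
  forall x v, B x v -> v = 0.
Definition rsub_full (C : addcat) (A : rep C) (B : rsub A) : Prop :=
  forall x v, B x v.
Definition rsub_le (C : addcat) (A : rep C) (B D : rsub A) : Prop :=
  forall x v, B x v -> D x v.

Definition rzero (C : addcat) (A : rep C) : Prop := forall x (v : A x), v = 0.

Section RepSubQuot.
Variables (C : addcat) (A : rep C) (B : rsub A).

Program Definition rsub_rep : rep C :=
  @Rep C (fun x => zsub (B x))
    (fun x y f => (zsub_map (f := rmap A f) (@rsub_map C A B x y f)
                    : {additive zsub (B x) -> zsub (B y)})) _ _ _.
Next Obligation. by move=> x v; apply: val_inj; rewrite /= rmap1. Qed.
Next Obligation. by move=> x y z g f v; apply: val_inj; rewrite /= rmapM. Qed.
Next Obligation. by move=> x y f g v; apply: val_inj; rewrite /= rmapD. Qed.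

Program Definition rincl : rhom rsub_rep A :=
  @RHom C rsub_rep A (fun x => (val : {additive zsub (B x) -> A x})) _.
Next Obligation. by []. Qed.

Program Definition rquot : rep C :=
  @Rep C (fun x => zquot (B x))
    (fun x y f => (zquot_map (f := rmap A f) (@rsub_map C A B x y f)
                    : {additive zquot (B x) -> zquot (B y)})) _ _ _.
Next Obligation.
by move=> x q; have [v ->] := zpi_surj q; rewrite /= zquot_mapE rmap1.
Qed.
Next Obligation.
by move=> x y z g f q; have [v ->] := zpi_surj q; rewrite /= !zquot_mapE rmapM.
Qed.
Next Obligation.
move=> x y f g q; have [v ->] := zpi_surj q.
by rewrite /= !zquot_mapE rmapD; apply: (raddfD (zpi (B y))).
Qed.

Program Definition rpi : rhom A rquot :=
  @RHom C A rquot (fun x => (zpi (B x) : {additive A x -> zquot (B x)})) _.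
Next Obligation. by move=> x y f v; rewrite /= zquot_mapE. Qed.

End RepSubQuot.

Program Definition rsub_pre (C : addcat) (A B : rep C) (f : rhom A B) (D : rsub B) :
    rsub A :=
  @RSub C A (fun x => @SubGrp (A x) (fun v => D x (f x v)) _ _) _.
Next Obligation. by move=> C A B f D x; rewrite /= raddf0; apply: sg0. Qed.
Next Obligation. by move=> C A B f D x u v; rewrite /= raddfB; apply: sgB. Qed.
Next Obligation. by move=> C A B f D x y u v; rewrite /= rnat; apply: rsub_map. Qed.

Definition rsimple (C : addcat) (A : rep C) : Prop :=
  ~ rzero A /\ forall B : rsub A, rsub_zero B \/ rsub_full B.

(* A composition series 0 = s 0 <= s 1 <= ... <= s n = A; to form the quotient
   s (i+1) / s i, the subobject s i is pulled back to s (i+1). *)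
Definition has_length (C : addcat) (A : rep C) (n : nat) : Prop :=
  exists s : nat -> rsub A,
    [/\ rsub_zero (s 0%N), rsub_full (s n) &
        forall i, (i < n)%N -> rsub_le (s i) (s i.+1) /\
          rsimple (rquot (rsub_pre (rincl (s i.+1)) (s i)))].

Definition finite_length (C : addcat) (A : rep C) : Prop :=
  exists n, has_length A n.

Definition directed_up (C : addcat) (A : rep C) (D : rsub A -> Prop) : Prop :=
  (exists B, D B) /\
  forall B B', D B -> D B' -> exists2 B'', D B'' & rsub_le B B'' /\ rsub_le B' B''.

Definition directed_down (C : addcat) (A : rep C) (D : rsub A -> Prop) : Prop :=
  (exists B, D B) /\
  forall B B', D B -> D B' -> exists2 B'', D B'' & rsub_le B'' B /\ rsub_le B'' B'.

Definition finitely_generated (C : addcat) (A : rep C) : Prop :=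
  forall D : rsub A -> Prop, directed_up D ->
    (forall S : rsub A, (forall B, D B -> rsub_le B S) -> rsub_full S) ->
    exists2 B, D B & rsub_full B.

Definition finitely_cogenerated (C : addcat) (A : rep C) : Prop :=
  forall D : rsub A -> Prop, directed_down D ->
    (forall x (v : A x), (forall B, D B -> B x v) -> v = 0) ->
    exists2 B, D B & rsub_zero B.

(* The objects of finite length form a generating class: they separate
   morphisms. *)
Definition locally_finite (C : addcat) : Prop :=
  forall (A B : rep C) (f g : rhom A B),
    (forall (T : rep C) (h : rhom T A), finite_length T ->
       forall x v, f x (h x v) = g x (h x v)) ->
    forall x v, f x v = g x v.

Definition length_representatives (C : addcat) (L : nat -> rep C -> Prop) : Prop :=
  forall n,
    [/\ forall A, L n A -> has_length A n,
        forall A B, L n A -> L n B -> rep_iso A B -> A = B &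
        forall A, has_length A n -> exists2 B, L n B & rep_iso A B].

Record fct (k : fieldType) (C : addcat) := Fct {
  fob :> C -> lmodType k;
  fact : forall x y, hom x y -> {linear fob x -> fob y};
  fact1 : forall x v, fact (idm x) v = v;
  factM : forall x y z (g : hom y z) (f : hom x y) v,
    fact (g \oc f) v = fact g (fact f v) }.

Record fhom (k : fieldType) (C : addcat) (F G : fct k C) := FHom {
  fcomp :> forall x, {linear F x -> G x};
  fnat : forall x y (f : hom x y) v, fcomp y (fact F f v) = fact G f (fcomp x v) }.

Program Definition fhom_cmp (k : fieldType) (C : addcat) (F G H : fct k C)
    (g : fhom G H) (f : fhom F G) : fhom F H :=
  @FHom k C F H (fun x => (g x \o f x : {linear F x -> H x})) _.
Next Obligation. by move=> k C F G H g f x y u v; rewrite /= !fnat. Qed.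

Definition fct_iso (k : fieldType) (C : addcat) (F G : fct k C) : Prop :=
  exists (f : fhom F G) (g : fhom G F), forall x, cancel (f x) (g x) /\ cancel (g x) (f x).

Record fsub (k : fieldType) (C : addcat) (F : fct k C) := FSub {
  fspc :> forall x, subspc (F x);
  fsub_map : forall x y (f : hom x y) v, fspc x v -> fspc y (fact F f v) }.

Definition fsub_zero (k : fieldType) (C : addcat) (F : fct k C) (S : fsub F) : Prop :=
  forall x v, S x v -> v = 0.
Definition fsub_full (k : fieldType) (C : addcat) (F : fct k C) (S : fsub F) : Prop :=
  forall x v, S x v.
Definition fzero (k : fieldType) (C : addcat) (F : fct k C) : Prop :=
  forall x (v : F x), v = 0.

Section FctSubQuot.
Variables (k : fieldType) (C : addcat) (F : fct k C) (S : fsub F).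

Program Definition fsub_fct : fct k C :=
  @Fct k C (fun x => lsub (S x))
    (fun x y f => (lsub_map (f := fact F f) (@fsub_map k C F S x y f)
                    : {linear lsub (S x) -> lsub (S y)})) _ _.
Next Obligation. by move=> x v; apply: val_inj; rewrite /= fact1. Qed.
Next Obligation. by move=> x y z g f v; apply: val_inj; rewrite /= factM. Qed.

Program Definition fincl : fhom fsub_fct F :=
  @FHom k C fsub_fct F (fun x => (@lval k _ (S x) : {linear lsub (S x) -> F x})) _.
Next Obligation. by []. Qed.

Program Definition fquot : fct k C :=
  @Fct k C (fun x => lquot (S x))
    (fun x y f => (lquot_map (f := fact F f) (@fsub_map k C F S x y f)
                    : {linear lquot (S x) -> lquot (S y)})) _ _.
Next Obligation.
by move=> x q; have [v ->] := lpi_surj q; rewrite /= lquot_mapE fact1.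
Qed.
Next Obligation.
by move=> x y z g f q; have [v ->] := lpi_surj q; rewrite /= !lquot_mapE factM.
Qed.

Program Definition fpi : fhom F fquot :=
  @FHom k C F fquot (fun x => (lpi (S x) : {linear F x -> lquot (S x)})) _.
Next Obligation. by move=> x y f v; rewrite /= lquot_mapE. Qed.

End FctSubQuot.

Program Definition fimage (k : fieldType) (C : addcat) (F G : fct k C)
    (f : fhom F G) : fsub G :=
  @FSub k C G (fun x => @SubSpc k (G x)
     (@SubGrp (G x) (fun w => exists v, w = f x v) _ _) _) _.
Next Obligation. by move=> k C F G f x; exists 0; rewrite /= raddf0. Qed.
Next Obligation.
by move=> k C F G f x _ _ [u ->] [v ->]; exists (u - v); rewrite raddfB.
Qed.
Next Obligation.
by move=> k C F G f x a _ [u ->]; exists (a *: u); rewrite linearZ.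
Qed.
Next Obligation.
by move=> k C F G f x y u _ [v ->]; exists (fact F u v); rewrite fnat.
Qed.

Program Definition fker (k : fieldType) (C : addcat) (F G : fct k C)
    (f : fhom F G) : fsub F :=
  @FSub k C F (fun x => @SubSpc k (F x)
     (@SubGrp (F x) (fun v => f x v = 0) _ _) _) _.
Next Obligation. by move=> k C F G f x; rewrite /= raddf0. Qed.
Next Obligation. by move=> k C F G f x u v /= hu hv; rewrite linearB /= hu hv subr0. Qed.
Next Obligation. by move=> k C F G f x a u /= hu; rewrite linearZ /= hu scaler0. Qed.
Next Obligation. by move=> k C F G f x y u v /= hv; rewrite fnat hv linear0. Qed.

Definition fcoker (k : fieldType) (C : addcat) (F G : fct k C) (f : fhom F G) : fct k C :=
  fquot (fimage f).

Program Definition fsum (k : fieldType) (C : addcat) (F : fct k C)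
    (D : fsub F -> Prop) : fsub F :=
  @FSub k C F (fun x => span (fun v => exists2 S, D S & S x v)) _.
Next Obligation.
move=> k C F D x y f v; apply: span_map => {}v [S DS Sv].
by apply: span_in; exists S => //; apply: fsub_map.
Qed.

Program Definition fcap (k : fieldType) (C : addcat) (F : fct k C)
    (D : fsub F -> Prop) : fsub F :=
  @FSub k C F (fun x => @SubSpc k (F x)
     (@SubGrp (F x) (fun v => forall S, D S -> S x v) _ _) _) _.
Next Obligation. by move=> k C F D x S _; apply: sg0. Qed.
Next Obligation. by move=> k C F D x u v hu hv S DS; apply: sgB; auto. Qed.
Next Obligation. by move=> k C F D x a u hu S DS; apply: ssZ; apply: hu. Qed.
Next Obligation. by move=> k C F D x y f v hv S DS; apply/fsub_map/hv. Qed.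

(* Simple objects of the full subcategory P of F(A; k): only the subfunctors
   that belong to P count as subobjects. *)
Definition simple_in (k : fieldType) (C : addcat) (P : fct k C -> Prop) (F : fct k C) :
    Prop :=
  [/\ P F, ~ fzero F &
      forall S : fsub F, P (fsub_fct S) -> fsub_zero S \/ fsub_full S].

Section Shift.
Variables (k : fieldType) (C : addcat).

Program Definition tau (x : C) (F : fct k C) : fct k C :=
  @Fct k C (fun a => F (bip x a)) (fun a b f => fact F (bmat (idm x) 0 0 f)) _ _.
Next Obligation. by move=> x F a v; rewrite /= bmat1 fact1. Qed.
Next Obligation.
move=> x F a b c g f v; rewrite /= -factM bmat_cmp.
by rewrite !cmp1m !cmpm0 !cmp0m !addr0 add0r.
Qed.

Definition shear (x a : C) (u : hom x a) : hom (bip x a) (bip x a) :=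
  bmat (idm x) 0 u (idm a).

Program Definition shear_sub (x : C) (F : fct k C) : fsub (tau x F) :=
  @FSub k C (tau x F)
    (fun a => span (fun w : F (bip x a) =>
       exists (u : hom x a) (v : F (bip x a)), w = fact F (shear u) v - v)) _.
Next Obligation.
move=> x F a b f w; apply: span_map => {}w [u [v ->]].
apply: span_in; exists (f \oc u), (fact F (bmat (idm x) 0 0 f) v).
rewrite /= linearB /=; congr (_ - _); rewrite -[LHS]factM -[RHS]factM /shear !bmat_cmp.
by rewrite !(cmp1m, cmpm1, cmpm0, cmp0m, addr0, add0r).
Qed.

Definition taubar (x : C) (F : fct k C) : fct k C := fquot (shear_sub x F).

Program Definition tau_in (x : C) (F : fct k C) : fhom F (tau x F) :=
  @FHom k C F (tau x F) (fun a => fact F (in2 x a)) _.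
Next Obligation.
move=> x F a b f v; rewrite /= -!factM bmat_in2.
by rewrite cmpm0 add0r.
Qed.

Definition deltabar (x : C) (F : fct k C) : fct k C :=
  fcoker (fhom_cmp (fpi (shear_sub x F)) (tau_in x F)).

(* deltabar_{a 0} (... (deltabar_{a (n - 1)} F)) *)
Fixpoint deltabars (a : nat -> C) (n : nat) (F : fct k C) : fct k C :=
  if n is m.+1 then deltabars a m (deltabar (a m) F) else F.

(* The index is shifted so as to start at 0: this is F_{n - 1}(A; k). *)
Definition poly_lt (n : nat) (F : fct k C) : Prop :=
  forall (a : nat -> C) (x : C), fzero (deltabars a n (tau x F)).

Definition poly_le (d : nat) : fct k C -> Prop := poly_lt d.+1.

Definition all_fct : fct k C -> Prop := fun=> True.

End Shift.

Section Linearization.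
Variables (k : fieldType) (C : addcat).

Program Definition klin (A : rep C) : fct k C :=
  @Fct k C (fun x => {malg k[A x]})
    (fun x y f => (malg_map (rmap A f) : {linear {malg k[A x]} -> {malg k[A y]}})) _ _.
Next Obligation.
move=> A x; apply: (@malg_ext _ _ _ (malg_map (rmap A (idm x))) idfun) => v.
by rewrite /= malg_mapU rmap1.
Qed.
Next Obligation.
move=> A x y z g f; apply: (@malg_ext _ _ _ (malg_map (rmap A (g \oc f)))
  (malg_map (rmap A g) \o malg_map (rmap A f))) => v.
by rewrite /= !malg_mapU rmapM.
Qed.

Program Definition klin_map (A B : rep C) (f : rhom A B) : fhom (klin A) (klin B) :=
  @FHom k C (klin A) (klin B)
    (fun x => (malg_map (f x) : {linear {malg k[A x]} -> {malg k[B x]}})) _.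
Next Obligation.
move=> A B f x y u; apply: (@malg_ext _ _ _ (malg_map (f y) \o malg_map (rmap A u))
  (malg_map (rmap B u) \o malg_map (f x))) => v.
by rewrite /= !malg_mapU rnat.
Qed.

Lemma klin_map_cmp (A B D : rep C) (g : rhom B D) (f : rhom A B) (h : rhom A D) :
  (forall x v, h x v = g x (f x v)) ->
  forall x v, klin_map h x v = klin_map g x (klin_map f x v).
Proof.
move=> hE x; apply: (@malg_ext _ _ _ (malg_map (h x))
  (malg_map (g x) \o malg_map (f x))) => v.
by rewrite /= !malg_mapU hE.
Qed.

Lemma klin_map_id (A : rep C) x v : klin_map (rhom_id A) x v = v.
Proof.
move: v; apply: (@malg_ext _ _ _ (malg_map (rhom_id A x)) idfun) => v.
by rewrite /= malg_mapU.
Qed.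

(* The image of the direct sum of the k[B], for B a proper subobject of A, is the
   sum of their images. *)
Definition proper_part (A : rep C) : fsub (klin A) :=
  fsum (fun S => exists2 B : rsub A, ~ rsub_full B & S = fimage (klin_map (rincl B))).

Definition Qlow (A : rep C) : fct k C := fquot (proper_part A).

(* The kernel of the morphism from k[A] to the product of the k[A/B], for B a
   nonzero subobject of A, is the intersection of the kernels. *)
Definition Qup_sub (A : rep C) : fsub (klin A) :=
  fcap (fun S => exists2 B : rsub A, ~ rsub_zero B & S = fker (klin_map (rpi B))).

Definition Qup (A : rep C) : fct k C := fsub_fct (Qup_sub A).

End Linearization.

(* A k[Aut A]-module, unfolded as a k-linear representation of Aut A. The type
   [aut A] quantifies over the objects of C, so making it a groupType or forming
   a ring of functions on it would force [obj C] into the universe of small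
   sets. *)
Record autmod (k : fieldType) (C : addcat) (A : rep C) := AutMod {
  am_spc :> lmodType k;
  am_act : aut A -> {linear am_spc -> am_spc};
  am_act1 : forall m, am_act (aut1 A) m = m;
  am_actM : forall g h m, am_act (autM g h) m = am_act g (am_act h m) }.

Definition autmod_iso (k : fieldType) (C : addcat) (A : rep C) (M N : autmod k A) : Prop :=
  exists (f : {linear M -> N}) (f' : {linear N -> M}),
    [/\ cancel f f', cancel f' f &
        forall g m, f (am_act M g m) = am_act N g (f m)].

Definition simple_autmod (k : fieldType) (C : addcat) (A : rep C) (M : autmod k A) : Prop :=
  (exists m : M, m != 0) /\
  forall S : subspc M, (forall g m, S m -> S (am_act M g m)) ->
    (forall m, S m -> m = 0) \/ (forall m, S m).

Record autfct (k : fieldType) (C : addcat) (A : rep C) := AutFct {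
  af_fct :> fct k C;
  af_act : aut A -> fhom af_fct af_fct;
  af_act1 : forall x v, af_act (aut1 A) x v = v;
  af_actM : forall g h x v, af_act (autM g h) x v = af_act g x (af_act h x v) }.

Definition equivariant (k : fieldType) (C : addcat) (A : rep C) (X Y : autfct k A)
    (f : fhom X Y) : Prop :=
  forall g x v, f x (af_act X g x v) = af_act Y g x (f x v).

Section Actions.
Variables (k : fieldType) (C : addcat) (A : rep C).

Program Definition klin_aut : autfct k A :=
  @AutFct k C A (klin k A) (fun g => klin_map k g) _ _.
Next Obligation. exact: klin_map_id. Qed.
Next Obligation. by move=> g h; apply: klin_map_cmp. Qed.

Section Stable.
Variables (X : autfct k A) (S : fsub X).
Hypothesis stS : forall g x v, S x v -> S x (af_act X g x v).

Program Definition sub_autfct : autfct k A :=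
  @AutFct k C A (fsub_fct S) (fun g => @FHom k C (fsub_fct S) (fsub_fct S)
    (fun x => (lsub_map (f := af_act X g x) (stS g (x := x))
       : {linear lsub (S x) -> lsub (S x)})) _) _ _.
Next Obligation. by move=> g x y f v; apply: val_inj; rewrite /= fnat. Qed.
Next Obligation. by move=> x v; apply: val_inj; rewrite /= af_act1. Qed.
Next Obligation. by move=> g h x v; apply: val_inj; rewrite /= af_actM. Qed.

Lemma fincl_equivariant : equivariant (X := sub_autfct) (Y := X) (fincl S).
Proof. by []. Qed.

Program Definition quot_autfct : autfct k A :=
  @AutFct k C A (fquot S) (fun g => @FHom k C (fquot S) (fquot S)
    (fun x => (lquot_map (f := af_act X g x) (stS g (x := x))
       : {linear lquot (S x) -> lquot (S x)})) _) _ _.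
Next Obligation.
by move=> g x y f q; have [v ->] := lpi_surj q; rewrite /= !lquot_mapE fnat.
Qed.
Next Obligation.
by move=> x q; have [v ->] := lpi_surj q; rewrite /= lquot_mapE af_act1.
Qed.
Next Obligation.
by move=> g h x q; have [v ->] := lpi_surj q; rewrite /= !lquot_mapE af_actM.
Qed.

Lemma fpi_equivariant : equivariant (X := X) (Y := quot_autfct) (fpi S).
Proof. by move=> g x v; rewrite /= lquot_mapE. Qed.

End Stable.

Lemma proper_part_stable (g : aut A) x v :
  proper_part k A x v -> proper_part k A x (klin_map k g x v).
Proof.
apply: span_map => {}v [_ [B pB ->] [w ->]].
pose gB := rsub_pre (ainv g) B.
have gBP y u : B y u -> gB y (g y u) by rewrite /gB /= autK.
apply: span_in; exists (fimage (klin_map k (rincl gB))).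
  exists gB => // h; apply: pB => y u.
  by rewrite -[u](autK g); apply: (h y (g y u)).
have natP y z (u : hom y z) (t : zsub (B y)) :
    zsub_map (f := g z) (@gBP z) (rmap (rsub_rep B) u t)
    = rmap (rsub_rep gB) u (zsub_map (f := g y) (@gBP y) t).
  by apply: val_inj; rewrite /= rnat.
pose f : rhom (rsub_rep B) (rsub_rep gB) := @RHom C (rsub_rep B) (rsub_rep gB)
  (fun y => zsub_map (f := g y) (@gBP y)) natP.
exists (klin_map k f x w).
rewrite -(klin_map_cmp (h := rhom_cmp g (rincl B))) //.
exact: klin_map_cmp.
Qed.

Lemma Qup_stable (g : aut A) x v :
  Qup_sub k A x v -> Qup_sub k A x (klin_map k g x v).
Proof.
move=> hv _ [B nB ->]; pose gB := rsub_pre g B.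
have gBP y u : gB y u -> B y (g y u) by [].
have natP y z (u : hom y z) (q : zquot (gB y)) :
    zquot_map (f := g z) (@gBP z) (rmap (rquot gB) u q)
    = rmap (rquot B) u (zquot_map (f := g y) (@gBP y) q).
  by have [t ->] := zpi_surj q; rewrite /= !zquot_mapE rnat.
pose f : rhom (rquot gB) (rquot B) := @RHom C (rquot gB) (rquot B)
  (fun y => zquot_map (f := g y) (@gBP y)) natP.
rewrite -[fker _ x _]/(klin_map k (rpi B) x (klin_map k g x v) = 0).
suff -> : klin_map k (rpi B) x (klin_map k g x v)
        = klin_map k f x (klin_map k (rpi gB) x v).
  rewrite (_ : klin_map k (rpi gB) x v = 0) ?raddf0 //.
  apply: (hv (fker (klin_map k (rpi gB)))); exists gB => // h; apply: nB => y u Bu.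
  by rewrite -[u](autVK g) (h y (ainv g y u)) ?raddf0 //= autVK.
rewrite -(klin_map_cmp (h := rhom_cmp (rpi B) g)) //.
by apply: klin_map_cmp => y u; rewrite /= zquot_mapE.
Qed.

Definition Qlow_aut : autfct k A := quot_autfct (X := klin_aut) proper_part_stable.
Definition Qup_aut : autfct k A := sub_autfct (X := klin_aut) Qup_stable.

Program Definition ten_autfct (M : autmod k A) (X : autfct k A) : autfct k A :=
  @AutFct k C A
    (@Fct k C (fun x => tensor M (X x))
       (fun x y f => (tensor_map idfun (fact X f)
          : {linear tensor M (X x) -> tensor M (X y)})) _ _)
    (fun g => @FHom k C _ _
       (fun x => (tensor_map (am_act M g) (af_act X g x)
          : {linear tensor M (X x) -> tensor M (X x)})) _) _ _.
Next Obligation.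
move=> M X x; apply: (@tensor_ext _ _ _ _ (tensor_map idfun (fact X (idm x))) idfun).
by move=> m v; rewrite /= tensor_mapE fact1.
Qed.
Next Obligation.
move=> M X x y z g f; apply: (@tensor_ext _ _ _ _ (tensor_map idfun (fact X (g \oc f)))
  (tensor_map idfun (fact X g) \o tensor_map idfun (fact X f))).
by move=> m v; rewrite /= !tensor_mapE factM.
Qed.
Next Obligation.
move=> M X g x y f; apply: (@tensor_ext _ _ _ _
  (tensor_map (am_act M g) (af_act X g y) \o tensor_map idfun (fact X f))
  (tensor_map idfun (fact X f) \o tensor_map (am_act M g) (af_act X g x))).
by move=> m v; rewrite /= !tensor_mapE fnat.
Qed.
Next Obligation.
move=> M X x; apply: (@tensor_ext _ _ _ _
  (tensor_map (am_act M (aut1 A)) (af_act X (aut1 A) x)) idfun).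
by move=> m v; rewrite /= tensor_mapE am_act1 af_act1.
Qed.
Next Obligation.
move=> M X g h x; apply: (@tensor_ext _ _ _ _
  (tensor_map (am_act M (autM g h)) (af_act X (autM g h) x))
  (tensor_map (am_act M g) (af_act X g x) \o tensor_map (am_act M h) (af_act X h x))).
by move=> m v; rewrite /= !tensor_mapE am_actM af_actM.
Qed.

Program Definition coinv_sub (X : autfct k A) : fsub X :=
  @FSub k C X (fun x => span (fun w => exists g v, w = af_act X g x v - v)) _.
Next Obligation.
move=> X x y f w; apply: span_map => {}w [g [v ->]].
by apply: span_in; exists g, (fact X f v); rewrite linearB /= fnat.
Qed.

Definition coinv (X : autfct k A) : fct k C := fquot (coinv_sub X).

Lemma coinv_map_proof (X Y : autfct k A) (f : fhom X Y) (hf : equivariant f) x v :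
  coinv_sub X x v -> coinv_sub Y x (f x v).
Proof.
apply: span_map => {}v [g [w ->]].
by apply: span_in; exists g, (f x w); rewrite linearB hf.
Qed.

Program Definition coinv_map (X Y : autfct k A) (f : fhom X Y) (hf : equivariant f) :
    fhom (coinv X) (coinv Y) :=
  @FHom k C (coinv X) (coinv Y) (fun x => (lquot_map (f := f x) (@coinv_map_proof X Y f hf x)
    : {linear coinv X x -> coinv Y x})) _.
Next Obligation.
by move=> X Y f hf x y u q; have [v ->] := lpi_surj q; rewrite /= !lquot_mapE fnat.
Qed.

Definition gten (M : autmod k A) (X : autfct k A) : fct k C := coinv (ten_autfct M X).

Program Definition ten_fhom (M : autmod k A) (X Y : autfct k A) (f : fhom X Y) :
    fhom (ten_autfct M X) (ten_autfct M Y) :=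
  @FHom k C (ten_autfct M X) (ten_autfct M Y)
    (fun x => (tensor_map idfun (f x) : {linear tensor M (X x) -> tensor M (Y x)})) _.
Next Obligation.
move=> M X Y f x y u; apply: (@tensor_ext _ _ _ _
  (tensor_map idfun (f y) \o tensor_map idfun (fact X u))
  (tensor_map idfun (fact Y u) \o tensor_map idfun (f x))).
by move=> m v; rewrite /= !tensor_mapE fnat.
Qed.

Lemma ten_fhom_equivariant (M : autmod k A) (X Y : autfct k A) (f : fhom X Y) :
  equivariant f -> equivariant (ten_fhom M f).
Proof.
move=> hf g x; apply: (@tensor_ext _ _ _ _
  (tensor_map idfun (f x) \o tensor_map (am_act M g) (af_act X g x))
  (tensor_map (am_act M g) (af_act Y g x) \o tensor_map idfun (f x))).
by move=> m v; rewrite /= !tensor_mapE hf.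
Qed.

Definition gten_map (M : autmod k A) (X Y : autfct k A) (f : fhom X Y)
    (hf : equivariant f) : fhom (gten M X) (gten M Y) :=
  coinv_map (ten_fhom_equivariant (M := M) hf).

Definition Qmap (M : autmod k A) : fhom (gten M Qup_aut) (gten M Qlow_aut) :=
  fhom_cmp (gten_map M (@fpi_equivariant klin_aut _ proper_part_stable))
           (gten_map M (@fincl_equivariant klin_aut _ Qup_stable)).

Definition Q (M : autmod k A) : fct k C := fsub_fct (fimage (Qmap M)).

End Actions.

(* The class [S] is the predicate of being isomorphic to S, so that [S] = [S']
   if and only if S and S' are isomorphic. *)
Definition iso_class (T : Type) (iso : T -> T -> Prop) (S : T) : T -> Prop :=
  fun S' => iso S S'.

Definition iso_classes (T : Type) (P : T -> Prop) (iso : T -> T -> Prop) : Type :=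
  {c : T -> Prop | exists2 S, P S & c = iso_class iso S}.

Definition mk_class (T : Type) (P : T -> Prop) (iso : T -> T -> Prop) (S : T) (PS : P S) :
    iso_classes P iso :=
  exist _ (iso_class iso S) (ex_intro2 _ _ S PS erefl).

Definition IrrMod (k : fieldType) (C : addcat) (A : rep C) : Type :=
  iso_classes (@simple_autmod k C A) (@autmod_iso k C A).

Definition IrrFct (k : fieldType) (C : addcat) (P : fct k C -> Prop) : Type :=
  iso_classes (simple_in P) (@fct_iso k C).

(* Main.v *)
(** A rep generated by one element s over y is a quotient of C(y, -), and its values are finite of
order invertible in k.  For such an A, every q in Q^A(a) has a lift theta_{s,q} to k[C(y, a)] which is
invariant under translation by the annihilator of s.  It sends g s to g q for g in Aut(A) and kills
all the other elements of A(y): if f kills v but not s, then theta_{s,q} v only depends on the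
image of q in k[A/<f s>], which vanishes; otherwise finiteness makes f v |-> f s an automorphism.
Hence theta_{s,q} maps an element of M (x) Q_A to its component at the orbit of s, tensored with
q.  This isolates components, so that Q(A, M) is simple and determines A and M.

Conversely, given a simple F and w0 <> 0 in F(x), choose A with A(x) as small as possible such that F
is a subquotient of k[A].  Minimality forces theta_{s,q} w0 <> 0 for some s and q.  For a
suitable q0 in Q^A, theta_{t,q0} then acts on F as a nonzero idempotent whose image M is a simple
module with Q(A, M) = F.

For the degree, k-triviality makes coinvariants a direct factor, so the iterated deltabar is the image of an
explicit operator in the linearization of C.  On k[A] this operator detects the strictly
increasing chains of subobjects of A. *)

From HB Require Import structures.
From mathcomp Require Import all_boot all_algebra.
From mathcomp Require Import generic_quotient ring_quotient finmap boolp monalg.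
Require Import Defs.

Set Implicit Arguments.
Unset Strict Implicit.
Unset Printing Implicit Defensive.
Import GRing.Theory.
Local Open Scope ring_scope.
#[local] Obligation Tactic := idtac.

(** * Linear maps on free modules *)

(** The identities between the operators theta, such as f theta_{s,q} = theta_{s, f q}, fail in
    general in the linearization of C: composition with f does not carry the mean over the
    annihilator of s at one object to the mean at another. They hold after evaluation at the
    elements of A. This is why the converse looks for A through k[A]: a simple subquotient F of k[A]
    is killed by every operator that kills k[A], and this transports the identities to F. Only there
    does theta_{t,q0} become idempotent.

    All the information on A sits in Q^A, so Q^A must be nonzero. This comes from finite
    cogeneration: the tensor product of the elements [u] - [0], for u nonzero in a finite set A(x)
    that meets every nonzero subobject, vanishes in each k[A/B] with B nonzero.

    Aut(A) acts freely on the generators of A. Pairing any element with a generator (over a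
    biproduct) therefore gives points with trivial stabilizer; this is the source of q0, and of the
    elements on which degrees are tested. *)

Lemma malg_eq_linear (k : fieldType) (K : choiceType) (V : lmodType k)
    (f g : {malg k[K]} -> V) :
  linear f -> linear g -> (forall x, f << x >> = g << x >>) -> f =1 g.
Proof.
move=> lf lg fg.
pose F := GRing.isLinear.Build k {malg k[K]} V *:%R f lf.
pose G := GRing.isLinear.Build k {malg k[K]} V *:%R g lg.
pose f' : {linear {malg k[K]} -> V} := HB.pack f F.
pose g' : {linear {malg k[K]} -> V} := HB.pack g G.
exact: (@malg_ext k K V f' g').
Qed.

Section MalgMaps.
Variables (k : fieldType) (K L : choiceType) (V : lmodType k).

Lemma mlift_map (f : K -> L) (h : L -> V) z :
  mlift h (malg_map f z) = mlift (k := k) (h \o f) z.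
Proof.
move: z; apply: malg_eq_linear => [c u v|c u v|x]; rewrite ?linearP //.
by rewrite malg_mapU !mliftU.
Qed.

Lemma eq_mlift (h h' : K -> V) : h =1 h' -> @mlift k K V h =1 mlift h'.
Proof.
move=> hh; apply: malg_eq_linear => [c u v|c u v|x]; rewrite ?linearP //.
by rewrite !mliftU.
Qed.

Lemma mlift_linear_fun (W : lmodType k) (f : {linear V -> W}) (h : K -> V) z :
  f (mlift h z) = mlift (f \o h) z.
Proof.
move: z; apply: malg_eq_linear => [c u v|c u v|x]; rewrite ?linearP //.
by rewrite !mliftU.
Qed.

Lemma mlift_idE (z : {malg k[K]}) : mlift (fun x => << x >>) z = z.
Proof.
move: z; apply: malg_eq_linear => [c u v|c u v|x]; rewrite ?linearP //.
by rewrite mliftU.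
Qed.

Lemma mlift_cst (w : V) z : mlift (fun _ : K => w) z = mlift (fun _ => 1 : k^o) z *: w.
Proof.
move: z; apply: malg_eq_linear => [c u v|c u v|x]; first by rewrite linearP.
  by rewrite (linearP (mlift (fun _ : K => 1 : k^o))) scalerDl -scalerA.
by rewrite !mliftU scale1r.
Qed.
End MalgMaps.

Lemma sum_seq_unique (U : zmodType) (I : eqType) (r : seq I) (F : I -> U) i :
  uniq r -> i \in r -> (forall j, j \in r -> j != i -> F j = 0) ->
  \sum_(j <- r) F j = F i.
Proof.
move=> ur ir F0; rewrite (bigD1_seq i) //= big_seq_cond big1 ?addr0 // => j /andP[].
exact: F0.
Qed.

Section LinearFun.
Variables (k : fieldType) (V U : lmodType k).

Lemma linear_mlift (K : choiceType) (f : V -> U) (h : K -> V) z :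
  linear f -> f (mlift h z) = mlift (f \o h) z.
Proof.
move=> lf; pose f' : {linear V -> U} := HB.pack f (GRing.isLinear.Build k V U *:%R f lf).
exact: (mlift_linear_fun f').
Qed.

Lemma mlift0 (K : choiceType) (h : K -> V) (z : {malg k[K]}) :
  (forall x, h x = 0) -> mlift h z = 0.
Proof. by move=> h0; rewrite (eq_mlift (h' := fun=> 0)) // mlift_cst scaler0. Qed.

Lemma linear_combine (a : k) (f g : V -> U) :
  linear f -> linear g -> linear (fun x => a *: f x + g x).
Proof.
by move=> lf lg c u v; rewrite lf lg !scalerDr !scalerA mulrC addrACA.
Qed.

Lemma linear_bigsum (I : Type) (r : seq I) (F : I -> V -> U) :
  (forall i, linear (F i)) -> linear (fun x => \sum_(i <- r) F i x).
Proof.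
move=> lF c x v; rewrite scaler_sumr -big_split; apply: eq_bigr => i _ /=.
exact: lF.
Qed.

Lemma linear_comp (W : lmodType k) (f : V -> U) (g : W -> V) :
  linear f -> linear g -> linear (f \o g).
Proof. by move=> lf lg c u v; rewrite /= lg lf. Qed.

Lemma linear_funP (f : {linear V -> U}) : linear f.
Proof. by move=> c u v; rewrite linearP. Qed.
End LinearFun.

Lemma linear_fun0 (k : fieldType) (V U : lmodType k) (f : V -> U) : linear f -> f 0 = 0.
Proof.
move=> lf; pose f' : {linear V -> U} := HB.pack f (GRing.isLinear.Build k V U *:%R f lf).
exact: (raddf0 f').
Qed.

Lemma mliftB (k : fieldType) (V : lmodType k) (K : choiceType) (h h' : K -> V) z :
  mlift (fun x => h x - h' x) z = mlift h z - mlift h' z.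
Proof. by rewrite /mlift -sumrB; apply: eq_bigr => x _; rewrite scalerBr. Qed.

Lemma linear_funB (k : fieldType) (V U : lmodType k) (f : V -> U) u v :
  linear f -> f (u - v) = f u - f v.
Proof. by move=> lf; rewrite -scaleN1r addrC lf scaleN1r addrC. Qed.

Lemma span_mlift (k : fieldType) (V : lmodType k) (K : choiceType) (h : K -> V)
    (P : V -> Prop) w :
  (forall v, P v -> exists x, v = h x) -> span P w -> exists z : {malg k[K]}, w = mlift h z.
Proof.
move=> hP; pose R u := exists z : {malg k[K]}, u = mlift h z.
have R0 : R 0 by exists 0; rewrite linear0.
have RB u v : R u -> R v -> R (u - v) by move=> [z ->] [z' ->]; exists (z - z'); rewrite linearB.
have RZ c u : R u -> R (c *: u) by move=> [z ->]; exists (c *: z); rewrite linearZ.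
move=> /(_ (SubSpc (ss_grp := SubGrp R0 RB) RZ)); apply=> v /hP[x ->].
by exists << x >>; rewrite mliftU.
Qed.

Lemma span_linear_eq0 (k : fieldType) (V U : lmodType k) (P : V -> Prop) (f : V -> U) :
  linear f -> (forall v, P v -> f v = 0) -> forall v, span P v -> f v = 0.
Proof.
move=> lf hP v.
pose f' : {linear V -> U} := HB.pack f (GRing.isLinear.Build k V U *:%R f lf).
have h0 : forall u u' : U, u = 0 -> u' = 0 -> u - u' = 0 by move=> ? ? -> ->; rewrite subr0.
have hZ : forall a (u : U), u = 0 -> a *: u = 0 by move=> ? ? ->; rewrite scaler0.
by move=> /(_ (subspc_pre f' (SubSpc (ss_grp := @SubGrp U (fun u => u = 0) erefl h0) hZ))); apply.
Qed.

Lemma mlift_single (k : fieldType) (K : choiceType) (V : lmodType k) (h : K -> V) x z :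
  (forall y, y != x -> h y = 0) -> mlift h z = z@_x *: h x.
Proof.
move=> h0; rewrite /mlift; have [xz|xz] := boolP (x \in msupp z).
  rewrite (big_fsetD1 x) //= big_seq_fsetE big1 ?addr0 // => i _.
  rewrite h0 ?scaler0 //; have := valP i.
  by rewrite !inE => /andP[].
rewrite mcoeff_outdom // scale0r big_seq big1 // => y yz.
by rewrite h0 ?scaler0 //; apply: contraNneq xz => <-.
Qed.

Lemma malg_neq0_coef (k : fieldType) (K : choiceType) (z : {malg k[K]}) :
  z <> 0 -> exists x, z@_x != 0.
Proof.
move=> z0; apply: contrapT => h; apply: z0; apply/malgP => x; rewrite mcoeff0.
by apply/eqP; apply: contrapT => /negP hx; apply: h; exists x.
Qed.

Lemma malg_map_comp (k : fieldType) (K L J : choiceType) (f : K -> L) (g : L -> J) z :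
  malg_map g (malg_map f z) = malg_map (k := k) (g \o f) z.
Proof. exact: mlift_map. Qed.

Lemma eq_malg_map (k : fieldType) (K L : choiceType) (f g : K -> L) :
  f =1 g -> @malg_map k K L f =1 malg_map g.
Proof. by move=> fg; apply: eq_mlift => x; rewrite fg. Qed.

Lemma malg_map_idE (k : fieldType) (K : choiceType) (z : {malg k[K]}) :
  malg_map id z = z.
Proof. exact: mlift_idE. Qed.

Lemma malg_map_id (k : fieldType) (K : choiceType) (f : K -> K) (z : {malg k[K]}) :
  f =1 id -> malg_map f z = z.
Proof. by move=> fE; rewrite (eq_malg_map fE) malg_map_idE. Qed.

(** Being constant on the cosets of [B], [h] factors through the quotient as [h \o repr]. Membership
    in Q^A, an equation in k[A/B], is used in this form. *)
Lemma mlift_coset (k : fieldType) (V : zmodType) (B : subgrp V) (W : lmodType k)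
    (h : V -> W) (z : {malg k[V]}) :
  (forall u v, B (u - v) -> h u = h v) -> malg_map (zpi B) z = 0 -> mlift h z = 0.
Proof.
move=> hB z0; have -> : mlift h z = mlift (h \o repr) (malg_map (zpi B) z).
  rewrite mlift_map; apply: eq_mlift => v /=; apply: hB.
  by apply/zpi_eq; rewrite /zpi reprK.
by rewrite z0 linear0.
Qed.

(** * The linearization of C and its action on functors *)

Section Operators.
Variables (k : fieldType) (C : addcat).
Implicit Types F G : fct k C.

(** A functor to k-vector spaces is a module over the k-linearization of C. This is the action, and
    [mcmp] is the composition. *)
Definition fop F (y a : C) (z : {malg k[hom y a]}) (w : F y) : F a :=
  mlift (fun f => fact F f w) z.

Lemma fopU F y a (f : hom y a) (w : F y) : fop << f >> w = fact F f w.
Proof. exact: mliftU. Qed.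

Lemma fopPl F y a (w : F y) : linear (fun z : {malg k[hom y a]} => fop z w).
Proof. by move=> c u v; rewrite /fop linearP. Qed.

Lemma fopPr F y a (z : {malg k[hom y a]}) : linear (@fop F y a z).
Proof.
move=> c u v; move: z; apply: malg_eq_linear => [c' z z'|c' z z'|f].
- exact: fopPl.
- by rewrite !fopPl scalerDr scalerDr !scalerA mulrC addrACA.
- by rewrite !fopU linearP.
Qed.

HB.instance Definition _ F y a (z : {malg k[hom y a]}) :=
  GRing.isLinear.Build k (F y) (F a) *:%R (@fop F y a z) (@fopPr F y a z).

Lemma fopBl F y a (z z' : {malg k[hom y a]}) (w : F y) :
  fop (z - z') w = fop z w - fop z' w.
Proof. exact: raddfB (mlift _) _ _. Qed.
Lemma fop0l F y a (w : F y) : fop (0 : {malg k[hom y a]}) w = 0.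
Proof. exact: raddf0 (mlift _). Qed.

Lemma fopZl F y a c (z : {malg k[hom y a]}) (w : F y) : fop (c *: z) w = c *: fop z w.
Proof. by rewrite /fop linearZ. Qed.

Lemma fop_nat F G (p : fhom F G) y a (z : {malg k[hom y a]}) w :
  p a (fop z w) = fop z (p y w).
Proof. by rewrite /fop mlift_linear_fun; apply: eq_mlift => f /=; rewrite fnat. Qed.

Lemma subspc_mlift (V : lmodType k) (S : subspc V) (K : choiceType) (h : K -> V) z :
  (forall x, S (h x)) -> S (mlift h z).
Proof.
move=> Sh; rewrite /mlift.
elim/big_rec: _ => [|x u _ Su]; first exact: sg0.
by apply: sgD => //; apply: ssZ.
Qed.

Lemma fop_fsub F (S : fsub F) y a (z : {malg k[hom y a]}) w : S y w -> S a (fop z w).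
Proof. by move=> Sw; apply: subspc_mlift => f; apply: fsub_map. Qed.

Definition mcmp (y a b : C) (z : {malg k[hom a b]}) (z' : {malg k[hom y a]}) :
    {malg k[hom y b]} :=
  mlift (fun g => malg_map (cmp g) z') z.

Lemma mcmpUl y a b (g : hom a b) (z : {malg k[hom y a]}) :
  mcmp << g >> z = malg_map (cmp g) z.
Proof. exact: mliftU. Qed.

Lemma fop_cmp F y a b (z : {malg k[hom a b]}) (z' : {malg k[hom y a]}) (w : F y) :
  fop (mcmp z z') w = fop z (fop z' w).
Proof.
move: z; apply: malg_eq_linear => [c u v|c u v|g].
- by rewrite /mcmp linearP /= fopPl.
- exact: fopPl.
- rewrite fopU mcmpUl /fop mlift_map mlift_linear_fun.
  by apply: eq_mlift => f /=; rewrite factM.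
Qed.

Lemma fop_klinU (A : rep C) y a (z : {malg k[hom y a]}) (s : A y) :
  fop (F := klin k A) z << s >> = malg_map (fun f => rmap A f s) z.
Proof. by apply: eq_mlift => f /=; rewrite malg_mapU. Qed.

Lemma fop_idm F x (w : F x) : fop << idm x >> w = w.
Proof. by rewrite fopU fact1. Qed.

End Operators.

(** * Averages over groups of morphisms *)

Section Means.
Variables (k : fieldType) (C : addcat).
Hypothesis ktr : k_trivial k C.

(** The average over K is obtained as the image of the average over the whole group under rho(v) = v
    - repr(v), which retracts onto K up to translation. Thus only the order n of [hom x y] is
    inverted. Since rho commutes with translations by K, the result is invariant under them. *)
Lemma mean_exists (x y : C) (K : subgrp (hom x y)) :
  exists e : {malg k[hom x y]},
    (forall (W : lmodType k) (h : hom x y -> W) c,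
       (forall b, K b -> h b = c) -> mlift h e = c) /\
    (forall b, K b -> malg_map (fun v => b + v) e = e).
Proof.
have [n [e [[e' eK e'K] nu]]] := ktr x y.
pose rho (v : hom x y) := v - repr (zpi K v).
have Krho v : K (rho v) by apply/zpi_eq; rewrite /zpi reprK.
have rhoD b v : K b -> rho (b + v) = b + rho v.
  move=> Kb; rewrite /rho -addrA; congr (_ + (_ - repr _)).
  by apply/zpi_eq; rewrite addrK.
exists (n%:R^-1 *: \sum_(i < n) << rho (e i) >>); split=> [W h c hc|b Kb].
  rewrite linearZ linear_sum /= (eq_bigr (fun=> c)) => [|i _]; last first.
    by rewrite mliftU hc.
  by rewrite sumr_const card_ord -scaler_nat scalerA mulVr ?scale1r.
rewrite linearZ linear_sum /=; congr (_ *: _).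
rewrite [LHS](eq_bigr (fun i => << rho (e (e' (b + e i))) >>)) => [|i _]; last first.
  by rewrite malg_mapU e'K rhoD.
rewrite -(reindex (fun i => e' (b + e i)) (F := fun i => << rho (e i) >>) (P := xpredT)) //=.
exists (fun i => e' (- b + e i)) => i _; first by rewrite e'K addKr eK.
by rewrite e'K addNKr eK.
Qed.

End Means.

Section FiniteTypes.
Variables (T : eqType) (l : seq T).
Hypothesis lT : forall u, u \in l.

Lemma inj_surj_covered (f : T -> T) : injective f -> forall u, exists v, u = f v.
Proof.
move=> fI u; pose l' := undup l.
have [|||_ E] := @uniq_min_size _ (map f l') l'.
- by rewrite map_inj_uniq ?undup_uniq.
- by move=> v _; rewrite mem_undup lT.
- by rewrite size_map.
by have /mapP[v _ ->] : u \in map f l'; [rewrite E mem_undup lT | exists v].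
Qed.

Lemma surj_inj_covered (f : T -> T) : (forall u, exists v, u = f v) -> injective f.
Proof.
move=> fS; have [g gE] := choice fS.
have gI : injective g by move=> u v /(congr1 f); rewrite -!gE.
have gS := inj_surj_covered gI.
move=> u v; have [u' ->] := gS u; have [v' ->] := gS v.
by rewrite -!gE => ->.
Qed.
End FiniteTypes.

(** * Generators, and the operators theta *)

Section Reps.
Variable C : addcat.
Implicit Types A B : rep C.

Lemma rmapBl A x y (f g : hom x y) (v : A x) : rmap A (f - g) v = rmap A f v - rmap A g v.
Proof. by apply/eqP; rewrite eq_sym subr_eq -rmapD subrK. Qed.

Lemma rmap0l A x y (v : A x) : rmap A (0 : hom x y) v = 0.
Proof. by rewrite -(subrr 0) rmapBl subrr. Qed.

Definition gens A y (s : A y) : Prop := forall a (v : A a), exists f : hom y a, v = rmap A f s.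

Program Definition cyc A y (s : A y) : rsub A :=
  @RSub C A (fun a => @SubGrp (A a) (fun v => exists f : hom y a, v = rmap A f s) _ _) _.
Next Obligation. by move=> A y s a; exists 0; rewrite rmap0l. Qed.
Next Obligation.
by move=> A y s a _ _ [f ->] [g ->]; exists (f - g); rewrite rmapBl.
Qed.
Next Obligation.
by move=> A y s a b h _ [f ->]; exists (h \oc f); rewrite rmapM.
Qed.

Lemma cyc_id A y (s : A y) : cyc s y s.
Proof. by exists (idm y); rewrite rmap1. Qed.

Lemma cyc_le A y (s : A y) (B : rsub A) : B y s -> rsub_le (cyc s) B.
Proof. by move=> Bs a _ [f ->]; apply: rsub_map. Qed.

(** A set-theoretic section of f |-> f s; the value 0 off the subobject generated by [s] is a
    default. *)
Definition sec A y (s : A y) a (v : A a) : hom y a :=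
  if pselect (exists f, v = rmap A f s) is left h then sval (cid h) else 0.

Lemma secE A y (s : A y) a (v : A a) : cyc s a v -> rmap A (sec s v) s = v.
Proof. by rewrite /sec; case: pselect => // h _; case: cid. Qed.

Lemma gens_secE A y (s : A y) (gs : gens s) a (v : A a) : rmap A (sec s v) s = v.
Proof. exact/secE/gs. Qed.

Program Definition ann A y (s : A y) a : subgrp (hom y a) :=
  @SubGrp _ (fun f => rmap A f s = 0) _ _.
Next Obligation. by move=> A y s a; exact: rmap0l. Qed.
Next Obligation. by move=> A y s a f g /= hf hg; rewrite rmapBl hf hg subrr. Qed.

Definition ann_le A B y (s : A y) (t : B y) : Prop :=
  forall a (f : hom y a), rmap A f s = 0 -> rmap B f t = 0.

(** By Yoneda, A is the quotient of C(y, -) by the annihilator of [s], so a morphism from A to B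
    amounts to an element of B(y) with a larger annihilator. *)
Lemma rhom_gens A B y (s : A y) (t : B y) :
  gens s -> ann_le s t -> exists p : rhom A B, p y s = t.
Proof.
move=> gs st; pose p a (v : A a) : B a := rmap B (sec s v) t.
have pE a (f : hom y a) : p a (rmap A f s) = rmap B f t.
  apply/eqP; rewrite -subr_eq0 /p -rmapBl; apply/eqP/st.
  by rewrite rmapBl gens_secE // subrr.
have pB a : zmod_morphism (p a).
  move=> u v; have [f ->] := gs _ u; have [g ->] := gs _ v.
  by rewrite -rmapBl !pE rmapBl.
pose pa a : {additive A a -> B a} := HB.pack (p a) (GRing.isZmodMorphism.Build _ _ (p a) (pB a)).
have pN a b (h : hom a b) v : pa b (rmap A h v) = rmap B h (pa a v).
  by have [f ->] := gs _ v; rewrite /= -rmapM !pE rmapM.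
by exists (RHom pN); rewrite /= -{1}(rmap1 s) pE rmap1.
Qed.

Lemma rhom_bij_inv A B (p : rhom A B) :
  (forall a, injective (p a)) -> (forall a u, exists v, u = p a v) ->
  exists q : rhom B A, forall a, cancel (p a) (q a) /\ cancel (q a) (p a).
Proof.
move=> pI pS; pose q a u := sval (cid (pS a u)).
have pK a u : p a (q a u) = u by rewrite /q; case: cid.
have qK a v : q a (p a v) = v by apply: pI; rewrite pK.
have qB a : zmod_morphism (q a) by move=> u v; apply: pI; rewrite raddfB !pK.
pose qa a : {additive B a -> A a} := HB.pack (q a) (GRing.isZmodMorphism.Build _ _ (q a) (qB a)).
have qN a b (h : hom a b) v : qa b (rmap B h v) = rmap A h (qa a v).
  by apply: pI; rewrite rnat /= !pK.
by exists (RHom qN) => a; split; [exact: qK | exact: pK].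
Qed.

Definition autV A (g : aut A) : aut A := Aut (autVK g) (autK g).

Lemma gens_aut A y (s : A y) (g h : aut A) :
  gens s -> g y s = h y s -> forall a v, g a v = h a v.
Proof. by move=> gs gh a v; have [f ->] := gs a v; rewrite !rnat gh. Qed.

Lemma gens_img A B y (s : A y) (p : rhom A B) :
  gens s -> (forall a u, exists v, u = p a v) -> gens (p y s).
Proof.
move=> gs pS a u; have [v ->] := pS a u; have [f ->] := gs a v.
by exists f; rewrite rnat.
Qed.

Lemma aut_gens A y (s : A y) (g : aut A) : gens s -> gens (g y s).
Proof. by move=> gs; apply: gens_img => // a u; exists (ainv g a u); rewrite autVK. Qed.

End Reps.

Section Theta.
Variables (k : fieldType) (C : addcat).
Hypothesis ktr : k_trivial k C.
Implicit Types A B : rep C.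

Lemma gens_covered A y (s : A y) a : gens s -> exists l : seq (A a), forall v, v \in l.
Proof.
move=> gs; have [n [e [[e' eK e'K] _]]] := ktr y a.
exists [seq rmap A (e i) s | i <- enum 'I_n] => v; have [f ->] := gs a v.
by apply/mapP; exists (e' f); rewrite ?mem_enum // e'K.
Qed.

Lemma gens_surj_inj A (p : rhom A A) y (s : A y) :
  gens s -> (forall a u, exists v, u = p a v) -> forall a, injective (p a).
Proof. by move=> gs pS a; have [l hl] := gens_covered a gs; apply: (surj_inj_covered hl) => u; apply: pS. Qed.

(* [f s' |-> f s] is a surjection from a subset of the finite set [A a] onto [A a], hence a
   bijection of [A a]. *)
Lemma ann_le_aut A y (s s' : A y) :
  gens s -> ann_le s' s -> exists g : aut A, s' = g y s.
Proof.
move=> gs s's.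
have gs' : gens s'.
  move=> a u; have [l hl] := gens_covered a gs.
  have [|v ->] := @inj_surj_covered _ l hl (fun v => rmap A (sec s v) s') _ u.
    move=> v v' /eqP; rewrite -subr_eq0 -rmapBl => /eqP /s's.
    by rewrite rmapBl !gens_secE // => /eqP; rewrite subr_eq0 => /eqP.
  by exists (sec s v).
have [p ps] := rhom_gens gs' s's.
have pS a u : exists v, u = p a v.
  by have [f ->] := gs a u; exists (rmap A f s'); rewrite rnat ps.
have [q pq] := rhom_bij_inv (gens_surj_inj gs pS) pS.
pose g := @Aut C A q p (fun a => (pq a).2) (fun a => (pq a).1).
by exists g; rewrite /= -ps (pq y).1.
Qed.

(** The values of A are finite, so the surjective endomorphism q p is injective, and p with it. *)
Lemma rep_iso_of_surj A B y (s : A y) z (t : B z) (p : rhom A B) (q : rhom B A) :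
  gens s -> gens t -> (forall a u, exists v, u = p a v) ->
  (forall a u, exists v, u = q a v) -> rep_iso A B.
Proof.
move=> gs gt pS qS.
have pI a : injective (p a).
  have qpS b u : exists v, u = rhom_cmp q p b v.
    by have [v ->] := qS b u; have [w ->] := pS b v; exists w.
  by move=> u v uv; apply: (gens_surj_inj gs qpS); rewrite /= uv.
by have [r hr] := rhom_bij_inv pI pS; exists p, r.
Qed.

Definition mean (x y : C) (K : subgrp (hom x y)) : {malg k[hom x y]} :=
  sval (cid (mean_exists ktr K)).

Lemma mlift_mean x y (K : subgrp (hom x y)) (W : lmodType k) (h : hom x y -> W) c :
  (forall b, K b -> h b = c) -> mlift h (mean K) = c.
Proof. by rewrite /mean; case: cid => e /= [he _]; apply: he. Qed.

Lemma mean_shift x y (K : subgrp (hom x y)) b :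
  K b -> malg_map (fun v => b + v) (mean K) = mean K.
Proof. by rewrite /mean; case: cid => e /= [_]; apply. Qed.

(* The lift of [q] along [f |-> f s] which is invariant under the annihilator of [s]. *)
Definition theta A y (s : A y) a (q : {malg k[A a]}) : {malg k[hom y a]} :=
  mlift (fun v => malg_map (fun f => sec s v + f) (mean (ann s a))) q.

Lemma theta_linear A y (s : A y) a : linear (@theta A y s a).
Proof. by move=> c u v; rewrite /theta linearP. Qed.
HB.instance Definition _ A y (s : A y) a :=
  GRing.isLinear.Build k _ _ *:%R (@theta A y s a) (@theta_linear A y s a).

Lemma theta_evalE A B y (s : A y) (t : B y) a (q : {malg k[A a]}) :
  fop (F := klin k B) (theta s q) << t >> =
  mlift (fun v => mlift (fun f => << rmap B (sec s v + f) t >>) (mean (ann s a))) q.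
Proof.
rewrite fop_klinU /theta mlift_linear_fun; apply: eq_mlift => v /=.
by rewrite malg_map_comp.
Qed.

(** Every lift of v along f |-> f s sends p s to p v, so the mean over the lifts collapses to one
    point. *)
Lemma theta_gens A B y (s : A y) (p : rhom A B) a (q : {malg k[A a]}) :
  gens s -> fop (F := klin k B) (theta s q) << p y s >> = klin_map k p a q.
Proof.
move=> gs; rewrite theta_evalE; apply: eq_mlift => v.
apply: mlift_mean => f /= fs; rewrite -rnat rmapD gens_secE //.
by rewrite (fs : _ = 0) addr0.
Qed.

Lemma Qup_subP A a (q : {malg k[A a]}) :
  Qup_sub k A a q <-> forall B : rsub A, ~ rsub_zero B -> malg_map (zpi (B a)) q = 0.
Proof.
split=> [h B nB|h _ [B nB ->]]; last exact: h.
by apply: (h (fker (klin_map k (rpi B)))); exists B.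
Qed.

(* If [f] kills [t] but not [s], then [theta s q << t >>] only depends on the image of [q] in
   the group ring of the quotient of [A] by the subobject generated by [f s]. *)
Lemma theta_kill A B y (s : A y) (t : B y) a (q : {malg k[A a]}) :
  gens s -> ~ ann_le t s -> Qup_sub k A a q -> fop (F := klin k B) (theta s q) << t >> = 0.
Proof.
move=> gs nts /Qup_subP hq; rewrite theta_evalE.
have [b [f [ft fs]]] : exists b (f : hom y b), rmap B f t = 0 /\ rmap A f s <> 0.
  apply: contrapT => h; apply: nts => b f ft; apply: contrapT => fs.
  by apply: h; exists b, f.
apply: (@mlift_coset _ _ (cyc (rmap A f s) a)); last first.
  by apply: hq => h; apply: fs; apply: h; apply: cyc_id.
move=> u v [g uv].
(* Shifting the mean by this element of the annihilator replaces [sec s v] by [sec s u - g \oc f],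
   and [g \oc f] kills [t]. *)
have Kd : ann s a (sec s u - sec s v - g \oc f).
  by rewrite /= !rmapBl !gens_secE // uv rmapM subrr.
rewrite -{2}(mean_shift Kd) mlift_map; apply: eq_mlift => h /=.
congr << _ >>.
rewrite rmapD [RHS]rmapD [X in _ = _ + X]rmapD [RHS]addrA; congr (_ + _).
by rewrite !rmapBl rmapM ft raddf0 subr0 addrC subrK.
Qed.

Lemma theta_dichotomy A y (s v : A y) : gens s ->
  (exists g : aut A, v = g y s) \/
  (forall a q, Qup_sub k A a q -> fop (F := klin k A) (theta s q) << v >> = 0).
Proof.
move=> gs; have [/(ann_le_aut gs)|nvs] := pselect (ann_le v s); first by left.
by right=> a q hq; apply: theta_kill.
Qed.

End Theta.

(** * Values on biproducts, and elements of Q^A *)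

Section Pairs.
Variable C : addcat.
Implicit Types A B : rep C.

Definition rpair A (x a : C) (s : A x) (t : A a) : A (bip x a) :=
  rmap A (in1 x a) s + rmap A (in2 x a) t.

Lemma rpair1 A x a (s : A x) (t : A a) : rmap A (pr1 x a) (rpair s t) = s.
Proof. by rewrite /rpair raddfD /= -!rmapM pr1_in1 pr1_in2 rmap0l addr0 rmap1. Qed.

Lemma rpair2 A x a (s : A x) (t : A a) : rmap A (pr2 x a) (rpair s t) = t.
Proof. by rewrite /rpair raddfD /= -!rmapM pr2_in1 pr2_in2 rmap0l add0r rmap1. Qed.

Lemma rpairE A x a (v : A (bip x a)) : v = rpair (rmap A (pr1 x a) v) (rmap A (pr2 x a) v).
Proof. by rewrite /rpair -!rmapM -rmapD bipE rmap1. Qed.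

Lemma rhom_rpair A B (p : rhom A B) x a (s : A x) (t : A a) :
  p _ (rpair s t) = rpair (p x s) (p a t).
Proof. by rewrite /rpair raddfD /= !rnat. Qed.

Lemma rpair_inj A x a (s s' : A x) (t t' : A a) :
  rpair s t = rpair s' t' -> s = s' /\ t = t'.
Proof.
move=> e; split; first by have := congr1 (rmap A (pr1 x a)) e; rewrite !rpair1.
by have := congr1 (rmap A (pr2 x a)) e; rewrite !rpair2.
Qed.

Lemma gens_rpairl A x a (s : A x) (t : A a) : gens s -> gens (rpair s t).
Proof.
move=> gs b v; have [f ->] := gs b v; exists (f \oc pr1 x a).
by rewrite rmapM rpair1.
Qed.

(** Dual to generation at [x]: every nonzero subobject is nonzero at [x], so membership in Q^A can
    be tested on the subobjects generated by elements of A(x). *)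
Definition cogens A x : Prop := forall a (v : A a), v <> 0 -> exists f : hom a x, rmap A f v <> 0.

End Pairs.

Section Qup.
Variables (k : fieldType) (C : addcat).
Hypothesis ktr : k_trivial k C.
Implicit Types A B : rep C.

Lemma fop_klinE A y a (z : {malg k[hom y a]}) (w : {malg k[A y]}) :
  fop (F := klin k A) z w = mlift (fun v => fop (F := klin k A) z << v >> : {malg k[A a]}) w.
Proof.
by rewrite -{1}[w]mlift_idE (mlift_linear_fun (fop (F := klin k A) z)).
Qed.

Lemma zpi_rpair A (B : rsub A) x a (s : A x) (q : {malg k[A a]}) :
  malg_map (zpi (B _)) (malg_map (rpair s) q) =
  malg_map (rpair (A := rquot B) (zpi (B x) s)) (malg_map (zpi (B a)) q).
Proof.
rewrite !malg_map_comp; apply: eq_malg_map => t.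
exact: (rhom_rpair (rpi B)).
Qed.

Lemma Qup_rpair A x a (s : A x) (q : {malg k[A a]}) :
  Qup_sub k A a q -> Qup_sub k A (bip x a) (malg_map (rpair s) q).
Proof.
move=> /Qup_subP hq; apply/Qup_subP => B nB.
by rewrite zpi_rpair hq // linear0.
Qed.

(** The witness is the tensor product of the [u] - [0] for u nonzero in A(x), built one factor at a
    time over iterated biproducts. A nonzero subobject B contains some such u, and modulo B the
    corresponding factor vanishes. *)
Lemma Qup_nonzero A x (l : seq (A x)) : cogens A x -> (forall v, v \in l) ->
  exists a (q : {malg k[A a]}), Qup_sub k A a q /\ q <> 0.
Proof.
move=> cg hl.
suff [a [q [hq q0]]] : exists a (q : {malg k[A a]}),
    (forall u, u \in l -> u <> 0 -> forall B : rsub A, B x u -> malg_map (zpi (B a)) q = 0)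
    /\ q <> 0.
  exists a, q; split=> //; apply/Qup_subP => B nB.
  have [b [v [Bv v0]]] : exists b (v : A b), B b v /\ v <> 0.
    apply: contrapT => h; apply: nB => b v Bv; apply: contrapT => v0.
    by apply: h; exists b, v.
  have [f fv] := cg b v v0.
  by apply: (hq (rmap A f v)) => //; apply: rsub_map.
elim: l {hl} => [|u l [a [q [hq q0]]]].
  exists x, << 0 >>; split=> // /(congr1 (mcoeff 0)).
  by rewrite mcoeffUU mcoeff0 => /eqP; rewrite oner_eq0.
have [u0|/eqP u0] := eqVneq u 0.
  exists a, q; split=> // v; rewrite inE => /orP[/eqP->|]; [by rewrite u0 | exact: hq].
exists (bip x a), (malg_map (rpair u) q - malg_map (rpair 0) q); split.
  move=> v + v0 B Bv; rewrite inE linearB /= !zpi_rpair => /orP[/eqP vu|vl].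
    by rewrite (_ : zpi (B x) u = zpi (B x) 0) ?subrr //; apply/zpi_eq; rewrite subr0 -vu.
  by rewrite (hq v) // !linear0 addr0.
(* [L] keeps the points whose first coordinate is u and forgets that coordinate: it recovers q from
   [u] (x) q and kills [0] (x) q. *)
pose L := mlift (fun v : A (bip x a) =>
  if rmap A (pr1 x a) v == u then << rmap A (pr2 x a) v >> else 0 : {malg k[A a]}).
move=> /(congr1 L); rewrite /L linear0 linearB /= !mlift_map => e; apply: q0.
move: e; rewrite (eq_mlift (h' := fun t => << t >>)) => [|t]; last first.
  by rewrite /= rpair1 eqxx rpair2.
rewrite mlift_idE (eq_mlift (h' := fun t => 0)) => [|t]; last first.
  by rewrite /= rpair1 eq_sym (introF eqP).
by rewrite mlift_cst scaler0 subr0.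
Qed.

(* [q0 = s (x) q'] sees a single point of the Aut(A)-orbit of the generator [(s, t)], because an
   automorphism is determined by its value on [s]. *)
Lemma Qup_dirac A y (s : A y) a (q : {malg k[A a]}) : gens s -> Qup_sub k A a q -> q <> 0 ->
  exists z (t : A z) (q0 : {malg k[A z]}), [/\ gens t, Qup_sub k A z q0 &
    forall (W : lmodType k) (h : A z -> W),
      (forall v, ~ (exists g : aut A, v = g z t) -> h v = 0) -> mlift h q0 = h t].
Proof.
move=> gs hq /malg_neq0_coef[t pure_ten].
exists (bip y a), (rpair s t), ((q@_t)^-1 *: malg_map (rpair s) q); split.
- exact: gens_rpairl.
- by apply: ssZ; apply: Qup_rpair.
- move=> W h h0; rewrite linearZ /= mlift_map (mlift_single (x := t)) => [|t' tt'].
    by rewrite scalerA mulVf ?scale1r.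
  apply: h0 => -[g]; rewrite rhom_rpair => /rpair_inj[gs1 gt].
  have gid := @gens_aut C A y s (aut1 A) g gs gs1.
  by move: tt'; rewrite gt -(gid a t) /= eqxx.
Qed.

(** theta_{t,q} vanishes off the orbit of t, so it sees q0 as the single point t, which it sends to
    q. *)
Lemma theta_dirac A z (t : A z) (q0 : {malg k[A z]}) :
  gens t -> (forall (W : lmodType k) (h : A z -> W),
      (forall v, ~ (exists g : aut A, v = g z t) -> h v = 0) -> mlift h q0 = h t) ->
  forall a q, Qup_sub k A a q -> fop (F := klin k A) (theta ktr t q) q0 = q.
Proof.
move=> gt h a q hq; rewrite fop_klinE h => [|v nv].
  by have := theta_gens ktr (rhom_id A) q gt; rewrite klin_map_id.
by have [|->] := theta_dichotomy ktr v gt.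
Qed.

End Qup.

(** * Components of elements of M (x) Q_A *)

Section AutExt.
Variable C : addcat.

Lemma additive_ext (U V : zmodType) (f g : {additive U -> V}) : f =1 g -> f = g.
Proof.
case: f g => [f cf] [g cg] /= /funext fg; case: g / fg cg => cg.
congr (GRing.Additive.Pack _); move: cf cg => [[m]] [[m']].
by rewrite (Prop_irrelevance m m').
Qed.

Lemma rhom_ext (A B : rep C) (p q : rhom A B) : (forall a v, p a v = q a v) -> p = q.
Proof.
case: p q => [p pn] [q qn] /= pq.
have e : p = q by apply: functional_extensionality_dep => a; apply: additive_ext => v; apply: pq.
by case: q / e qn pq => qn _; rewrite (Prop_irrelevance pn qn).
Qed.

(** The axioms of [autmod] are used by rewriting automorphisms, so identities such as autM (autV g)
    g = aut1 A have to be equalities of records, proof fields included. *)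
Lemma aut_ext (A : rep C) (g h : aut A) : (forall a v, g a v = h a v) -> g = h.
Proof.
case: g h => [g g' gK gVK] [h h' hK hVK] /= gh.
have e := rhom_ext gh; case: h / e hK hVK gh => hK hVK _.
have e' : g' = h' by apply: rhom_ext => a v; rewrite -{1}[v](hVK a) gK.
case: h' / e' hK hVK => hK hVK.
by rewrite (Prop_irrelevance gK hK) (Prop_irrelevance gVK hVK).
Qed.
End AutExt.

Section Lifts.
Variables (k : fieldType) (V V' U : lmodType k).

Lemma lquot_lift (S : subspc V) (f : V -> U) : linear f -> (forall v, S v -> f v = 0) ->
  exists L : {linear lquot S -> U}, forall v, L (lpi S v) = f v.
Proof.
move=> lf fS; pose f' : {linear V -> U} := HB.pack f (GRing.isLinear.Build k V U *:%R f lf).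
pose L (q : lquot S) := f (repr q).
have LE v : L (lpi S v) = f v.
  apply/eqP; rewrite -subr_eq0 /L -[f]/(f' : V -> U) -raddfB; apply/eqP/fS.
  by apply/zpi_eq; rewrite /lpi /zpi reprK.
have lL : linear L.
  move=> c p q; have [u ->] := lpi_surj p; have [v ->] := lpi_surj q.
  by rewrite -linearP !LE lf.
pose L' : {linear lquot S -> U} := HB.pack L (GRing.isLinear.Build k (lquot S) U *:%R L lL).
by exists L'.
Qed.
End Lifts.

Section TensorLifts.
Variables (k : fieldType) (V V' U : lmodType k).

Lemma subr_telescope (Z : zmodType) (x p q r : Z) : x - (p + q) = (x - r - q) + (r - p).
Proof. by rewrite [x - r - q]addrAC addrA subrK addrAC opprD addrA. Qed.

Lemma ten_linearl (w : V') : linear (fun v : V => ten v w).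
Proof.
move=> c u v; rewrite /ten -linearP; apply/zpi_eq.
rewrite (subr_telescope _ _ _ << (c *: u, w) >>).
by apply: sgD; apply: span_in; [apply: BilinDl | apply: BilinZl].
Qed.

Lemma ten_linearr (v : V) : linear (fun w : V' => ten v w).
Proof.
move=> c u w; rewrite /ten -linearP; apply/zpi_eq.
rewrite (subr_telescope _ _ _ << (v, c *: u) >>).
by apply: sgD; apply: span_in; [apply: BilinDr | apply: BilinZr].
Qed.

Lemma ten_span (u : tensor V V') :
  exists z : {malg k[(V * V')%type]}, u = mlift (fun p => ten p.1 p.2) z.
Proof.
have [z ->] := lpi_surj u; exists z; rewrite -{1}[z]mlift_idE.
rewrite (mlift_linear_fun (lpi _)).
by apply: eq_mlift => -[].
Qed.

Lemma tensor_lift (b : V -> V' -> U) :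
  (forall w, linear (b^~ w)) -> (forall v, linear (b v)) ->
  exists L : {linear tensor V V' -> U}, forall v w, L (ten v w) = b v w.
Proof.
move=> bl br; pose f : {malg k[(V * V')%type]} -> U := mlift (fun p : V * V' => b p.1 p.2).
have lf : linear f by move=> c u v; rewrite /f linearP.
have fE v w : f << (v, w) >> = b v w by rewrite /f mliftU.
have [|L LE] := lquot_lift (S := span (@bilin_rel k V V')) lf.
  apply: span_linear_eq0 => // v.
  have fB u w : f (u - w) = f u - f w by rewrite /f raddfB.
  have fZ a u : f (a *: u) = a *: f u by rewrite /f linearZ.
  have blD w u u' : b (u + u') w = b u w + b u' w.
    by rewrite -[u]scale1r bl !scale1r.
  have brD w u u' : b w (u + u') = b w u + b w u'.
    by rewrite -[u]scale1r br !scale1r.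
  have b0l w : b 0 w = 0 by apply: (addrI (b 0 w)); rewrite -blD !addr0.
  have b0r w : b w 0 = 0 by apply: (addrI (b w 0)); rewrite -brD !addr0.
  case=> [u u' w|u w w'|a u w|a u w]; rewrite /= !fB ?fZ !fE.
  - by rewrite blD [X in X - _ - _]addrC addrK subrr.
  - by rewrite brD [X in X - _ - _]addrC addrK subrr.
  - by rewrite -[a *: u]addr0 bl b0l addr0 subrr.
  - by rewrite -[a *: w]addr0 br b0r addr0 subrr.
by exists L => v w; rewrite -fE -LE.
Qed.
End TensorLifts.

Section GTensor.
Variables (k : fieldType) (C : addcat) (A : rep C) (M : autmod k A) (X : autfct k A).

Definition gten_pure a (m : M) (z : X a) : gten M X a :=
  fpi (coinv_sub (ten_autfct M X)) a (ten m z).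

Lemma gten_pure_linearl a (z : X a) : linear (fun m => gten_pure m z).
Proof.
exact: (linear_comp (linear_funP (fpi (coinv_sub (ten_autfct M X)) a)) (ten_linearl z)).
Qed.

Lemma gten_pure_linearr a m : linear (@gten_pure a m).
Proof.
exact: (linear_comp (linear_funP (fpi (coinv_sub (ten_autfct M X)) a)) (@ten_linearr k M (X a) m)).
Qed.

Lemma gten_pure_act a (g : aut A) m (z : X a) :
  gten_pure (am_act M g m) (af_act X g a z) = gten_pure m z.
Proof.
apply/zpi_eq; apply: span_in; exists g, (ten m z).
by rewrite /= tensor_mapE.
Qed.

Lemma gten_pure_fact a b (f : hom a b) m (z : X a) :
  fact (gten M X) f (gten_pure m z) = gten_pure m (fact X f z).
Proof. by rewrite /gten_pure -fnat /= tensor_mapE. Qed.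

Lemma gten_span a (u : gten M X a) :
  exists z : {malg k[(M * X a)%type]}, u = mlift (fun p => gten_pure p.1 p.2) z.
Proof.
have [t ->] := lpi_surj u; have [z ->] := ten_span t; exists z.
exact: (mlift_linear_fun (fpi (coinv_sub (ten_autfct M X)) a)).
Qed.

Lemma gten_ext a (U : lmodType k) (f g : gten M X a -> U) : linear f -> linear g ->
  (forall m z, f (gten_pure m z) = g (gten_pure m z)) -> f =1 g.
Proof.
move=> lf lg fg u; have [z ->] := gten_span u.
rewrite (linear_mlift _ _ lf) (linear_mlift _ _ lg).
by apply: eq_mlift => -[m x]; apply: fg.
Qed.

Lemma gten_lift a (U : lmodType k) (b : M -> X a -> U) :
  (forall w, linear (b^~ w)) -> (forall v, linear (b v)) ->
  (forall g m x, b (am_act M g m) (af_act X g a x) = b m x) ->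
  exists L : {linear gten M X a -> U}, forall m x, L (gten_pure m x) = b m x.
Proof.
move=> bl br bA; have [L LE] := tensor_lift bl br.
have [||L' LE'] := @lquot_lift k _ U (coinv_sub (ten_autfct M X) a) L.
- exact: linear_funP.
- apply: span_linear_eq0 => [|_ [g [v ->]]]; first exact: linear_funP.
  rewrite linearB; apply/eqP; rewrite subr_eq0; apply/eqP.
  apply: (tensor_ext (f := L \o (tensor_map (am_act M g) (af_act X g a) :
    {linear tensor M (X a) -> tensor M (X a)})) (g := L)) => m x.
  by rewrite /= tensor_mapE !LE bA.
by exists L' => m x; rewrite LE' LE.
Qed.

End GTensor.

Lemma gten_map_pure (k : fieldType) (C : addcat) (A : rep C) (M : autmod k A)
    (X Y : autfct k A) (f : fhom X Y) (hf : equivariant f) a m (x : X a) :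
  gten_map M hf a (gten_pure m x) = gten_pure m (f a x).
Proof.
apply: etrans (lquot_mapE (@coinv_map_proof _ _ _ _ _ _ (ten_fhom_equivariant (M := M) hf) a) _) _.
exact: (congr1 (fpi (coinv_sub (ten_autfct M Y)) a) (tensor_mapE idfun (f a) m x)).
Qed.

Section Coordinates.
Variables (k : fieldType) (C : addcat).
Hypothesis ktr : k_trivial k C.
Variables (A : rep C) (M : autmod k A).

Lemma am_actK g : cancel (am_act M g) (am_act M (autV g)).
Proof.
move=> m; rewrite -am_actM (_ : autM _ _ = aut1 A) ?am_act1 //.
by apply: aut_ext => a v /=; rewrite autK.
Qed.

Lemma am_actVK g : cancel (am_act M (autV g)) (am_act M g).
Proof.
move=> m; rewrite -am_actM (_ : autM _ _ = aut1 A) ?am_act1 //.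
by apply: aut_ext => a v /=; rewrite autVK.
Qed.

(** Aut(A) acts freely on generators, so M tensored over k[Aut(A)] with the linearization of the
    orbit of a generator [s] is a copy of M: the class of m (x) g s corresponds to g^{-1} m. Points
    off the orbit go to 0. *)
Definition coord y (s v : A y) (m : M) : M :=
  if pselect (exists g : aut A, v = g y s) is left h
  then am_act M (autV (sval (cid h))) m else 0.

Lemma coord_in y (s : A y) (g : aut A) m : gens s -> coord s (g y s) m = am_act M (autV g) m.
Proof.
move=> gs; rewrite /coord; case: pselect => [h|]; last by case; exists g.
case: cid => h' /= e; congr (am_act M (autV _) m).
by apply: aut_ext => a v; apply: (gens_aut gs).
Qed.

Lemma coord_out y (s v : A y) m : ~ (exists g : aut A, v = g y s) -> coord s v m = 0.
Proof. by rewrite /coord; case: pselect. Qed.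

Lemma coord_linear y (s v : A y) : linear (coord s v).
Proof.
move=> c m n; rewrite /coord; case: pselect => [h|_]; first by rewrite linearP.
by rewrite scaler0 addr0.
Qed.

Lemma coord_act y (s v : A y) (g : aut A) m : gens s ->
  coord s (g y v) (am_act M g m) = coord s v m.
Proof.
move=> gs; have [[h ->]|nv] := pselect (exists h : aut A, v = h y s).
  rewrite -[g y (h y s)]/(autM g h y s) !coord_in //.
  rewrite (_ : autV (autM g h) = autM (autV h) (autV g)); last exact: aut_ext.
  by rewrite am_actM am_actK.
rewrite !coord_out // => -[h e]; apply: nv; exists (autM (autV g) h).
by rewrite /= -e autK.
Qed.

Definition pure_ten a (m : M) (z : {malg k[A a]}) : gten M (Qlow_aut k A) a :=
  @gten_pure k C A M (Qlow_aut k A) a m (fpi (proper_part k A) a z).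

Lemma pure_ten_linearl a z : linear (fun m => @pure_ten a m z).
Proof. exact: gten_pure_linearl. Qed.

Lemma pure_ten_linearr a m : linear (@pure_ten a m).
Proof.
exact: (linear_comp (@gten_pure_linearr k C A M (Qlow_aut k A) a m)
  (linear_funP (fpi (proper_part k A) a))).
Qed.

HB.instance Definition _ a m :=
  GRing.isLinear.Build k _ _ *:%R (@pure_ten a m) (@pure_ten_linearr a m).

Lemma pure_ten0l a z : @pure_ten a 0 z = 0.
Proof. exact: (linear_fun0 (pure_ten_linearl z)). Qed.

Lemma pure_tenE a m (z : {malg k[A a]}) : pure_ten m z = mlift (fun v => pure_ten m << v >>) z.
Proof. by rewrite -{1}[z]mlift_idE (linear_mlift _ _ (@pure_ten_linearr a m)). Qed.

Lemma pure_ten_act a g m (z : {malg k[A a]}) : pure_ten (am_act M g m) (klin_map k g a z) = pure_ten m z.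
Proof.
rewrite /pure_ten -(gten_pure_act (X := Qlow_aut k A) g m); congr gten_pure.
by rewrite /= lquot_mapE.
Qed.

Lemma pure_ten_fact a b (f : hom a b) m (z : {malg k[A a]}) :
  fact (gten M (Qlow_aut k A)) f (pure_ten m z) = pure_ten m (fact (klin k A) f z).
Proof. by rewrite /pure_ten gten_pure_fact; congr gten_pure; rewrite -fnat. Qed.

Lemma pure_ten_fop a b (f : {malg k[hom a b]}) m (z : {malg k[A a]}) :
  fop f (pure_ten m z) = pure_ten m (fop (F := klin k A) f z).
Proof.
rewrite /fop (linear_mlift _ _ (@pure_ten_linearr b m)).
by apply: eq_mlift => g; exact: pure_ten_fact.
Qed.

Lemma proper_gen a (v : A a) : ~ gens v -> proper_part k A a << v >>.
Proof.
move=> nv; apply: span_in; exists (fimage (klin_map k (rincl (cyc v)))).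
  by exists (cyc v).
exists << ZSub (introT (sg_predP (cyc v a) v) (cyc_id v)) >>.
by rewrite /= malg_mapU.
Qed.

Lemma pure_ten_proper a m (v : A a) : ~ gens v -> pure_ten m << v >> = 0.
Proof.
move=> /proper_gen /(lpi_eq0 (proper_part k A a)) h.
rewrite -(linear_fun0 (@gten_pure_linearr k C A M (Qlow_aut k A) a m)).
by congr gten_pure; exact: h.
Qed.

Lemma pure_ten_ext a (U : lmodType k) (f g : gten M (Qlow_aut k A) a -> U) :
  linear f -> linear g -> (forall m v, f (pure_ten m << v >>) = g (pure_ten m << v >>)) -> f =1 g.
Proof.
move=> lf lg fg; apply: gten_ext => // m z; have [x ->] := lpi_surj z.
rewrite -/(pure_ten m x) pure_tenE (linear_mlift _ _ lf) (linear_mlift _ _ lg).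
by apply: eq_mlift => v; apply: fg.
Qed.

(** An element of a proper subobject cannot be a generator. With [proper_gen], this makes Q_A(a)
    free on the generators of A lying in A(a). *)
Lemma proper_killed a (U : lmodType k) (f : {malg k[A a]} -> U) : linear f ->
  (forall v, ~ gens v -> f << v >> = 0) -> forall z, proper_part k A a z -> f z = 0.
Proof.
move=> lf hf; apply: span_linear_eq0 => // _ [_ [B pB ->] [w ->]].
rewrite -[klin_map _ _ _ _]/(mlift (fun v => << val v >>) w) (linear_mlift _ _ lf).
apply: mlift0 => v /=; rewrite hf // => gv; apply: pB => b u.
by have [g ->] := gv b u; apply: rsub_map; apply/sg_predP/valP.
Qed.

Lemma comp_exists y (s : A y) : gens s ->
  exists L : {linear gten M (Qlow_aut k A) y -> M}, forall m v, L (pure_ten m << v >>) = coord s v m.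
Proof.
move=> gs; pose c m : {malg k[A y]} -> M := mlift (fun v => coord s v m).
have cl m : linear (c m) by move=> a u v; rewrite /c linearP.
have cm z : linear (c^~ z).
  move=> a m m'; rewrite /c; move: z; apply: malg_eq_linear => [b u v|b u v|v].
  - by rewrite linearP.
  - exact: (linear_combine a (cl m) (cl m')).
  - by rewrite !mliftU coord_linear.
have cK m z : proper_part k A y z -> c m z = 0.
  apply: proper_killed => // v nv; rewrite /c mliftU coord_out // => -[g vg].
  by apply: nv; rewrite vg; apply: aut_gens.
pose cb m (z : Qlow k A y) := c m (repr z).
have cbE m z : cb m (fpi (proper_part k A) y z) = c m z.
  pose c' : {linear {malg k[A y]} -> M} := HB.pack (c m)
    (GRing.isLinear.Build k _ _ *:%R (c m) (cl m)).
  apply/eqP; rewrite -subr_eq0 /cb -[c m]/(c' : _ -> _) -raddfB; apply/eqP/cK.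
  by apply/zpi_eq; rewrite /= /lpi /zpi reprK.
have [|||L LE] := @gten_lift k C A M (Qlow_aut k A) y M cb.
- by move=> z a m m'; have [x ->] := lpi_surj z; rewrite !cbE cm.
- move=> m a z z'; have [x ->] := lpi_surj z; have [x' ->] := lpi_surj z'.
  by rewrite -[a *: _ + _](linearP (fpi (proper_part k A) y)) !cbE cl.
- move=> g m z; have [x ->] := lpi_surj z.
  rewrite /= lquot_mapE !cbE /c mlift_map; apply: eq_mlift => v /=.
  exact: coord_act.
by exists L => m v; rewrite LE cbE /c mliftU.
Qed.

Definition comp y (s : A y) : {linear gten M (Qlow_aut k A) y -> M} :=
  if pselect (gens s) is left gs then sval (cid (comp_exists gs)) else \0.

Lemma compU y (s : A y) m v : gens s -> comp s (pure_ten m << v >>) = coord s v m.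
Proof. by rewrite /comp; case: pselect => // gs _; case: cid. Qed.

Lemma compE y (s : A y) m z : gens s -> comp s (pure_ten m z) = mlift (fun v => coord s v m) z.
Proof. move=> gs; rewrite pure_tenE (linear_mlift _ _ (linear_funP (comp s))).
by apply: eq_mlift => v; apply: compU. Qed.

Lemma theta_comp y (s : A y) a q (u : gten M (Qlow_aut k A) y) :
  gens s -> Qup_sub k A a q -> fop (theta ktr s q) u = pure_ten (comp s u) q.
Proof.
move=> gs hq.
have ll : linear (fun u => pure_ten (comp s u) q).
  exact: (linear_comp (pure_ten_linearl q) (linear_funP (comp s))).
apply: (pure_ten_ext (fopPr (theta ktr s q)) ll) => m v.
rewrite pure_ten_fop.
rewrite (compU m v gs).
have [[g ->]|nv] := pselect (exists g : aut A, v = g y s).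
  rewrite (theta_gens ktr g q gs) (coord_in g m gs) -{1}[m](am_actVK g).
  exact: pure_ten_act.
rewrite (coord_out m nv) pure_ten0l; have [h|h] := theta_dichotomy ktr v gs; first by case: nv.
rewrite (h a q hq); exact: (linear_fun0 (@pure_ten_linearr a m)).
Qed.

(** [choose] depends only on the predicate as soon as its default satisfies it, so the result is the
    same along the whole orbit. *)
Definition orbit_rep y (v : A y) : A y := choose (fun u => `[< exists g : aut A, u = g y v >]) v.

Lemma orbit_repP y (v : A y) : exists g : aut A, orbit_rep v = g y v.
Proof.
apply/asboolP; apply: (@chooseP _ (fun u => `[< exists g : aut A, u = g y v >])).
by apply/asboolP; exists (aut1 A).
Qed.

Lemma orbit_rep_aut y (v : A y) (g : aut A) : orbit_rep (g y v) = orbit_rep v.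
Proof.
rewrite /orbit_rep (_ : (fun u => `[< exists h : aut A, u = h y (g y v) >])
                 = (fun u => `[< exists h : aut A, u = h y v >])).
  apply: choose_id; apply/asboolP; [by exists g | by exists (aut1 A)].
apply/funext => u; apply: asbool_equiv_eq; split=> -[h ->].
  by exists (autM h g).
by exists (autM h (autV g)); rewrite /= autK.
Qed.

(** A tensor u is rebuilt from its components: it is the sum of (component at r) (x) [r] over the
    orbit representatives r of generators, finitely many because A(y) is finite. If A has no
    generator over y, then Q_A(y) = 0. *)
Lemma comp_detect y (u : gten M (Qlow_aut k A) y) :
  (forall s, gens s -> comp s u = 0) -> u = 0.
Proof.
have [[s0 gs0]|ns] := pselect (exists s : A y, gens s); last first.
  move=> _; apply: (pure_ten_ext (f := idfun) (g := fun=> 0)) => [||m v].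
  - by [].
  - by move=> c x v; rewrite scaler0 addr0.
  by apply: pure_ten_proper => gv; apply: ns; exists v.
have [l hl] := gens_covered ktr y gs0.
move=> h; pose R := [seq r <- undup l | `[< gens r >] && (orbit_rep r == r)].
have rl : linear (fun u => \sum_(r <- R) pure_ten (comp r u) << r >>).
  by apply: linear_bigsum => r; exact: (linear_comp (pure_ten_linearl _) (linear_funP (comp r))).
set r := fun u => _ in rl.
suff -> : u = r u.
  rewrite /r big_seq; apply: big1 => x.
  rewrite mem_filter => /andP[/andP[/asboolP gx _] _].
  by rewrite (h x gx) pure_ten0l.
apply: (pure_ten_ext (f := idfun) (g := r)) => // m v; rewrite /idfun /r.
have [gv|nv] := pselect (gens v); last first.
  rewrite (pure_ten_proper m nv) big_seq; apply/esym/big1 => x.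
  rewrite mem_filter => /andP[/andP[/asboolP gx _] _].
  by rewrite (linear_fun0 (linear_funP (comp x))) pure_ten0l.
have [g rv] := orbit_repP v.
have vrep : v = autV g y (orbit_rep v) by rewrite rv /= autK.
have grv : gens (orbit_rep v) by rewrite rv; apply: aut_gens.
rewrite (sum_seq_unique (i := orbit_rep v)); first last.
- move=> x; rewrite mem_filter => /andP[/andP[/asboolP gx /eqP rx] _] xv.
  rewrite (compU m v gx) coord_out ?pure_ten0l; first by [].
  by case=> h' vh; move: xv; rewrite vh orbit_rep_aut rx eqxx.
- by rewrite mem_filter mem_undup hl rv orbit_rep_aut -rv eqxx (asboolT grv).
- by rewrite filter_uniq ?undup_uniq.
rewrite (compU m v grv) {3}vrep (coord_in _ _ grv) {1}vrep -(pure_ten_act g).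
congr pure_ten; first by congr (am_act M _ m); apply: aut_ext.
by rewrite -[LHS]/(malg_map _ _) malg_mapU /= autVK.
Qed.

Lemma pure_ten_span a (w : gten M (Qlow_aut k A) a) :
  fimage (Qmap M) a w <->
  span (fun w => exists m q, Qup_sub k A a q /\ w = pure_ten m q) w.
Proof.
have QmapE m (x : Qup_aut k A a) : Qmap M a (gten_pure m x) = pure_ten m (lval x).
  apply: etrans (congr1 (gten_map M _ a) (gten_map_pure _ m x)) _.
  exact: gten_map_pure.
split=> [[u ->]|].
  have [z ->] := gten_span u; rewrite (linear_mlift _ _ (linear_funP (Qmap M a))).
  apply: subspc_mlift => -[m x].
  by apply: span_in; exists m, (lval x); split; [apply: (lvalP x) | apply: QmapE].
apply=> {}w [m [q [hq ->]]].
exists (gten_pure (X := Qup_aut k A) m (ZSub (introT (sg_predP (Qup_sub k A a) q) hq))).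
by rewrite QmapE.
Qed.

End Coordinates.

(** * Simplicity of Q(A, M) *)

Section FctFacts.
Variables (k : fieldType) (C : addcat).
Implicit Types F G : fct k C.

Lemma fsub_elt F (S : fsub F) a v : S a v -> exists w : fsub_fct S a, lval w = v.
Proof. by move=> Sv; exists (ZSub (introT (sg_predP (S a) v) Sv)). Qed.

Lemma lval_fop F (S : fsub F) y a (f : {malg k[hom y a]}) (w : fsub_fct S y) :
  lval (fop f w) = fop f (lval w).
Proof. exact: (fop_nat (fincl S)). Qed.

Lemma fhom_factor (X G G' : fct k C) (p : fhom X G) (p' : fhom X G') :
  (forall a w, exists u, w = p a u) -> (forall a u, p a u = 0 -> p' a u = 0) ->
  exists f : fhom G G', forall a u, f a (p a u) = p' a u.
Proof.
move=> pS pp'; pose f a w := p' a (sval (cid (pS a w))).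
have fE a u : f a (p a u) = p' a u.
  rewrite /f; case: cid => u' /= e; apply/eqP; rewrite -subr_eq0 -raddfB.
  by apply/eqP/pp'; rewrite linearB e subrr.
have fl a : linear (f a).
  move=> c w w'; have [u ->] := pS a w; have [u' ->] := pS a w'.
  by rewrite -linearP !fE linearP.
pose f' a : {linear G a -> G' a} := HB.pack (f a) (GRing.isLinear.Build k (G a) (G' a) *:%R (f a) (fl a)).
have fN a b (h : hom a b) w : f' b (fact G h w) = fact G' h (f' a w).
  by have [u ->] := pS a w; rewrite -fnat /= !fE fnat.
by exists (FHom fN) => a u; rewrite /= fE.
Qed.

Lemma fct_iso_kernel (X G G' : fct k C) (p : fhom X G) (p' : fhom X G') :
  (forall a w, exists u, w = p a u) -> (forall a w, exists u, w = p' a u) ->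
  (forall a u, p a u = 0 <-> p' a u = 0) -> fct_iso G G'.
Proof.
move=> pS pS' pp'.
have [f fE] := fhom_factor pS (fun a u => (pp' a u).1).
have [g gE] := fhom_factor pS' (fun a u => (pp' a u).2).
exists f, g => a; split=> w; first by have [u ->] := pS a w; rewrite fE gE.
by have [u ->] := pS' a w; rewrite gE fE.
Qed.

Lemma fct_iso_refl F : fct_iso F F.
Proof.
by exists (@FHom k C F F (fun=> idfun) (fun _ _ _ _ => erefl)),
  (@FHom k C F F (fun=> idfun) (fun _ _ _ _ => erefl)).
Qed.

Lemma fct_iso_sym F G : fct_iso F G -> fct_iso G F.
Proof. by move=> [f [g fg]]; exists g, f => x; have [] := fg x. Qed.

Lemma fct_iso_trans F G H : fct_iso F G -> fct_iso G H -> fct_iso F H.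
Proof.
move=> [f [g fg]] [f' [g' fg']]; exists (fhom_cmp f' f), (fhom_cmp g g') => x.
have [fK gK] := fg x; have [fK' gK'] := fg' x.
by split=> v /=; rewrite ?fK' ?fK ?gK ?gK'.
Qed.

Lemma simple_fop F x (w : F x) a (v : F a) : simple_in (@all_fct k C) F -> w <> 0 ->
  exists f : {malg k[hom x a]}, v = fop f w.
Proof.
move=> [_ _ hS] w0.
have h0 b : exists f : {malg k[hom x b]}, 0 = fop f w by exists 0; rewrite fop0l.
have hB b u v' : (exists f : {malg k[hom x b]}, u = fop f w) ->
    (exists f : {malg k[hom x b]}, v' = fop f w) -> exists f : {malg k[hom x b]}, u - v' = fop f w.
  by move=> [f ->] [g ->]; exists (f - g); rewrite fopBl.
have hZ b c u : (exists f : {malg k[hom x b]}, u = fop f w) ->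
    exists f : {malg k[hom x b]}, c *: u = fop f w.
  by move=> [f ->]; exists (c *: f); rewrite /fop linearZ.
pose S b := SubSpc (ss_grp := SubGrp (h0 b) (@hB b)) (@hZ b).
have hF b c (h : hom b c) u : S b u -> S c (fact F h u).
  by move=> [f ->]; exists (mcmp << h >> f); rewrite fop_cmp fopU.
have [//|z|] := hS (FSub hF); last exact.
by case: w0; apply: z; exists << idm x >>; rewrite fop_idm.
Qed.

End FctFacts.

Section QSimple.
Variables (k : fieldType) (C : addcat).
Hypothesis ktr : k_trivial k C.
Implicit Types A : rep C.

Definition Qup_ne A := exists a (q : {malg k[A a]}), Qup_sub k A a q /\ q <> 0.

Lemma coord_id A (M : autmod k A) z (t : A z) (m : M) : gens t -> coord t t m = m.
Proof.
move=> gt; rewrite -[X in coord _ X]/(aut1 A z t) coord_in //.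
by rewrite -{1}[m]am_act1 am_actK.
Qed.

Lemma Q_elt A (M : autmod k A) a (m : M) q : Qup_sub k A a q ->
  exists w : Q M a, lval w = pure_ten m q.
Proof.
by move=> hq; apply: fsub_elt; apply/pure_ten_span; apply: span_in; exists m, q.
Qed.

Definition dirac A z (t : A z) (q0 : {malg k[A z]}) : Prop :=
  [/\ gens t, Qup_sub k A z q0 &
    forall (W : lmodType k) (h : A z -> W),
      (forall v, ~ (exists g : aut A, v = g z t) -> h v = 0) -> mlift h q0 = h t].

Lemma dirac_exists A y (s : A y) : gens s -> Qup_ne A ->
  exists z (t : A z) (q0 : {malg k[A z]}), dirac t q0.
Proof. by move=> gs [a [q [hq q0]]]; apply: Qup_dirac gs hq q0. Qed.

Lemma comp_dirac A (M : autmod k A) z (t : A z) q0 m : dirac t q0 ->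
  comp M t (pure_ten m q0) = m.
Proof.
move=> [gt hq0 hd]; rewrite (compE m q0 gt) hd ?coord_id // => v.
exact: coord_out.
Qed.

(** For a subfunctor S, the m such that m (x) q lies in S for all q in Q^A form a submodule N of M.
    If N = M then S is everything. If N = 0, then by [theta_comp] all the components of an element
    of S lie in N, so S = 0. *)
Theorem Q_simple A (M : autmod k A) y (s : A y) :
  gens s -> Qup_ne A -> simple_autmod M -> simple_in (@all_fct k C) (Q M).
Proof.
move=> gs neQ [[m0 /eqP m00] sM].
have [z [t [q0 dt]]] := dirac_exists gs neQ; have [gt hq0 hd] := dt.
split=> // [Q0|S _].
  have [w wE] := Q_elt m0 hq0; apply: m00.
  rewrite -(comp_dirac m0 dt) -wE (Q0 z w).
  exact: (linear_fun0 (linear_funP (comp M t))).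
have [S0|nS0] := pselect (fsub_zero S); [by left | right].
(* S consists of elements of a subtype; [inS] is its image in M (x) Q_A, where components make
   sense. *)
pose inS b u := exists2 w, S b w & lval w = u.
have inS0 b : inS b 0 by exists 0; [apply: sg0 | rewrite raddf0].
have inSB b u v : inS b u -> inS b v -> inS b (u - v).
  by move=> [w Sw <-] [w' Sw' <-]; exists (w - w'); [apply: sgB | rewrite raddfB].
have inSZ b c u : inS b u -> inS b (c *: u).
  by move=> [w Sw <-]; exists (c *: w); [apply: ssZ | rewrite linearZ].
pose S' b := SubSpc (ss_grp := SubGrp (inS0 b) (@inSB b)) (@inSZ b).
pose N m := forall b q, Qup_sub k A b q -> S' b (pure_ten m q).
have N0 : N 0 by move=> b q _; rewrite pure_ten0l; apply: sg0.
have NB m n : N m -> N n -> N (m - n).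
  move=> hm hn b q hq; rewrite -scaleN1r addrC pure_ten_linearl scaleN1r addrC.
  by apply: sgB; [apply: hm | apply: hn].
have NZ c m : N m -> N (c *: m).
  move=> hm b q hq; rewrite -[c *: m]addr0 pure_ten_linearl pure_ten0l addr0.
  by apply: ssZ; apply: hm.
have NA g m : N m -> N (am_act M g m).
  move=> hm b q hq; rewrite -(pure_ten_act (autV g)) am_actK.
  by apply: hm; apply: Qup_stable.
have [hN|hN] := sM (SubSpc (ss_grp := SubGrp N0 NB) NZ) NA; last first.
  move=> b w; have /pure_ten_span h : fimage (Qmap M) b (lval w) by apply: (lvalP w).
  have [|w' Sw' /lval_inj <-] := h (S' b) _ => // _ [m [q [hq ->]]].
  exact: (hN m b q hq).
case: nS0 => b w Sw; apply: lval_inj; rewrite raddf0; apply: (comp_detect ktr) => r gr.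
apply: hN => c q hq; exists (fop (theta ktr r q) w); first exact: fop_fsub.
by rewrite lval_fop (theta_comp ktr _ gr hq).
Qed.

End QSimple.

(** * Recovering A and M from Q(A, M) *)

Section FreeFct.
Variables (k : fieldType) (C : addcat) (A : rep C) (M : autmod k A).

Lemma free_act_id x (p : M * Qup k A x) : (p.1, fact (Qup k A) (idm x) p.2) = p.
Proof. by case: p => m q; congr pair; apply: fact1. Qed.

Lemma free_act_cmp x y z (g : hom y z) (f : hom x y) (p : M * Qup k A x) :
  (p.1, fact (Qup k A) (g \oc f) p.2) = (p.1, fact (Qup k A) g (fact (Qup k A) f p.2)).
Proof. by congr pair; apply: factM. Qed.

Definition free_map a b (h : hom a b) (p : M * Qup k A a) : M * Qup k A b :=
  (p.1, fact (Qup k A) h p.2).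

(** Free functor on formal pairs (m, q). Both Q(A, M) and a candidate G are quotients of it, so an
    isomorphism results from comparing two kernels, and bilinearity or invariance under Aut(A) need
    no separate check. *)
Program Definition free_fct : fct k C :=
  @Fct k C (fun a => {malg k[(M * Qup k A a)%type]})
    (fun a b h => (malg_map (free_map h) :
       {linear {malg k[(M * Qup k A a)%type]} -> {malg k[(M * Qup k A b)%type]}})) _ _.
Next Obligation. by move=> x v; apply: malg_map_id => p; apply: free_act_id. Qed.
Next Obligation.
move=> x y z g f v; rewrite /= malg_map_comp; apply: eq_malg_map => p; exact: free_act_cmp.
Qed.

Definition free_fhom (G : fct k C) (t : forall a, M -> Qup k A a -> G a)
    (tN : forall a b (h : hom a b) m x, fact G h (t a m x) = t b m (fact (Qup k A) h x)) :
  fhom free_fct G.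
Proof.
apply: (@FHom k C free_fct G (fun a => (mlift (fun p => t a p.1 p.2) :
   {linear {malg k[(M * Qup k A a)%type]} -> G a}))).
move=> a b h v; rewrite /= mlift_map mlift_linear_fun; apply: eq_mlift => p /=.
by rewrite tN.
Defined.

Definition gen_sum (G : fct k C) (t : forall a, M -> Qup k A a -> G a) a
  (z : {malg k[(M * Qup k A a)%type]}) : G a := mlift (fun p => t a p.1 p.2) z.

Lemma Q_iso (G : fct k C) (t : forall a, M -> Qup k A a -> G a) :
  (forall a b (h : hom a b) m x, fact G h (t a m x) = t b m (fact (Qup k A) h x)) ->
  (forall a w, exists z, w = gen_sum t (a := a) z) ->
  (forall a z, gen_sum t (a := a) z = 0 <->
     @gen_sum (gten M (Qlow_aut k A)) (fun a m x => pure_ten m (lval x)) a z = 0) ->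
  fct_iso (Q M) G.
Proof.
move=> tN tS tK.
pose e a m (x : Qup k A a) : Q M a := sval (cid (Q_elt m (lvalP x))).
have eE a m x : lval (@e a m x) = pure_ten m (lval x) by rewrite /e; case: cid.
have eN a b (h : hom a b) m x : fact (Q M) h (e a m x) = e b m (fact (Qup k A) h x).
  by apply: lval_inj; rewrite eE; apply: etrans (congr1 (fact _ h) (eE a m x)) (pure_ten_fact h m _).
have sE a z : lval (gen_sum e (a := a) z) =
    @gen_sum (gten M (Qlow_aut k A)) (fun a m x => pure_ten m (lval x)) a z.
  apply: etrans (mlift_linear_fun (fincl (fimage (Qmap M)) a) _ _) _.
  by apply: eq_mlift => -[m x]; apply: eE.
apply: (@fct_iso_kernel k C free_fct _ _ (free_fhom eN) (free_fhom tN)) => [a w|//|a u].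
  have /pure_ten_span h : fimage (Qmap M) a (lval w) by apply: (lvalP w).
  have [_ [m [q [hq ->]]]|z wz] := span_mlift (h := fun p : M * Qup k A a => pure_ten p.1 (lval p.2)) _ h.
    by have [x <-] := fsub_elt hq; exists (m, x).
  by exists z; apply: lval_inj; exact: etrans wz (esym (sE a z)).
rewrite -[free_fhom eN a u]/(gen_sum e (a := a) u) -[free_fhom tN a u]/(gen_sum t (a := a) u) tK -sE.
by split=> [->|h]; [rewrite raddf0 | apply: lval_inj; rewrite h raddf0].
Qed.

End FreeFct.

Section Injectivity.
Variables (k : fieldType) (C : addcat).
Hypothesis ktr : k_trivial k C.
Implicit Types A : rep C.

(** The element w = m (x) q0 is fixed by theta_{t,q0}, hence so is its nonzero image in M' (x)
    Q_{A'}. By [theta_kill] this forces a generator v of A' whose annihilator is contained in that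
    of t, and v |-> t defines the surjection. *)
Lemma Q_iso_rep_surj A A' (M : autmod k A) (M' : autmod k A') y (s : A y)
    (f : fhom (Q M) (Q M')) :
  gens s -> Qup_ne k A -> (exists m : M, m != 0) -> (forall a, injective (f a)) ->
  exists (z : C) (t : A' z) (p : rhom A' A), gens t /\ forall a u, exists v, u = p a v.
Proof.
move=> gs nQ [m /eqP m0] fI.
have [z [t [q0 dt]]] := dirac_exists gs nQ; have [gt hq0 hd] := dt.
have [w wE] := Q_elt m hq0.
have tw : fop (theta ktr t q0) w = w.
  by apply: lval_inj; rewrite lval_fop (theta_comp ktr _ gt hq0) {1}wE (comp_dirac m dt) wE.
have fw : lval (f z w) <> 0.
  move=> e; have fw0 : f z w = 0 by apply: lval_inj; rewrite e raddf0.
  have w0 : w = 0 by apply: (fI z); rewrite fw0 raddf0.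
  apply: m0; rewrite -(comp_dirac m dt) -wE w0.
  exact: (linear_fun0 (linear_funP (comp M t))).
have [v [gv tv]] : exists v : A' z, gens v /\ ann_le v t.
  apply: contrapT => h; apply: fw.
  rewrite -tw (fop_nat f) lval_fop.
  have l0 : linear (fun=> 0 : gten M' (Qlow_aut k A') z).
    by move=> W c x x'; rewrite scaler0 addr0.
  apply: (pure_ten_ext (fopPr (theta ktr t q0)) (l0 _)) => m' v.
  rewrite pure_ten_fop.
  have [gv|nv] := pselect (gens v).
    rewrite theta_kill; [|exact: gt| |exact: hq0].
      exact: (linear_fun0 (@pure_ten_linearr k C A' M' z m')).
    by move=> vt; apply: h; exists v.
  by rewrite -pure_ten_fop (pure_ten_proper m' nv); apply: (linear_fun0 (fopPr _)).
have [p pv] := rhom_gens gv tv.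
exists z, v, p; split=> // a u; have [g ->] := gt a u.
by exists (rmap A' g v); rewrite rnat pv.
Qed.

Lemma Q_iso_rep A A' (M : autmod k A) (M' : autmod k A') y (s : A y) y' (s' : A' y') :
  gens s -> gens s' -> Qup_ne k A -> Qup_ne k A' ->
  (exists m : M, m != 0) -> (exists m : M', m != 0) ->
  fct_iso (Q M) (Q M') -> rep_iso A A'.
Proof.
move=> gs gs' nQ nQ' nM nM' [f [g fg]].
have fI a : injective (f a) by apply: can_inj (fg a).1.
have gI a : injective (g a) by apply: can_inj (fg a).2.
have [_ [_ [p [_ pS]]]] := Q_iso_rep_surj gs nQ nM fI.
have [_ [_ [q [_ qS]]]] := Q_iso_rep_surj gs' nQ' nM' gI.
exact: (rep_iso_of_surj ktr gs gs' qS pS).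
Qed.

(** Since m (x) q = theta_{t,q} (m (x) q0), the morphism is determined by its values on the m (x)
    q0, and r m is the component at t of such a value. Equivariance comes from g m (x) q0 = m (x)
    g^{-1} q0. *)
Lemma Q_fhom_mod A (M M' : autmod k A) z (t : A z) (q0 : {malg k[A z]}) (f : fhom (Q M) (Q M')) :
  dirac t q0 -> exists r : {linear M -> M'},
    (forall a m q (w : Q M a), Qup_sub k A a q -> lval w = pure_ten m q -> lval (f a w) = pure_ten (r m) q)
    /\ (forall g m, r (am_act M g m) = am_act M' g (r m)).
Proof.
move=> dt; have [gt hq0 hd] := dt.
pose e m : Q M z := sval (cid (Q_elt m hq0)).
have eE m : lval (e m) = pure_ten m q0 by rewrite /e; case: cid.
pose r m := comp M' t (lval (f z (e m))).
have rl : linear r.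
  have el : linear e by move=> c m m'; apply: lval_inj; rewrite eE pure_ten_linearl -!eE.
  exact: (linear_comp (linear_funP (comp M' t))
    (linear_comp (linear_funP (fincl (fimage (Qmap M')) z)) (linear_comp (linear_funP (f z)) el))).
have rE a m q (w : Q M a) : Qup_sub k A a q -> lval w = pure_ten m q -> lval (f a w) = pure_ten (r m) q.
  move=> hq wE; have -> : w = fop (theta ktr t q) (e m).
    by apply: lval_inj; rewrite lval_fop (theta_comp ktr _ gt hq) wE eE (comp_dirac m dt).
  by rewrite (fop_nat f) lval_fop (theta_comp ktr _ gt hq).
pose r' : {linear M -> M'} := HB.pack r (GRing.isLinear.Build k M M' *:%R r rl).
exists r'; split=> // g m.
have hq := Qup_stable (autV g) hq0.
have [w wE] := Q_elt m hq.
have eg : lval (e (am_act M g m)) = pure_ten m (klin_map k (autV g) z q0).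
  by rewrite eE -(pure_ten_act (autV g)) am_actK.
rewrite -[LHS](comp_dirac _ dt) -(rE _ _ _ (e (am_act M g m)) hq0 (eE _)).
have gV : klin_map k g z (klin_map k (autV g) z q0) = q0.
  rewrite -[LHS]/(malg_map _ (malg_map _ _)) malg_map_comp.
  by apply: malg_map_id => v /=; rewrite autVK.
rewrite (rE _ _ _ _ hq eg) -(pure_ten_act g) gV; exact: comp_dirac dt.
Qed.

Lemma Q_iso_mod A (M M' : autmod k A) y (s : A y) : gens s -> Qup_ne k A ->
  fct_iso (Q M) (Q M') -> autmod_iso M M'.
Proof.
move=> gs nQ [f [g fg]].
have [z [t [q0 dt]]] := dirac_exists gs nQ; have [gt hq0 hd] := dt.
have [r [rE rA]] := Q_fhom_mod f dt; have [r' [rE' rA']] := Q_fhom_mod g dt.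
exists r, r'; split=> // m.
  have [w wE] := Q_elt m hq0.
  have := rE' _ _ _ _ hq0 (rE _ _ _ _ hq0 wE); rewrite (fg z).1 wE => /(congr1 (comp M t)).
  by rewrite !(comp_dirac _ dt).
have [w wE] := Q_elt m hq0.
have := rE _ _ _ _ hq0 (rE' _ _ _ _ hq0 wE); rewrite (fg z).2 wE => /(congr1 (comp M' t)).
by rewrite !(comp_dirac _ dt).
Qed.

(** Both functors are quotients of the free functor on pairs. The kernels agree because [f] turns
    the components of a tensor over M into those of its image over M'. *)
Lemma Q_mod_iso A (M M' : autmod k A) : autmod_iso M M' -> fct_iso (Q M) (Q M').
Proof.
move=> [f [f' [fK fK' fA]]].
pose t a m (x : Qup k A a) : Q M' a := sval (cid (Q_elt (f m) (lvalP x))).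
have tE a m x : lval (@t a m x) = pure_ten (f m) (lval x) by rewrite /t; case: cid.
have sE a z : lval (gen_sum t (a := a) z) =
    mlift (fun p : M * Qup k A a => pure_ten (f p.1) (lval p.2)) z.
  apply: etrans (mlift_linear_fun (fincl (fimage (Qmap M')) a) _ _) _.
  by apply: eq_mlift => -[m x]; apply: tE.
have cE y (s : A y) (u : {malg k[(M * Qup k A y)%type]}) : gens s ->
    comp M' s (mlift (fun p : M * Qup k A y => pure_ten (f p.1) (lval p.2)) u) =
    f (comp M s (mlift (fun p : M * Qup k A y => pure_ten p.1 (lval p.2)) u)).
  move=> gs; rewrite (linear_mlift _ _ (linear_funP (comp M' s))).
  rewrite (linear_mlift _ _ (linear_funP (comp M s))) mlift_linear_fun.
  apply: eq_mlift => -[m x].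
  apply: etrans (compE (f m) (lval x) gs) _.
  apply: etrans _ (esym (congr1 f (compE m (lval x) gs))).
  rewrite mlift_linear_fun; apply: eq_mlift => v /=.
  rewrite /coord; case: pselect => h; first by rewrite fA.
  by rewrite raddf0.
apply: (Q_iso (t := t)) => [a b h m x|a w|a z].
- apply: lval_inj; rewrite tE; apply: etrans (congr1 (fact _ h) (tE a m x)) (pure_ten_fact h _ _).
- have /pure_ten_span h : fimage (Qmap M') a (lval w) by apply: (lvalP w).
  have [_ [m [q [hq ->]]]|z wz] :=
    span_mlift (h := fun p : M * Qup k A a => pure_ten (f p.1) (lval p.2)) _ h.
    have [x xq] := fsub_elt hq; exists (f' m, x).
    rewrite -xq -{1}(fK' m); exact: erefl.
  by exists z; apply: lval_inj; exact: etrans wz (esym (sE a z)).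
- split=> h.
    apply: (comp_detect ktr) => s gs; apply: (can_inj fK); rewrite raddf0.
    apply: etrans (esym (cE a s z gs)) _; rewrite -sE h.
    exact: (linear_fun0 (linear_comp (linear_funP (comp M' s))
      (linear_funP (fincl (fimage (Qmap M')) a)))).
  apply: lval_inj; rewrite raddf0 sE; apply: (comp_detect ktr) => s gs.
  rewrite (cE a s z gs) -[RHS](raddf0 f); congr (f _).
  apply: etrans (congr1 (comp M s) h) _.
  exact: (linear_fun0 (linear_funP (comp M s))).
Qed.

End Injectivity.

(** * Recovering M from a simple functor *)

Section Recognition.
Variables (k : fieldType) (C : addcat).
Hypothesis ktr : k_trivial k C.
Variables (F : fct k C) (A : rep C).
Hypothesis simF : simple_in (@all_fct k C) F.
Hypothesis relF : forall y a (f : {malg k[hom y a]}),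
  (forall v : A y, fop (F := klin k A) f << v >> = 0) -> forall w : F y, fop f w = 0.

Lemma rel_eq y a (f g : {malg k[hom y a]}) :
  (forall v : A y, fop (F := klin k A) f << v >> = fop (F := klin k A) g << v >>) ->
  forall w : F y, fop f w = fop g w.
Proof.
move=> fg w; apply/eqP; rewrite -subr_eq0 -fopBl; apply/eqP/relF => v.
by rewrite fopBl fg subrr.
Qed.

(** Checked on the points of A: at g s both sides give g (f q), and off the orbit of s both
    vanish. *)
Lemma fop_theta y (s : A y) a b (f : {malg k[hom a b]}) (q : {malg k[A a]}) (w : F y) :
  gens s -> Qup_sub k A a q ->
  fop f (fop (theta ktr s q) w) = fop (theta ktr s (fop (F := klin k A) f q)) w.
Proof.
move=> gs hq; rewrite -fop_cmp; apply: rel_eq => v; rewrite fop_cmp.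
have hfq : Qup_sub k A b (fop (F := klin k A) f q) by apply: fop_fsub.
have [[g ->]|h] := theta_dichotomy ktr v gs.
  by rewrite !theta_gens // (fop_nat (klin_map k g)).
by rewrite (h a q hq) (h b _ hfq) linear0.
Qed.

Variables (z : C) (t : A z) (q0 : {malg k[A z]}).
Hypothesis dt : dirac t q0.
Let gt : gens t. Proof. by case: dt. Qed.
Let hq0 : Qup_sub k A z q0. Proof. by case: dt. Qed.
Local Notation Th q := (theta ktr t q).
Let thq0 a q : Qup_sub k A a q -> fop (F := klin k A) (Th q) q0 = q.
Proof. by case: dt => _ _ hd; apply: (theta_dirac ktr gt hd). Qed.

Let fix0 : fop (Th q0) (0 : F z) = 0. Proof. by rewrite linear0. Qed.
Let fixB u v : fop (Th q0) u = u -> fop (Th q0) v = v -> fop (Th q0) (u - v) = u - v :> F z.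
Proof. by move=> hu hv; rewrite linearB /= hu hv. Qed.
Let fixZ c u : fop (Th q0) u = u -> fop (Th q0) (c *: u) = c *: u :> F z.
Proof. by move=> hu; rewrite linearZ /= hu. Qed.

(* [theta t q0] acts on [F] as an idempotent; its image is the module attached to [F]. *)
Definition fix_spc : subspc (F z) := SubSpc (ss_grp := SubGrp fix0 fixB) fixZ.

Let act_op (g : rhom A A) : {malg k[hom z z]} := Th (klin_map k g z q0).

Let Qg (g : aut A) : Qup_sub k A z (klin_map k (ainv g) z q0).
Proof. exact: (Qup_stable (autV g) hq0). Qed.

Let act_opM (g : aut A) a (q : {malg k[A a]}) (v : F z) : Qup_sub k A a q ->
  fop (Th q) (fop (act_op (ainv g)) v) = fop (Th (klin_map k (ainv g) a q)) v.
Proof.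
move=> hq; apply: etrans (fop_theta _ v gt (Qg g)) _.
by rewrite -(fop_nat (klin_map k (ainv g))) (thq0 hq).
Qed.

Let act_fix (g : aut A) v : fix_spc v -> fix_spc (fop (act_op (ainv g)) v).
Proof. by move=> _; exact: (act_opM g v hq0). Qed.

(** By [act_opM], g |-> theta_{t, g q0} reverses products; the inverse turns it into a left
    action. *)
Definition fix_act (g : aut A) : {linear lsub fix_spc -> lsub fix_spc} :=
  lsub_map (f := fop (act_op (ainv g))) (act_fix g).

Let fix_act1 m : fix_act (aut1 A) m = m.
Proof.
apply: lval_inj; apply: etrans (lvalP m).
apply: etrans (lsub_mapE (act_fix (aut1 A)) m) _.
by rewrite /act_op -[klin_map _ _ _ _]/(klin_map k (rhom_id A) z q0) klin_map_id.
Qed.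

Let fix_actM g h m : fix_act (autM g h) m = fix_act g (fix_act h m).
Proof.
apply: lval_inj; apply: etrans (lsub_mapE (act_fix (autM g h)) m) _.
apply: esym; apply: etrans (lsub_mapE (act_fix g) _) _.
apply: etrans (congr1 (fop _) (lsub_mapE (act_fix h) m)) _.
apply: etrans (act_opM h (lval m) (Qg g)) _.
by rewrite /act_op (klin_map_cmp (g := ainv h) (f := ainv g) (h := ainv (autM g h))).
Qed.

Definition fix_mod : autmod k A := AutMod fix_act1 fix_actM.

(** The dictionary between F and M (x) Q_A: theta_{s,q0} reads in F what the component at s reads in
    the tensor product. By linearity f q may be replaced by a point v; if v = g s both sides are
    g^{-1} m, and otherwise both are 0. *)
Lemma fix_comp (m : fix_mod) a b (s : A b) (f : {malg k[hom a b]}) (q : {malg k[A a]}) :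
  gens s -> Qup_sub k A a q ->
  fop (theta ktr s q0) (fop f (fop (Th q) (lval m))) =
  lval (comp fix_mod s (fop f (pure_ten m q))).
Proof.
move=> gs hq; rewrite pure_ten_fop (fop_theta f (lval m) gt hq).
set p := fop (F := klin k A) f q; have hp : Qup_sub k A b p by apply: fop_fsub.
rewrite (compE m p gs) (fop_theta _ _ gt hp) fop_klinE.
apply: etrans (linear_mlift _ _ (linear_comp (fopPl (lval m)) (@theta_linear _ _ ktr _ _ t z))) _.
apply: etrans _ (esym (mlift_linear_fun (@lval k _ fix_spc) _ _)); apply: eq_mlift => v.
have [[g ->]|nv] := pselect (exists g : aut A, v = g b s).
  rewrite -[RHS]/(lval (coord s (g b s) (m : fix_mod))) (coord_in _ _ gs).
  by rewrite -[LHS]/(fop (Th (fop (F := klin k A) (theta ktr s q0) << g b s >>)) (lval m)) theta_gens.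
rewrite -[RHS]/(lval (coord s v (m : fix_mod))) (coord_out _ nv) raddf0.
rewrite -[LHS]/(fop (Th (fop (F := klin k A) (theta ktr s q0) << v >>)) (lval m)).
have [h|h] := theta_dichotomy ktr v gs; first by case: nv.
by rewrite (h z q0 hq0) linear0 fop0l.
Qed.

Variables (m0 : fix_mod).
Hypothesis m00 : m0 <> 0.

Lemma fix_fixed (m : fix_mod) : fop (Th q0) (lval m) = lval m.
Proof. exact: (lvalP m). Qed.

(** If m1 is a nonzero element of a submodule, simplicity of F gives any m as f m1. By [fix_comp], m
    is then the component at t of f (m1 (x) q0), a combination of translates of m1. *)
Lemma fix_simple : simple_autmod fix_mod.
Proof.
split=> [|S hS]; first by exists m0; apply/eqP.
have [S0|nS0] := pselect (forall m, S m -> m = 0); [by left | right=> m].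
have [m1 [Sm1 m10]] : exists m1, S m1 /\ m1 <> 0.
  by apply: contrapT => h; apply: nS0 => m1 Sm1; apply: contrapT => m10; apply: h; exists m1.
have lm1 : lval m1 <> 0 by move=> e; apply: m10; apply: lval_inj; rewrite e raddf0.
have [f fE] := simple_fop (lval m) simF lm1.
have -> : m = comp fix_mod t (fop f (pure_ten m1 q0)).
  by apply: lval_inj; rewrite -(fix_comp _ f gt hq0) fix_fixed -fE fix_fixed.
rewrite pure_ten_fop (compE _ _ gt); apply: subspc_mlift => v.
have [[g ->]|nv] := pselect (exists g : aut A, v = g z t).
  by rewrite (coord_in _ _ gt); apply: hS.
by rewrite (coord_out _ nv); apply: sg0.
Qed.

(** Surjectivity: any w is f m0 = theta_{t, f q0} m0. Kernels: a relation in F kills all components,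
    hence holds in M (x) Q_A. Conversely, if a sum vanishes there but not in F, some f sends its
    value in F to m0, while theta_{t,q0} f sends it to a component of 0. *)
Lemma fix_iso : fct_iso (Q fix_mod) F.
Proof.
pose tau a (m : fix_mod) (x : Qup k A a) : F a := fop (Th (lval x)) (lval m).
have tN a b (h : hom a b) m x : fact F h (tau a m x) = tau b m (fact (Qup k A) h x).
  by rewrite -fopU /tau (fop_theta _ _ gt (lvalP x)) fopU.
have lm0 : lval m0 <> 0 by move=> e; apply: m00; apply: lval_inj; rewrite e raddf0.
have key a b (s : A b) (f : {malg k[hom a b]}) (u : {malg k[(fix_mod * Qup k A a)%type]}) :
  gens s -> fop (theta ktr s q0) (fop f (gen_sum tau (a := a) u)) =
  lval (comp fix_mod s (fop f (mlift (fun p : fix_mod * Qup k A a => pure_ten p.1 (lval p.2)) u))).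
  move=> gs; apply: etrans (linear_mlift _ _ (linear_comp (fopPr _) (fopPr f))) _.
  apply: esym; apply: etrans (linear_mlift _ _ (linear_comp (linear_funP (@lval k _ fix_spc))
    (linear_comp (linear_funP (comp fix_mod s)) (fopPr f)))) _; apply: esym.
  by apply: eq_mlift => -[m x]; exact: (fix_comp m f gs (lvalP x)).
apply: (Q_iso tN) => [a w|a u].
  have [f fE] := simple_fop w simF lm0.
  have hf : Qup_sub k A a (fop (F := klin k A) f q0) by apply: fop_fsub.
  have [x xE] := fsub_elt hf.
  exists << (m0, x) >>; rewrite /gen_sum mliftU /tau xE -(fop_theta _ _ gt hq0).
  by rewrite fE -{1}(fix_fixed m0).
split=> h.
  apply: (comp_detect ktr) => s gs; apply: lval_inj.
  by have := key a a s << idm a >> u gs; rewrite h !fop_idm linear0 raddf0 => <-.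
apply: contrapT => u0; have [f fE] := simple_fop (lval m0) simF u0.
apply: lm0; rewrite -(fix_fixed m0) fE (key a z t f u gt).
rewrite -[RHS](raddf0 (@lval k _ fix_spc)); congr (lval _).
apply: etrans (congr1 (comp fix_mod t \o fop f) h) _.
exact: (linear_fun0 (linear_comp (linear_funP (comp fix_mod t)) (fopPr f))).
Qed.

End Recognition.

(** * Chains of subobjects and length *)

Section Balanced.
Variables (C : addcat) (A : rep C) (x : C).

Program Definition gen_sub : rsub A := @RSub C A (fun a => @SubGrp (A a)
  (fun u => forall D : rsub A, (forall v : A x, D x v) -> D a u) _ _) _.
Next Obligation. by move=> a D _; apply: sg0. Qed.
Next Obligation. by move=> a u v hu hv D hD; apply: sgB; [apply: hu | apply: hv]. Qed.
Next Obligation. by move=> a b f u hu D hD; apply/rsub_map/hu. Qed.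

Program Definition killed_sub : rsub A := @RSub C A (fun a => @SubGrp (A a)
  (fun u => forall f : hom a x, rmap A f u = 0) _ _) _.
Next Obligation. by move=> a f; rewrite raddf0. Qed.
Next Obligation. by move=> a u v hu hv f; rewrite raddfB hu hv subrr. Qed.
Next Obligation. by move=> a b f u hu g; rewrite -rmapM. Qed.

Definition generated_at := forall D : rsub A, (forall v : A x, D x v) -> rsub_full D.
End Balanced.

Lemma gen_sub_generated C (A : rep C) x : generated_at (rsub_rep (gen_sub A x)) x.
Proof.
move=> D hD a w.
pose P b u := exists2 w : rsub_rep (gen_sub A x) b, D b w & val w = u.
have P0 b : P b 0 by exists 0; [apply: sg0 | rewrite raddf0].
have PB b u v : P b u -> P b v -> P b (u - v).
  by move=> [w1 D1 <-] [w2 D2 <-]; exists (w1 - w2); [apply: sgB | rewrite raddfB].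
have PM b c (f : hom b c) u : P b u -> P c (rmap A f u).
  by move=> [w1 D1 <-]; exists (rmap (rsub_rep (gen_sub A x)) f w1) => //; apply: rsub_map.
pose D' := @RSub C A (fun b => SubGrp (P0 b) (@PB b)) PM.
have gw : gen_sub A x a (val w) by apply/sg_predP/valP.
have [v|w' Dw' /val_inj <-] // := gw D'.
have gv : gen_sub A x x v by move=> D1; apply.
by exists (ZSub (introT (sg_predP (gen_sub A x x) v) gv)).
Qed.

Lemma rquot_generated C (A : rep C) x (B : rsub A) : generated_at A x -> generated_at (rquot B) x.
Proof.
move=> gA D hD a u; have [v ->] := zpi_surj u.
by apply: (gA (rsub_pre (rpi B) D)) => v'; apply: hD.
Qed.

Lemma rquot_killed_cogens C (A : rep C) x : cogens (rquot (killed_sub A x)) x.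
Proof.
move=> a u u0; apply: contrapT => h; apply: u0; have [v vE] := zpi_surj u.
rewrite vE; apply/zpi_eq0 => f; rewrite -(rmap1 (rmap A f v)).
apply: (_ : killed_sub A x x (rmap A f v)); apply/zpi_eq0.
apply: etrans (rnat (rpi (killed_sub A x)) f v) _; rewrite -[rpi _ _ _]vE.
by apply: contrapT => fu; apply: h; exists f.
Qed.

Section Lattice.
Variables (C : addcat) (A : rep C).
Implicit Types B D E U : rsub A.

Program Definition rsub_add B D : rsub A := @RSub C A (fun a => @SubGrp (A a)
  (fun u => exists v w, [/\ B a v, D a w & u = v + w]) _ _) _.
Next Obligation. by move=> B D a; exists 0, 0; split; [apply: sg0..|rewrite addr0]. Qed.
Next Obligation.
move=> B D a _ _ [v [w [Bv Dw ->]]] [v' [w' [Bv' Dw' ->]]].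
by exists (v - v'), (w - w'); split; [apply: sgB..|rewrite opprD addrACA].
Qed.
Next Obligation.
move=> B D a b f _ [v [w [Bv Dw ->]]]; exists (rmap A f v), (rmap A f w).
by split; [apply: rsub_map..|rewrite raddfD].
Qed.

Program Definition rsub_cap B D : rsub A := @RSub C A (fun a => @SubGrp (A a)
  (fun u => B a u /\ D a u) _ _) _.
Next Obligation. by move=> B D a; split; apply: sg0. Qed.
Next Obligation. by move=> B D a u v [? ?] [? ?]; split; apply: sgB. Qed.
Next Obligation. by move=> B D a b f u [? ?]; split; apply: rsub_map. Qed.

Program Definition rsub_top : rsub A := @RSub C A (fun a => @SubGrp (A a) (fun=> True) _ _) _.
Next Obligation. by []. Qed.
Next Obligation. by []. Qed.
Next Obligation. by []. Qed.

Program Definition rsub_bot : rsub A := @RSub C A (fun a => @SubGrp (A a) (fun u => u = 0) erefl _) _.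
Next Obligation. by move=> a u v -> ->; rewrite subr0. Qed.
Next Obligation. by move=> a b f u /= ->; rewrite raddf0. Qed.

Lemma rsub_add_l B D : rsub_le B (rsub_add B D).
Proof. by move=> a v Bv; exists v, 0; rewrite addr0; split=> //; apply: sg0. Qed.
Lemma rsub_add_r B D : rsub_le D (rsub_add B D).
Proof. by move=> a v Bv; exists 0, v; rewrite add0r; split=> //; apply: sg0. Qed.
Lemma rsub_add_le B D E : rsub_le B E -> rsub_le D E -> rsub_le (rsub_add B D) E.
Proof. by move=> BE DE a _ [v [w [Bv Dw ->]]]; apply: sgD; [apply: BE | apply: DE]. Qed.
Lemma rsub_le_trans B D E : rsub_le B D -> rsub_le D E -> rsub_le B E.
Proof. by move=> BD DE a v /BD /DE. Qed.
Lemma rsub_bot_le B : rsub_le rsub_bot B.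
Proof. by move=> a v /= ->; apply: sg0. Qed.
Definition rsub_lt B D : Prop := rsub_le B D /\ ~ rsub_le D B.

Lemma not_rle B D : ~ rsub_le B D -> exists a (v : A a), B a v /\ ~ D a v.
Proof.
move=> h; apply: contrapT => h'; apply: h => a v Bv; apply: contrapT => Dv.
by apply: h'; exists a, v.
Qed.

Lemma rsub_lt_add_cyc B a (v : A a) : ~ B a v -> rsub_lt B (rsub_add B (cyc v)).
Proof.
by move=> nv; split=> [|h]; [apply: rsub_add_l | apply: nv; apply/h/rsub_add_r/cyc_id].
Qed.

Fixpoint chainin U B (m : nat) : Prop :=
  if m is m'.+1 then exists D, [/\ rsub_lt B D, rsub_le D U & chainin U D m'] else True.

Lemma chainin_mono U B D m : rsub_le B D -> chainin U D m -> chainin U B m.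
Proof.
case: m => // m BD [E [[DE nED] EU cE]]; exists E; split=> //; split.
  exact: rsub_le_trans DE.
by move=> EB; apply: nED; apply: rsub_le_trans BD.
Qed.

Lemma chainin_up U U' B m : rsub_le U U' -> chainin U B m -> chainin U' B m.
Proof.
move=> UU'; elim: m B => // m IH B [D [BD DU cD]]; exists D; split=> //; last exact: IH.
exact: rsub_le_trans UU'.
Qed.

Lemma chainin_pred U B m : chainin U B m.+1 -> chainin U B m.
Proof. by move=> [D [[BD _] _ cD]]; apply: chainin_mono cD. Qed.

Lemma chainin_leq U B m m' : (m' <= m)%N -> chainin U B m -> chainin U B m'.
Proof.
move=> mm; rewrite -(subnK mm); elim: (m - m')%N => // d IH.
by rewrite addSn => /chainin_pred.
Qed.

Lemma chainin_append U U' B m : rsub_le B U -> rsub_lt U U' -> chainin U B m -> chainin U' B m.+1.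
Proof.
move=> BU [UU' nUU']; elim: m B BU => [|m IH] B BU.
  move=> _; exists U'; split=> //; split; first exact: rsub_le_trans UU'.
  by move=> U'B; apply: nUU'; apply: rsub_le_trans BU.
move=> [D [BD DU cD]]; exists D; split=> //; first exact: rsub_le_trans UU'.
exact: IH.
Qed.

Definition covers B D : Prop :=
  rsub_lt B D /\ forall E, rsub_le B E -> rsub_le E D -> rsub_le E B \/ rsub_le D E.

Fixpoint covchain B (n : nat) : Prop :=
  if n is n'.+1 then exists D, covers B D /\ covchain D n' else rsub_full B.

(* Adding an atom [S] over [B] to all the terms of a chain identifies at most two of them. *)
Lemma chain_add B S D m : covers B S -> rsub_le B D ->
  chainin rsub_top D m -> chainin rsub_top (rsub_add D S) m.-1.
Proof.
move=> [[BSle nSB] BS]; elim: m D => // m IH D BD [D' [[DD' nDD'] _ cD']] /=.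
have BD' := rsub_le_trans BD DD'.
have [SD'|nSD'] := pselect (rsub_le S D').
  by apply: (chainin_mono _ cD'); apply: rsub_add_le.
case: m IH cD' => // m IH cD'; exists (rsub_add D' S); split=> //; last exact: IH cD'.
split.
  by apply: rsub_add_le; [exact: (rsub_le_trans DD' (@rsub_add_l _ _)) | apply: rsub_add_r].
move=> h; apply: nDD' => a u D'u; have [v [w [Dv Sw uE]]] := h a u (rsub_add_l _ D'u).
have D'w : D' a w.
  by rewrite (_ : w = u - v); [apply: sgB => //; apply: DD' | rewrite uE addrC addKr].
have [||le|ge] := BS (rsub_cap D' S).
- by move=> b z Bz; split; [apply: BD' | apply: BSle].
- by move=> b z [].
- by rewrite uE; apply: sgD => //; apply: BD; apply: le.
- by case: nSD' => b z /ge[].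
Qed.

(** The comparison behind the Jordan-Hölder theorem: adding the first cover S of B to all the terms
    of the other chain costs at most one step, and the induction resumes from S. *)
Lemma covchain_bound B n D m : covchain B n -> rsub_le B D -> chainin rsub_top D m -> (m <= n)%N.
Proof.
elim: n B D m => [|n IH] B D m /=.
  move=> fB BD; case: m => // m [E [[_ nED] _ _]]; case: nED => a v _; apply: BD; apply: fB.
move=> [S [BS cS]] BD cD; have := IH _ _ _ cS (@rsub_add_r D S) (chain_add BS BD cD).
by case: m cD.
Qed.

Lemma covchain_chain B n : covchain B n -> chainin rsub_top B n.
Proof. by elim: n B => // n IH B [D [[BD _] cD]]; exists D; split=> //; apply: IH. Qed.

(** A subobject strictly inside a step would lengthen the chain, so each step is a cover. *)
Lemma covchain_max B n : chainin rsub_top B n -> ~ chainin rsub_top B n.+1 -> covchain B n.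
Proof.
elim: n B => [|n IH] B.
  move=> _ h a v; apply: contrapT => nBv; apply: h; exists rsub_top; split=> //.
  by split=> // h; apply/nBv/h.
move=> [D [BD _ cD]] nc; exists D; split; last first.
  by apply: IH => // cD'; apply: nc; exists D; split.
split=> // E BE ED; apply: contrapT => h; apply: nc.
have [nEB nDE] : ~ rsub_le E B /\ ~ rsub_le D E.
  by split=> h'; apply: h; [left | right].
by exists E; split=> //; exists D; split.
Qed.

Lemma covchain_exists B d : ~ chainin rsub_top B d.+1 -> exists n, (n <= d)%N /\ covchain B n.
Proof.
elim: d => [|d IH] h; first by exists 0%N; split=> //; apply: covchain_max.
have [h'|/IH[n [nd c]]] := pselect (chainin rsub_top B d.+1).
  by exists d.+1; split=> //; apply: covchain_max.
by exists n; split=> //; apply: leqW.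
Qed.

Lemma simple_covers B D : rsub_le B D ->
  rsimple (rquot (rsub_pre (rincl D) B)) <-> covers B D.
Proof.
move=> BD; set P := rsub_pre (rincl D) B.
have up b (v : A b) (Dv : D b v) : exists w : rsub_rep D b, val w = v.
  by exists (ZSub (introT (sg_predP (D b) v) Dv)).
have valD b (w : rsub_rep D b) : D b (val w) by apply/sg_predP/valP.
split=> [[nz sP]|[[_ nDB] cov]].
  split; first split=> // DB.
    by apply: nz => b q; have [w ->] := zpi_surj q; apply/zpi_eq0; apply: DB; apply: valD.
  move=> E BE ED.
  pose T b (q : rquot P b) := exists2 w : rsub_rep D b, q = zpi _ w & E b (val w).
  have T0 b : T b 0 by exists 0; rewrite ?raddf0 //; apply: sg0.
  have TB b u v : T b u -> T b v -> T b (u - v).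
    move=> [w -> Ew] [w' -> Ew']; exists (w - w'); first by rewrite raddfB.
    by rewrite raddfB; apply: sgB.
  have TM b c (f : hom b c) u : T b u -> T c (rmap (rquot P) f u).
    move=> [w -> Ew]; exists (rmap (rsub_rep D) f w); last exact: rsub_map.
    by rewrite /= zquot_mapE.
  have [z|f] := sP (@RSub C (rquot P) (fun b => SubGrp (T0 b) (@TB b)) TM); [left|right] => b v.
    move=> Ev; have [w wE] := up b v (ED b v Ev); rewrite -wE.
    by apply/(zpi_eq0 (P b) w); apply: z; exists w; rewrite ?wE.
  move=> Dv; have [w wE] := up b v Dv; have [w' /zpi_eq h Ew'] := f b (zpi _ w).
  rewrite -wE -(subrK (val w') (val w)); apply: sgD => //; apply: BE.
  by rewrite -raddfB.
split.
  move=> z; apply: nDB => b v Dv; have [w <-] := up b v Dv.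
  exact/(zpi_eq0 (P b) w)/z.
move=> T; pose E b v := exists2 w : rsub_rep D b, val w = v & T b (zpi _ w).
have E0 b : E b 0 by exists 0; rewrite raddf0 //; apply: sg0.
have EB b u v : E b u -> E b v -> E b (u - v).
  by move=> [w <- Tw] [w' <- Tw']; exists (w - w'); rewrite raddfB //; apply: sgB.
have EM b c (f : hom b c) u : E b u -> E c (rmap A f u).
  move=> [w <- Tw]; exists (rmap (rsub_rep D) f w) => //.
  by rewrite -[zpi _ _](zquot_mapE (@rsub_map C _ P b c f)); apply: (rsub_map (r := T) f).
have [||EB'|DE] := cov (@RSub C A (fun b => SubGrp (E0 b) (@EB b)) EM).
- move=> b v Bv; have [w wE] := up b v (BD b v Bv); exists w => //.
  rewrite (_ : zpi _ w = 0); first exact: sg0.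
  by apply/zpi_eq0; rewrite /= wE.
- by move=> b _ [w <- _]; apply: valD.
- left=> b q Tq; have [w wE] := zpi_surj q; rewrite wE; apply/zpi_eq0.
  by apply: EB'; exists w; rewrite -?wE.
- right=> b q; have [w ->] := zpi_surj q.
  by have [w' /val_inj <-] := DE b (val w) (valD b w).
Qed.

Lemma covchain_length B n : rsub_zero B -> covchain B n -> has_length A n.
Proof.
suff h : covchain B n -> exists s : nat -> rsub A, [/\ s 0%N = B, rsub_full (s n) &
    forall i, (i < n)%N -> covers (s i) (s i.+1)].
  move=> zB /h[s [s0 sn sc]]; exists s; split=> //; first by rewrite s0.
  move=> i ltn; have [[le _] _] := sc i ltn; split=> //.
  by apply/(simple_covers le)/sc.
elim: n B => [|n IH] B /=; first by move=> fB; exists (fun=> B).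
move=> [D [BD /IH[s [s0 sn sc]]]].
exists (fun i => if i is j.+1 then s j else B); split=> // -[|i] lt /=; last exact: sc.
by rewrite s0.
Qed.

Lemma length_covchain n : has_length A n -> exists2 B, rsub_zero B & covchain B n.
Proof.
move=> [s [s0 sn sc]]; exists (s 0%N) => //.
suff h i : (i <= n)%N -> covchain (s (n - i)%N) i by rewrite -[X in s X](subnn n); apply: h.
elim: i => [_|i IH lt]; first by rewrite subn0.
have lt' : (n - i.+1 < n)%N by rewrite ltn_subrL (leq_trans _ lt).
exists (s (n - i)%N); split; last exact/IH/ltnW.
have e : (n - i = (n - i.+1).+1)%N by rewrite subnSK.
by have [le sim] := sc _ lt'; rewrite e; apply/simple_covers.
Qed.

(** Length is the maximal number of steps of a strict chain. In this form it is visibly unique and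
    invariant under isomorphism, and it can be compared with degrees. *)
Lemma length_chain n : has_length A n <-> chainin rsub_top rsub_bot n /\ ~ chainin rsub_top rsub_bot n.+1.
Proof.
split=> [/length_covchain[B zB cB]|[c nc]]; last first.
  by apply: (covchain_length (B := rsub_bot)) => //; apply: covchain_max.
split; first by apply: chainin_mono (covchain_chain cB); apply: rsub_bot_le.
move=> c; suff : (n.+1 <= n)%N by rewrite ltnn.
apply: (covchain_bound cB _ c) => a v Bv; exact: zB.
Qed.

Lemma length_uniq n m : has_length A n -> has_length A m -> n = m.
Proof.
move=> /length_chain[cn ncn] /length_chain[cm ncm].
case: (ltngtP n m) => // lt; first by case: ncn; apply: (chainin_leq lt cm).
by case: ncm; apply: (chainin_leq lt cn).
Qed.

Lemma length_exists d : ~ chainin rsub_top rsub_bot d.+1 -> exists n, (n <= d)%N /\ has_length A n.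
Proof.
by move=> /covchain_exists[n [nd c]]; exists n; split=> //; apply: covchain_length c.
Qed.

(** Adjoining an element v outside B shortens the chains above. The generator found above B + <v>
    and v itself are the two coordinates of one element over a biproduct. *)
Lemma chain_cyclic B N : ~ chainin rsub_top B N -> exists y (s : A y),
  forall D, rsub_le B D -> D y s -> rsub_full D.
Proof.
elim: N B => [|N IH] B h; first by case: h.
have [fB|nB] := pselect (rsub_full B).
  by exists (zob C), 0 => D BD _ a v; apply/BD/fB.
have [a [v nv]] : exists a (v : A a), ~ B a v.
  apply: contrapT => h'; apply: nB => a v; apply: contrapT => nv.
  by apply: h'; exists a, v.
have [|y [s ys]] := IH (rsub_add B (cyc v)).
  by move=> c; apply: h; exists (rsub_add B (cyc v)); split=> //; apply: rsub_lt_add_cyc.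
exists (bip a y), (rpair v s) => D BD Dp; apply: ys.
  apply: rsub_add_le => //; apply: cyc_le; rewrite -[v](rpair1 v s); exact: rsub_map.
by rewrite -[s](rpair2 v s); apply: rsub_map.
Qed.

(** If a nonzero v in A(a) is killed by all morphisms to x, replacing x by its biproduct with a
    makes [killed_sub] strictly smaller; bounded chains stop the process. *)
Lemma chain_cogens N x : ~ chainin (killed_sub A x) rsub_bot N -> exists x', cogens A x'.
Proof.
elim: N x => [|N IH] x h; first by case: h.
have [cx|ncx] := pselect (cogens A x); first by exists x.
have [a [v [cv v0]]] : exists a (v : A a), killed_sub A x a v /\ v <> 0.
  apply: contrapT => h'; apply: ncx => a v v0; apply: contrapT => nf.
  by apply: h'; exists a, v; split=> // f; apply: contrapT => fv; apply: nf; exists f.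
apply: (IH (bip x a)) => c; apply: h; apply: (chainin_append (U := killed_sub A (bip x a))) => //.
  exact: rsub_bot_le.
split=> [b u hu f|le].
  by rewrite -[f]cmp1m -(pr1_in1 x a) -cmpA rmapM hu raddf0.
by apply: v0; rewrite -[v]rmap1 -(pr2_in2 x a) rmapM (le a v cv) raddf0.
Qed.

Lemma length_gens n : has_length A n -> exists y (s : A y), gens s.
Proof.
move=> /length_chain[_ /chain_cyclic[y [s h]]]; exists y, s => a v.
exact: (h (cyc s) (rsub_bot_le _) (cyc_id s)).
Qed.

Lemma length_cogens n : has_length A n -> exists x, cogens A x.
Proof.
move=> /length_chain[_ nc]; apply: (@chain_cogens n.+1 (zob C)) => c; apply: nc.
exact: chainin_up c.
Qed.

(** A chain of subobjects E of B + B' is traced on E /\ B and on (E + B) /\ B'. A step at which both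
    traces stall is not strict, so the two traces share at least m strict steps. *)
Lemma chainin_add B B' E m : rsub_le E (rsub_add B B') -> chainin (rsub_add B B') E m ->
  exists m1 m2, [/\ (m <= m1 + m2)%N, chainin B (rsub_cap E B) m1 &
    chainin B' (rsub_cap (rsub_add E B) B') m2].
Proof.
elim: m E => [|m IH] E EU; first by exists 0%N, 0%N.
move=> [E' [[EE' nEE'] E'U /(IH _ E'U)[m1 [m2 [mm c1 c2]]]]].
have le1 : rsub_le (rsub_cap E B) (rsub_cap E' B) by move=> a v [Ev Bv]; split=> //; apply: EE'.
have le2 : rsub_le (rsub_cap (rsub_add E B) B') (rsub_cap (rsub_add E' B) B').
  move=> a v [hv Bv]; split=> //; move: a v hv {Bv}; apply: rsub_add_le; last exact: rsub_add_r.
  by apply: rsub_le_trans EE' _; apply: rsub_add_l.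
have [n1|n1] := pselect (rsub_le (rsub_cap E' B) (rsub_cap E B)); last first.
  exists m1.+1, m2; split; first by rewrite addSn.
    by exists (rsub_cap E' B); split=> // a v [].
  exact: chainin_mono c2.
have [n2|n2] := pselect (rsub_le (rsub_cap (rsub_add E' B) B') (rsub_cap (rsub_add E B) B')); last first.
  exists m1, m2.+1; split; first by rewrite addnS.
    exact: chainin_mono c1.
  by exists (rsub_cap (rsub_add E' B) B'); split=> // a v [].
case: nEE' => a u E'u; have [b [b' [Bb Bb' uE]]] := E'U a u E'u.
have [|[e [b1 [Ee Bb1 bE]]] _] := n2 a b'.
  by split=> //; exists u, (- b); split=> //; [apply: sgN | rewrite uE addrC addKr].
have [|Eb _] := n1 a (b + b1).
  split; last exact: sgD.
  rewrite (_ : b + b1 = u - e); first by apply: sgB => //; apply: EE'.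
  by rewrite uE bE addrCA addrC addrK.
by rewrite uE bE addrCA; apply: sgD.
Qed.

End Lattice.

(** * Finitely generated objects of a locally finite category *)

Section LocallyFinite.
Variables (C : addcat) (A : rep C).

Lemma chain_image (T : rep C) (h : rhom T A) (U E : rsub A) m :
  (forall a v, U a v -> exists w, v = h a w) -> chainin U E m ->
  chainin (rsub_top T) (rsub_pre h E) m.
Proof.
move=> Uh; elim: m E => // m IH E [E' [[EE' nEE'] E'U /IH c]].
exists (rsub_pre h E'); split=> //; split; first by move=> a w; apply: EE'.
move=> le; apply: nEE' => a v E'v; have [w wE] := Uh a v (E'U a v E'v).
by rewrite wE; apply: le; rewrite /= -wE.
Qed.

(** The subobjects with bounded chains are directed by [chainin_add]. If S contains all of them, it
    contains the image of every morphism from an object of finite length, so A -> A/S and the zero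
    morphism agree on these images and hence are equal. Thus the supremum is A, and finite
    generation puts A in the family. *)
Lemma locally_finite_fg : locally_finite C -> finitely_generated A -> finite_length A.
Proof.
move=> lf fg.
pose D (B : rsub A) := exists N, ~ chainin B (rsub_bot A) N.
have [||B [N nc] fB] := fg D.
- split.
    by exists (rsub_bot A), 1%N => -[E [[_ n] l _]]; apply: n.
  move=> B B' [N nc] [N' nc']; exists (rsub_add B B'); last by split; [apply: rsub_add_l | apply: rsub_add_r].
  exists (N + N')%N => c; have [m1 [m2 [le c1 c2]]] := chainin_add (rsub_bot_le _) c.
  have [l1|l1] := leqP N m1.
    by apply: nc; apply: chainin_mono (chainin_leq l1 c1); apply: rsub_bot_le.
  have l2 : (N' <= m2)%N.
    rewrite leqNgt; apply/negP => l2; suff : (m1 + m2 < N + N')%N by rewrite ltnNge le.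
    by rewrite -addSn leq_add // ltnW.
  by apply: nc'; apply: chainin_mono (chainin_leq l2 c2); apply: rsub_bot_le.
- move=> S hS a v.
  have nul : forall x y (f : hom x y) (u : A x), (\0 : {additive A y -> rquot S y}) (rmap A f u) =
    rmap (rquot S) f ((\0 : {additive A x -> rquot S x}) u) by move=> *; rewrite /= raddf0.
  suff /zpi_eq0 : rpi S a v = RHom nul a v by [].
  apply: lf => T h [n /length_chain[_ nT]] x u; apply/zpi_eq0.
  have I0 b : exists w, (0 : A b) = h b w by exists 0; rewrite raddf0.
  have IB b (u1 u2 : A b) : (exists w, u1 = h b w) -> (exists w, u2 = h b w) ->
      exists w, u1 - u2 = h b w.
    by move=> [w ->] [w' ->]; exists (w - w'); rewrite raddfB.
  have IM b c (f : hom b c) (u1 : A b) : (exists w, u1 = h b w) -> exists w, rmap A f u1 = h c w.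
    by move=> [w ->]; exists (rmap T f w); rewrite rnat.
  pose I := @RSub C A (fun b => SubGrp (I0 b) (@IB b)) IM.
  apply: (hS I); last by exists u.
  exists n.+1 => c; apply: nT; apply: (@chainin_mono _ _ _ (rsub_bot T) (rsub_pre h (rsub_bot A))).
    exact: rsub_bot_le.
  exact: (chain_image (U := I)).
have [|n [_ hn]] := @length_exists C A N; last by exists n.
by move=> /chainin_pred c; apply: nc; apply: chainin_up c.
Qed.

End LocallyFinite.

(** * Recovering A from a simple functor *)

Section Covers.
Variables (V : zmodType) (l : seq V) (P : subgrp V).
Hypothesis lV : forall v, v \in l.

Lemma zsub_covered v : ~ P v ->
  exists l' : seq (zsub P), (size l' < size l)%N /\ forall w, w \in l'.
Proof.
move=> nPv; exists (pmap insub l); split; last by move=> w; rewrite mem_pmap_sub.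
rewrite size_pmap_sub ltn_neqAle count_size andbT -all_count; apply/negP => /allP h.
by apply: nPv; apply/sg_predP/h.
Qed.

Lemma zquot_covered u : P u -> u <> 0 ->
  exists l' : seq (zquot P), (size l' < size l)%N /\ forall w, w \in l'.
Proof.
move=> Pu u0; exists (map (zpi P) (filter (predC1 u) l)); split.
  rewrite size_map size_filter ltn_neqAle count_size andbT -all_count; apply/negP => /allP h.
  by have := h u (lV u); rewrite /= eqxx.
move=> w; have [v ->] := zpi_surj w; have [vu|vu] := eqVneq v u; last first.
  by apply: map_f; rewrite mem_filter lV /= vu.
have -> : zpi P v = zpi P 0 by apply/zpi_eq; rewrite subr0 vu.
by apply: map_f; rewrite mem_filter lV /= eq_sym; apply/andP; split=> //; apply/eqP.
Qed.
End Covers.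

Section Dominance.
Variables (k : fieldType) (C : addcat) (F : fct k C) (x : C) (w0 : F x).
Hypothesis simF : simple_in (@all_fct k C) F.
Hypothesis w00 : w0 <> 0.

(* [F] is the quotient, sending [v] to [w0], of the subfunctor of [Y / T] generated by [v]. *)
Definition dom (Y : fct k C) (T : fsub Y) (v : Y x) : Prop :=
  forall f : {malg k[hom x x]}, T x (fop f v) -> fop f w0 = 0.

Lemma dom_neq0 (Y : fct k C) (T : fsub Y) v : dom T v -> ~ T x v.
Proof. by move=> h Tv; apply: w00; rewrite -(fop_idm w0); apply: h; rewrite fop_idm. Qed.

Lemma dom_hom (Y Z : fct k C) (p : fhom Y Z) (T : fsub Y) (T' : fsub Z) v :
  (forall u, T x u -> T' x (p x u)) -> dom T' (p x v) -> dom T v.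
Proof. by move=> TT' h f hf; apply: h; rewrite -fop_nat; apply: TT'. Qed.

(** By simplicity a nonzero f w0 can be brought back to w0. *)
Lemma not_dom (Y : fct k C) (T : fsub Y) v : ~ dom T v ->
  exists f : {malg k[hom x x]}, T x (fop f v) /\ fop f w0 = w0.
Proof.
move=> nd; have [f [Tf fw]] : exists f : {malg k[hom x x]}, T x (fop f v) /\ fop f w0 <> 0.
  apply: contrapT => h; apply: nd => f Tf; apply: contrapT => fw.
  by apply: h; exists f.
have [g gw] := simple_fop w0 simF fw.
by exists (mcmp g f); rewrite !fop_cmp -gw; split=> //; apply: fop_fsub.
Qed.

Lemma dom_fop (Y : fct k C) (T : fsub Y) v (f : {malg k[hom x x]}) :
  fop f w0 = w0 -> dom T v -> dom T (fop f v).
Proof. by move=> fw h g; rewrite -fop_cmp => /h; rewrite fop_cmp fw. Qed.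

(** If the first term v does not dominate, some f fixes w0 and sends v into T. Applied to the sum, f
    removes v modulo T and preserves dominance, so the remaining terms can be treated by
    induction. *)
Lemma dom_sum (Y : fct k C) (T : fsub Y) (r : seq (Y x)) : dom T (\sum_(v <- r) v) ->
  exists v (f : {malg k[hom x x]}), v \in r /\ dom T (fop f v).
Proof.
have [n] := ubnP (size r); elim: n r => // n IH [|v r] /=.
  by rewrite big_nil => _ /dom_neq0 []; apply: sg0.
rewrite ltnS big_cons => rn h.
have [dv|/not_dom[f [Tf fw]]] := pselect (dom T v).
  by exists v, << idm x >>; rewrite fop_idm mem_head.
have [||v' [g [+ dg]]] := IH [seq fop f u | u <- r]; first by rewrite size_map.
  move=> g hg; rewrite -fw -fop_cmp; apply: h.
  rewrite linearD /= !fop_cmp; apply: sgD; first exact: fop_fsub.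
  by move: hg; rewrite big_map -linear_sum.
move=> /mapP[u ur e]; exists u, (mcmp g f); rewrite inE ur orbT; split=> //.
by rewrite fop_cmp -e.
Qed.

End Dominance.

Program Definition fsub_bot (k : fieldType) (C : addcat) (Y : fct k C) : fsub Y :=
  @FSub k C Y (fun a => @SubSpc k (Y a) (@SubGrp (Y a) (fun v => v = 0) erefl _) _) _.
Next Obligation. by move=> k C Y a u v -> ->; rewrite subr0. Qed.
Next Obligation. by move=> k C Y a c v /= ->; rewrite scaler0. Qed.
Next Obligation. by move=> k C Y a b f v /= ->; rewrite linear0. Qed.

Fact cmp_zmod_morphism (C : addcat) (x y z : C) (f : hom y z) :
  GRing.zmod_morphism (fun g : hom x y => f \oc g).
Proof. by move=> u v /=; apply/eqP; rewrite eq_sym subr_eq -cmpDr subrK. Qed.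

Definition cmp_add (C : addcat) (x y z : C) (f : hom y z) : {additive hom x y -> hom x z} :=
  HB.pack (fun g : hom x y => f \oc g)
    (GRing.isZmodMorphism.Build _ _ (fun g : hom x y => f \oc g) (cmp_zmod_morphism f)).

Program Definition hom_rep (C : addcat) (x : C) : rep C :=
  @Rep C (fun y => hom x y) (fun y z f => cmp_add x f) _ _ _.
Next Obligation. by move=> C x y f; apply: cmp1m. Qed.
Next Obligation. by move=> C x y z t g f v; rewrite /= cmpA. Qed.
Next Obligation. by move=> C x y z f g v; rewrite /= cmpDl. Qed.

Section Classification.
Variables (k : fieldType) (C : addcat).
Hypothesis ktr : k_trivial k C.
Variables (F : fct k C) (x : C) (w0 : F x).
Hypothesis simF : simple_in (@all_fct k C) F.
Hypothesis w00 : w0 <> 0.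

Local Notation dom := (dom w0).

(** F is a subquotient of k[A], and a covering list bounds the number of elements of A(x). *)
Definition carries (n : nat) : Prop := exists A : rep C,
  (exists l : seq (A x), (size l <= n)%N /\ forall v, v \in l) /\
  exists v : klin k A x, dom (fsub_bot (klin k A)) v.

Lemma dom_klin_hom (A B : rep C) (p : rhom A B) (v : klin k A x) :
  dom (fsub_bot (klin k B)) (klin_map k p x v) -> dom (fsub_bot (klin k A)) v.
Proof. by apply: dom_hom => u /= ->; rewrite linear0. Qed.

(** By Yoneda, k[C(x, -)] is free on the identity of x, which may be sent to w0. *)
Lemma carries_hom_rep : exists n, carries n.
Proof.
have [n [e [[e' eK e'K] _]]] := ktr x x.
pose l := [seq e i | i <- enum 'I_n].
exists (size l), (hom_rep x); split.
  by exists l; split=> // v; apply/mapP; exists (e' v); rewrite ?mem_enum ?e'K.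
exists << idm x >> => f /= h; suff -> : f = 0 by rewrite fop0l.
by rewrite -h fop_klinU malg_map_id // => g /=; rewrite cmpm1.
Qed.

(* A carrier [A] with [A x] of minimal size may be replaced by its subobject generated by [A x],
   and then by the quotient by the largest subobject vanishing at [x]. *)
Lemma balanced_carrier : exists n (A : rep C) (v : klin k A x) (l : seq (A x)),
  [/\ generated_at A x, cogens A x, dom (fsub_bot (klin k A)) v,
      (size l <= n)%N /\ (forall u, u \in l) & forall m, carries m -> (n <= m)%N].
Proof.
pose P n := `[< carries n >].
have exP : exists n, P n by have [n h] := carries_hom_rep; exists n; apply/asboolP.
case: (ex_minnP exP) => n /asboolP[A [[l [ln hl]] [v dv]]] nmin.
pose A1 := rsub_rep (gen_sub A x); pose A2 := rquot (killed_sub A1 x).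
have gv u : gen_sub A x x u by move=> D; apply.
pose up u : A1 x := ZSub (introT (sg_predP (gen_sub A x x) u) (gv u)).
have upK u : val (up u) = u by [].
pose v1 : klin k A1 x := malg_map up v.
have v1E : klin_map k (rincl (gen_sub A x)) x v1 = v.
  by rewrite -[LHS]/(malg_map _ (malg_map _ _)) malg_map_comp; apply: malg_map_id.
have dv1 : dom (fsub_bot (klin k A1)) v1 by apply: (@dom_klin_hom A1 A (rincl (gen_sub A x))); rewrite v1E.
exists n, A2, (klin_map k (rpi (killed_sub A1 x)) x v1), (map (fun u => zpi _ (up u)) l); split.
- exact/rquot_generated/gen_sub_generated.
- exact: rquot_killed_cogens.
- move=> f /= hf; apply: dv1 => /=.
  (* The second reduction loses nothing at x: [killed_sub] vanishes there, as the identity of x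
     shows. *)
  have pK (u : A1 x) : repr (zpi (killed_sub A1 x x) u) = u.
    apply/eqP; rewrite -subr_eq0; apply/eqP; rewrite -[LHS](rmap1 (r := A1)).
    have : killed_sub A1 x x (repr (zpi (killed_sub A1 x x) u) - u) by apply/zpi_eq; rewrite /zpi reprK.
    exact.
  rewrite -[fop f v1](malg_map_id (f := repr \o zpi (killed_sub A1 x x))) //.
  by rewrite -malg_map_comp -[malg_map (zpi _) _]/(klin_map k (rpi (killed_sub A1 x)) x _)
    fop_nat hf linear0.
- split; first by rewrite size_map.
  move=> w; have [u ->] := zpi_surj w; apply/mapP; exists (val u) => //.
  by congr (zpi _ _); apply: val_inj.
- by move=> m /asboolP; apply: nmin.
Qed.

Variables (n : nat) (A : rep C) (v0 : klin k A x) (l : seq (A x)).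
Hypothesis genA : generated_at A x.
Hypothesis cogA : cogens A x.
Hypothesis dv0 : dom (fsub_bot (klin k A)) v0.
Hypothesis ln : (size l <= n)%N.
Hypothesis hl : forall u, u \in l.
Hypothesis nmin : forall m, carries m -> (n <= m)%N.

(** If f kills k[A] but not g w0, some h brings f g w0 back to w0; yet h f g kills v0, so it must
    kill w0. *)
Lemma carrier_rel y a (f : {malg k[hom y a]}) :
  (forall v : A y, fop (F := klin k A) f << v >> = 0) -> forall w : F y, fop f w = 0.
Proof.
move=> hf w; have [g ->] := simple_fop w simF w00.
apply: contrapT => fg; have [h hE] := simple_fop w0 simF fg.
apply: w00; rewrite {1}hE -!fop_cmp; apply: dv0 => /=.
by rewrite !fop_cmp (fop_klinE f) mlift0 // linear0.
Qed.

(** As A is generated by A(x), the proper subobject <u> misses an element of A(x). It would be a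
    carrier with fewer elements at x. *)
Lemma not_dom_sub (u : A x) c (f : {malg k[hom x x]}) : ~ gens u ->
  ~ dom (fsub_bot (klin k A)) (fop (F := klin k A) f (c *: << u >>)).
Proof.
move=> nu d; have [v nv] : exists v, ~ cyc u x v.
  apply: contrapT => h; apply: nu => b v; apply: (genA (D := cyc u)) => v'.
  by apply: contrapT => h'; apply: h; exists v'.
have [l' [l'l hl']] := zsub_covered hl nv.
pose u' : rsub_rep (cyc u) x := ZSub (introT (sg_predP (cyc u x) u) (cyc_id u)).
suff /nmin : carries (size l') by rewrite leqNgt (leq_trans l'l).
exists (rsub_rep (cyc u)); split; first by exists l'.
exists (fop (F := klin k (rsub_rep (cyc u))) f (c *: << u' >>)); apply: (dom_klin_hom (p := rincl (cyc u))).
by rewrite fop_nat linearZ [klin_map _ _ _ _]malg_mapU.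
Qed.

(** Dually, A/<u> has fewer elements at x than A, because u is a nonzero element of A(x). *)
Lemma not_dom_quot (u : A x) (y : klin k A x) : u <> 0 ->
  ~ dom (fker (klin_map k (rpi (cyc u)))) y.
Proof.
move=> u0 d; have [l' [l'l hl']] := zquot_covered hl (cyc_id u) u0.
suff /nmin : carries (size l') by rewrite leqNgt (leq_trans l'l).
exists (rquot (cyc u)); split; first by exists l'.
exists (klin_map k (rpi (cyc u)) x y) => f h; apply: d.
exact: etrans (fop_nat (klin_map k (rpi (cyc u))) f y) h.
Qed.

(** At x, Q^A is the intersection of the finitely many kernels of k[A] -> k[A/<u>], for u nonzero in
    A(x). By [not_dom_quot], operators fixing w0 move y into these kernels one after the other. The
    result would still dominate modulo Q^A while lying in Q^A. *)
Lemma not_dom_Qup (y : klin k A x) : ~ dom (Qup_sub k A) y.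
Proof.
have step (r : seq (A x)) : dom (Qup_sub k A) y ->
    exists y', dom (Qup_sub k A) y' /\
      forall u, u \in r -> u <> 0 -> klin_map k (rpi (cyc u)) x y' = 0.
  elim: r => [|u r IH] d; first by exists y.
  have [y' [dy' y'r]] := IH d.
  have [u0|/eqP u0] := eqVneq u 0.
    by exists y'; split=> // u'; rewrite inE => /orP[/eqP->|]; [rewrite u0 | apply: y'r].
  have [f [fT fw]] := not_dom simF (not_dom_quot (y := y') u0).
  exists (fop f y'); split; first exact: dom_fop.
  move=> u'; rewrite inE => /orP[/eqP-> //|ur u'0].
  by rewrite fop_nat y'r // linear0.
move=> /(step l)[y' [dy' y'l]]; apply: (dom_neq0 w00 dy'); apply/Qup_subP => B nB.
have [b [v [Bv v0']]] : exists b (v : A b), B b v /\ v <> 0.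
  apply: contrapT => h; apply: nB => b v Bv; apply: contrapT => v0'.
  by apply: h; exists b, v.
have [f fv] := cogA v0'.
apply: (mlift_coset (B := cyc (rmap A f v) x)); last exact: (y'l _ (hl _) fv).
move=> u u' uu'; congr << _ >>; apply/zpi_eq; apply: (cyc_le (s := rmap A f v)) uu'.
exact: rsub_map.
Qed.

Let orbit_aut (u : A x) : aut A := sval (cid (orbit_repP u)).
Let orbit_autE (u : A x) : u = autV (orbit_aut u) x (orbit_rep u).
Proof. by rewrite /orbit_aut; case: cid => g /= ->; rewrite autK. Qed.

(** The element of k[Aut(A)] that sends [r] to the part of v0 supported on the orbit of r. It
    commutes with the operators of C, and theta_{r,q} v0 is its value at q. *)
Let L (r : A x) b (z : klin k A b) : klin k A b :=
  \sum_(u <- msupp v0 | `[< gens u >] && (orbit_rep u == r)) v0@_u *: klin_map k (autV (orbit_aut u)) b z.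

Let L_linear r b : linear (@L r b).
Proof.
move=> c z z'; rewrite /L scaler_sumr -big_split; apply: eq_bigr => u _ /=.
by rewrite linearP scalerDr !scalerA mulrC.
Qed.

Let L_fop r b c (f : {malg k[hom b c]}) z : fop f (L r z) = L r (fop f z).
Proof.
rewrite /L linear_sum; apply: eq_bigr => u _; rewrite linearZ; congr (_ *: _).
exact: esym (fop_nat (klin_map k (autV (orbit_aut u))) f z).
Qed.

Let L_theta r a q : gens r -> orbit_rep r = r -> Qup_sub k A a q ->
  fop (theta ktr r q) v0 = L r q.
Proof.
move=> gr rr hq; rewrite fop_klinE /mlift /L [RHS]big_mkcond; apply: eq_bigr => u _ /=.
case: ifPn => [/andP[_ /eqP ur]|nu].
  by congr (_ *: _); rewrite {1}(orbit_autE u) ur theta_gens.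
have [[g ug]|h] := theta_dichotomy ktr u gr; last by rewrite h // scaler0.
case/negP: nu; rewrite ug orbit_rep_aut rr eqxx andbT; apply/asboolP.
exact: aut_gens.
Qed.

(** Let N consist of the f v0 with f w0 = 0. As v0 dominates modulo N, so does, up to an operator f,
    one of its terms: a multiple of a non-generator or an orbit part L_r [r]. The former is excluded
    by [not_dom_sub]. For the latter, if h f [r] = q lies in Q^A, then h f L_r [r] = theta_{r,q} v0,
    which lies in N if theta_{r,q} w0 = 0. Hence, if every theta_{s,q} killed w0, f [r] would
    dominate modulo Q^A, against [not_dom_Qup]. *)
Lemma theta_carrier : exists s : A x, gens s /\ exists a (q : {malg k[A a]}),
  Qup_sub k A a q /\ fop (theta ktr s q) w0 <> 0.
Proof.
apply: contrapT => no.
have th0 s a (q : {malg k[A a]}) : gens s -> Qup_sub k A a q -> fop (theta ktr s q) w0 = 0.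
  by move=> gs hq; apply: contrapT => h; apply: no; exists s; split=> //; exists a, q.
pose N a (u : klin k A a) := exists2 f : {malg k[hom x a]}, u = fop f v0 & fop f w0 = 0.
have N0 a : N a 0 by exists 0; rewrite fop0l.
have NB a u v : N a u -> N a v -> N a (u - v).
  move=> [f -> fw] [g -> gw]; exists (f - g); first by rewrite fopBl.
  by rewrite fopBl fw gw subrr.
have NZ a c u : N a u -> N a (c *: u).
  move=> [f -> fw]; exists (c *: f); first by rewrite fopZl.
  by rewrite fopZl fw scaler0.
have NM a b (h : hom a b) u : N a u -> N b (fact (klin k A) h u).
  move=> [f -> fw]; exists (mcmp << h >> f); first by rewrite fop_cmp fopU.
  by rewrite fop_cmp fw linear0.
pose NS := @FSub k C (klin k A) (fun a => SubSpc (ss_grp := SubGrp (N0 a) (@NB a)) (@NZ a)) NM.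
have dN : dom NS v0.
  move=> f [g fg gw]; have h : fop (f - g) w0 = 0 by apply: dv0; rewrite /= fopBl fg subrr.
  by move: h; rewrite fopBl gw subr0.
pose R := undup [seq orbit_rep u | u <- msupp v0 & `[< gens u >]].
pose terms : seq (klin k A x) := [seq L r << r >> | r <- R] ++
  [seq v0@_u *: << u >> | u <- msupp v0 & ~~ `[< gens u >]].
have v0E : v0 = \sum_(v <- terms) v.
  rewrite big_cat /= !big_map -{1}[v0]mlift_idE /mlift (bigID (fun u => `[< gens u >])) /=.
  congr (_ + _); last by rewrite big_filter.
  rewrite -[LHS]big_filter.
  rewrite (eq_big_seq (fun u => \sum_(r <- R) if orbit_rep u == r then v0@_u *: << u >> else 0)); last first.
    move=> u; rewrite mem_filter => /andP[gu uS].
    rewrite (sum_seq_unique (i := orbit_rep u)) ?eqxx ?undup_uniq //.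
      by rewrite mem_undup map_f // mem_filter gu.
    by move=> j _; rewrite eq_sym => /negPf->.
  rewrite exchange_big /=; apply: eq_bigr => r _; rewrite -big_mkcond /= big_filter_cond /L.
  apply: eq_bigr => u /andP[_ /eqP ur].
  by rewrite [klin_map _ _ _ _]malg_mapU -ur -orbit_autE.
rewrite v0E in dN; have [v [f [+ df]]] := dom_sum simF w00 dN.
rewrite mem_cat => /orP[] /mapP[r]; last first.
  rewrite mem_filter => /andP[/asboolP nr _] vE; apply: (@not_dom_sub r (v0@_r) f nr).
  by rewrite -vE => h hh; apply: df; rewrite (hh : fop h (fop f v) = 0); apply: (N0 x).
rewrite mem_undup => /mapP[u]; rewrite mem_filter => /andP[/asboolP gu _] ru vE.
have [g rg] := orbit_repP u.
have gr : gens r by rewrite ru rg; apply: aut_gens.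
have rr : orbit_rep r = r by rewrite ru rg orbit_rep_aut -rg.
apply: (@not_dom_Qup (fop (F := klin k A) f << r >>)) => h hh; apply: df => /=.
rewrite vE !L_fop -(L_theta gr rr hh).
exists (theta ktr r (fop (F := klin k A) h (fop (F := klin k A) f << r >>))) => //.
exact: th0.
Qed.

End Classification.

Section Recognizes.
Variables (k : fieldType) (C : addcat).
Hypothesis ktr : k_trivial k C.
Variable F : fct k C.

(** What is retained of a minimal carrier. It passes along isomorphisms ([recognizes_iso]), so A can
    be replaced by the representative of its class. *)
Definition recognizes (A : rep C) : Prop :=
  (forall y a (f : {malg k[hom y a]}),
    (forall v : A y, fop (F := klin k A) f << v >> = 0) -> forall w : F y, fop f w = 0) /\
  exists y (s : A y) a (q : {malg k[A a]}) (w : F y),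
    [/\ gens s, Qup_sub k A a q & fop (theta ktr s q) w <> 0].

Lemma recognizes_Qup A : recognizes A -> Qup_ne k A.
Proof.
move=> [_ [y [s [a [q [w [gs hq qw]]]]]]]; exists a, q; split=> // q0.
by apply: qw; rewrite q0 linear0 fop0l.
Qed.

Lemma recognizes_iso A B : rep_iso A B -> recognizes A -> recognizes B.
Proof.
move=> [f [g fg]] [rel [y [s [a [q [w [gs hq qw]]]]]]].
have fS b u : exists v, u = f b v by exists (g b u); rewrite (fg b).2.
split.
  move=> y' a' z hz; apply: rel => v.
  have -> : << v >> = klin_map k g y' << f y' v >> by rewrite [RHS]malg_mapU (fg y').1.
  by rewrite -(fop_nat (klin_map k g)) hz linear0.
have gfs : gens (f y s) by apply: gens_img.
have hfq : Qup_sub k B a (klin_map k f a q).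
  apply/Qup_subP => D nD; rewrite -[klin_map _ _ _ _]/(malg_map _ _) malg_map_comp.
  apply: (mlift_coset (B := rsub_pre f D a)).
    by move=> u v uv; congr << _ >>; apply/zpi_eq; rewrite -raddfB.
  move/Qup_subP: hq => -> // nz; apply: nD => b u Du.
  by rewrite -[u](fg b).2 (nz b (g b u)) ?raddf0 //= (fg b).2.
exists y, (f y s), a, (klin_map k f a q), w; split=> // e; apply: qw; rewrite -e.
apply: (rel_eq rel) => v.
have [[h ->]|nv] := pselect (exists h : aut A, v = h y s).
  rewrite theta_gens // -[h y s](congr1 (h y) ((fg y).1 s)).
  rewrite -[h y (g y (f y s))]/(rhom_cmp h g y (f y s)) theta_gens //.
  rewrite -[RHS]/(malg_map _ (malg_map _ _)) malg_map_comp; apply: eq_malg_map => u /=.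
  by rewrite (fg a).1.
have nvs : ~ ann_le v s by move=> /(ann_le_aut ktr gs).
rewrite !theta_kill // => vs; apply: nvs => b x /vs; rewrite -rnat => /(congr1 (g b)).
by rewrite (fg b).1 raddf0.
Qed.

Lemma recognizes_mod A : simple_in (@all_fct k C) F -> recognizes A ->
  exists2 M : autmod k A, simple_autmod M & fct_iso (Q M) F.
Proof.
move=> simF rA; have nQ := recognizes_Qup rA.
have [relF [y [s [a [q [w [gs hq qw]]]]]]] := rA.
have [z [t [p dt]]] := dirac_exists gs nQ; have [gt hp hd] := dt.
have thp b (q1 : {malg k[A b]}) (u : F z) : Qup_sub k A b q1 ->
    fop (theta ktr t q1) (fop (theta ktr t p) u) = fop (theta ktr t q1) u.
  by move=> h1; rewrite (fop_theta ktr relF _ _ gt hp) (theta_dirac ktr gt hd h1).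
(* Nonzero, because theta_{t,q} theta_{t,p} = theta_{t,q} and theta_{t,q} theta_{s,p} = theta_{s,q}
   on F, so theta_{t,q} w1 = theta_{s,q} w. *)
pose w1 := fop (theta ktr t p) (fop (theta ktr s p) w).
have w1q : fop (theta ktr t q) w1 = fop (theta ktr s q) w.
  by rewrite /w1 thp // (fop_theta ktr relF _ _ gs hp) (theta_dirac ktr gt hd hq).
have fw1 : fix_spc ktr F t p w1 by rewrite /= /w1 thp.
have [m mE] : exists m : fix_mod ktr relF dt, lval m = w1.
  by exists (ZSub (introT (sg_predP (fix_spc ktr F t p) w1) fw1)).
have m0 : m <> 0 by move=> m0; apply: qw; rewrite -w1q -mE m0 !raddf0.
exists (fix_mod ktr relF dt); first exact: (fix_simple simF m0).
exact: (fix_iso simF m0).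
Qed.

Lemma simple_recognized : simple_in (@all_fct k C) F ->
  exists (A : rep C) x (s : A x), [/\ gens s, cogens A x & recognizes A].
Proof.
move=> simF; have [_ nzF _] := simF.
have [x [w0 w00]] : exists x (w : F x), w <> 0.
  by apply: contrapT => h; apply: nzF => x w; apply: contrapT => w0; apply: h; exists x, w.
have [n [A [v0 [l [gA cA dv [ln hl] nmin]]]]] := balanced_carrier ktr w0.
have [s [gs [a [q [hq qw]]]]] := theta_carrier ktr simF w00 gA cA dv ln hl nmin.
exists A, x, s; split=> //; split; first exact: (carrier_rel simF w00 dv).
by exists x, s, a, q, w0.
Qed.

End Recognizes.

(** * Polynomial degree *)

Section Degree.
Variables (k : fieldType) (C : addcat).
Hypothesis ktr : k_trivial k C.
Implicit Types F G : fct k C.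

Program Definition sgfull (V : zmodType) : subgrp V := @SubGrp V (fun=> True) _ _.
Next Obligation. by []. Qed.
Next Obligation. by []. Qed.

Definition avg (x a : C) : {malg k[hom (bip x a) (bip x a)]} :=
  malg_map (@shear C x a) (mean ktr (sgfull (hom x a))).

Definition deltabar_op (x a : C) : {malg k[hom (bip x a) (bip x a)]} :=
  avg x a - mcmp << in2 x a \oc pr2 x a >> (avg x a).

Definition tau_op (x a b : C) (z : {malg k[hom a b]}) : {malg k[hom (bip x a) (bip x b)]} :=
  malg_map (fun f => bmat (idm x) 0 0 f) z.

Lemma fop_tau x F a b (z : {malg k[hom a b]}) (w : tau x F a) :
  fop (F := tau x F) z w = fop (F := F) (tau_op x z) w.
Proof. by rewrite /fop /tau_op mlift_map. Qed.

Lemma fop_avg F x a (w : F (bip x a)) :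
  fop (avg x a) w = mlift (fun u => fact F (shear u) w) (mean ktr (sgfull (hom x a))).
Proof. by rewrite /fop /avg mlift_map. Qed.

Lemma shear_in2 (x a : C) (u : hom x a) : shear u \oc in2 x a = in2 x a.
Proof. by rewrite /shear bmat_in2 cmpm0 add0r cmpm1. Qed.

Lemma shear_cmp (x a : C) (u v : hom x a) : shear u \oc shear v = shear (v + u).
Proof.
rewrite /shear bmat_cmp !cmp1m !cmpm1 !cmp0m ?cmpm0 !addr0 !add0r.
by rewrite [u + v]addrC.
Qed.

Definition deltabar_pi x F a (w : F (bip x a)) : deltabar x F a :=
  fpi (fimage (fhom_cmp (fpi (shear_sub x F)) (tau_in x F))) a (fpi (shear_sub x F) a w).

Lemma deltabar_pi_surj x F a (v : deltabar x F a) : exists w, v = deltabar_pi w.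
Proof. by have [u ->] := lpi_surj v; have [w ->] := lpi_surj u; exists w. Qed.

Lemma deltabar_pi_linear x F a : linear (@deltabar_pi x F a).
Proof.
exact: (linear_comp (linear_funP (fpi (fimage (fhom_cmp (fpi (shear_sub x F)) (tau_in x F))) a))
  (linear_funP (fpi (shear_sub x F) a))).
Qed.

Lemma deltabar_pi_fact x F a b (f : hom a b) (w : F (bip x a)) :
  fact (deltabar x F) f (deltabar_pi w) = deltabar_pi (fact F (bmat (idm x) 0 0 f) w).
Proof.
apply: etrans (esym (fnat (fpi (fimage (fhom_cmp (fpi (shear_sub x F)) (tau_in x F)))) f _)) _.
apply: (congr1 (fpi (fimage (fhom_cmp (fpi (shear_sub x F)) (tau_in x F))) b)).
exact: esym (fnat (fpi (shear_sub x F)) f w).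
Qed.

Lemma deltabar_pi_fop x F a b (z : {malg k[hom a b]}) (w : F (bip x a)) :
  fop z (deltabar_pi w) = deltabar_pi (fop (tau_op x z) w).
Proof.
rewrite /fop /tau_op mlift_map (linear_mlift _ _ (@deltabar_pi_linear x F b)).
by apply: eq_mlift => f; apply: deltabar_pi_fact.
Qed.

(* Averaging over the shears splits off the coinvariants, and it fixes the image of [in2], of which
   [pr2] is a retraction. *)
Lemma deltabar_pi_eq0 x F a (w : F (bip x a)) : deltabar_pi w = 0 <-> fop (deltabar_op x a) w = 0.
Proof.
have kE u : fop (deltabar_op x a) u = fop (avg x a) u - fact F (in2 x a \oc pr2 x a) (fop (avg x a) u).
  by rewrite /deltabar_op fopBl fop_cmp fopU.
split=> [/lpi_eq0[v h]|].
  have {h} h : shear_sub x F a (w - fact F (in2 x a) v) by apply/zpi_eq.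
  have av : fop (avg x a) (fact F (in2 x a) v) = fact F (in2 x a) v.
    rewrite fop_avg; apply: mlift_mean => u _.
    by rewrite -factM shear_in2.
  have aw : fop (avg x a) w = fact F (in2 x a) v.
    apply/eqP; rewrite -av -subr_eq0 -linearB; apply/eqP.
    apply: (span_linear_eq0 (@fopPr k C F _ _ (avg x a)) _ h) => _ [u [w' ->]].
    rewrite linearB /= !fop_avg; apply/eqP; rewrite subr_eq0; apply/eqP.
    rewrite -{2}(mean_shift ktr (K := sgfull (hom x a)) (b := u)) // mlift_map.
    by apply: eq_mlift => u' /=; rewrite -factM shear_cmp.
  by rewrite kE aw -factM -cmpA pr2_in2 cmpm1 subrr.
rewrite kE => /eqP; rewrite subr_eq0 => /eqP e.
apply/lpi_eq0; exists (fact F (pr2 x a) (fop (avg x a) w)).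
apply/zpi_eq; rewrite /= -factM -e -opprB; apply: (@sgN _ (shear_sub x F a)).
rewrite -[X in _ - X](mlift_mean ktr (K := sgfull (hom x a)) (h := fun=> w)) // fop_avg -mliftB.
by apply: subspc_mlift => u; apply: span_in; exists u, w.
Qed.

Fixpoint iter_bip (l : seq C) (b : C) : C := if l is c :: l' then bip c (iter_bip l' b) else b.

Fixpoint deltabars_op (l : seq C) (b : C) : {malg k[hom (iter_bip l b) (iter_bip l b)]} :=
  if l is c :: l' then mcmp (deltabar_op c (iter_bip l' b)) (tau_op c (deltabars_op l' b)) else << idm b >>.

(** The first functor to be applied, for the last index, contributes the outermost summand; hence
    the reversed list. *)
Lemma deltabars_repr (a : nat -> C) n F b :
  exists r : F (iter_bip (rev (mkseq a n)) b) -> deltabars a n F b,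
    (forall v, exists w, v = r w) /\ forall w, r w = 0 <-> fop (deltabars_op (rev (mkseq a n)) b) w = 0.
Proof.
elim: n F => [|n IH] F /=.
  by exists id; split=> [v|w]; [exists v | rewrite fop_idm].
rewrite mkseqS rev_rcons /=.
have [r [rS rK]] := IH (deltabar (a n) F).
exists (fun w => r (deltabar_pi w)); split=> [v|w].
  by have [u ->] := rS v; have [w ->] := deltabar_pi_surj u; exists w.
by rewrite rK deltabar_pi_fop deltabar_pi_eq0 fop_cmp.
Qed.

(** The iterated cokernels become equations on the values of F, and equations are inherited by
    subfunctors. *)
Lemma poly_ltP n F : poly_lt n F <->
  forall l x b (w : F (bip x (iter_bip l b))), size l = n -> fop (tau_op x (deltabars_op l b)) w = 0.
Proof.
split=> [h l x b w ln|h a x b v].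
  have lE : l = rev (mkseq (nth (zob C) (rev l)) n).
    by rewrite -ln -size_rev mkseq_nth revK.
  move: w; rewrite lE; set a := nth _ _ => w.
  have [r [_ rK]] := deltabars_repr a n (tau x F) b.
  by rewrite -fop_tau; apply/rK; apply: h.
have [r [rS rK]] := deltabars_repr a n (tau x F) b.
by have [w ->] := rS v; apply/rK; rewrite fop_tau; apply: h; rewrite size_rev size_mkseq.
Qed.

Lemma poly_lt_inj n F G (f : fhom G F) : (forall a, injective (f a)) ->
  poly_lt n F -> poly_lt n G.
Proof.
move=> fI /poly_ltP h; apply/poly_ltP => l x b w ln; apply: fI.
by rewrite fop_nat h // linear0.
Qed.

Lemma poly_lt_sub n F (S : fsub F) : poly_lt n F -> poly_lt n (fsub_fct S).
Proof. by apply: (poly_lt_inj (f := fincl S)) => a; apply: lval_inj. Qed.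

Lemma rmap_shear (A : rep C) x a (u : hom x a) (s : A x) (t : A a) :
  rmap A (shear u) (rpair s t) = rpair s (t + rmap A u s).
Proof.
rewrite [LHS]rpairE -!rmapM /shear pr1_bmat pr2_bmat !rmapD !rmapM rpair1 rpair2.
by rewrite !rmap1 rmap0l addr0 addrC.
Qed.

Lemma rmap_taubmat (A : rep C) x a b (f : hom a b) (s : A x) (t : A a) :
  rmap A (bmat (idm x) 0 0 f) (rpair s t) = rpair s (rmap A f t).
Proof.
rewrite [LHS]rpairE -!rmapM pr1_bmat pr2_bmat !rmapD !rmapM rpair1 rpair2.
by rewrite !rmap1 !rmap0l addr0 add0r.
Qed.

Lemma deltabar_op_klin (A : rep C) x a (s : A x) (t : A a) :
  fop (F := klin k A) (deltabar_op x a) << rpair s t >> =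
  mlift (fun u => << rpair s (t + rmap A u s) >> - << rpair 0 (t + rmap A u s) >>)
    (mean ktr (sgfull (hom x a))).
Proof.
rewrite /deltabar_op fopBl fop_cmp fopU fop_avg.
rewrite (mlift_linear_fun (fact (klin k A) (in2 x a \oc pr2 x a))) -mliftB.
apply: eq_mlift => u; rewrite /= !malg_mapU rmap_shear rmapM rpair2.
by rewrite /rpair raddf0 add0r.
Qed.

Lemma tau_klin (A : rep C) x a b (z : {malg k[hom a b]}) (s : A x) (t : A a) :
  fop (F := klin k A) (tau_op x z) << rpair s t >> =
  malg_map (rpair s) (fop (F := klin k A) z << t >>).
Proof.
rewrite !fop_klinU /tau_op !malg_map_comp; apply: eq_malg_map => f /=.
exact: rmap_taubmat.
Qed.

(** * The deltabar operators on k[A] and chains of subobjects *)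

Section Kap.
Variable A : rep C.
Local Notation kz l b t := (fop (F := klin k A) (deltabars_op l b) << t >>).

Definition kterm (B : rsub A) c a (s : A c) (t : A a) : {malg k[zquot (B (bip c a))]} :=
  << zpi (B _) (rpair s t) >> - << zpi (B _) (rpair 0 t) >>.

Lemma deltabars_op_cons c l b (s : A c) (t : A (iter_bip l b)) (B : rsub A) :
  malg_map (zpi (B _)) (fop (F := klin k A) (deltabars_op (c :: l) b) << rpair s t >>) =
  mlift (fun t' => mlift (fun u => kterm B s (t' + rmap A u s))
    (mean ktr (sgfull (hom c (iter_bip l b))))) (kz l b t).
Proof.
rewrite /= fop_cmp tau_klin fop_klinE mlift_map (mlift_linear_fun (malg_map _)).
apply: eq_mlift => t'; rewrite /= deltabar_op_klin (mlift_linear_fun (malg_map _)).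
by apply: eq_mlift => u; rewrite /= linearB /= !malg_mapU.
Qed.

Lemma zpi_rpair_eq (B : rsub A) x a (s s' : A x) (t t' : A a) :
  B x (s - s') -> B a (t - t') -> zpi (B _) (rpair s t) = zpi (B _) (rpair s' t').
Proof.
move=> hs ht; apply/zpi_eq; rewrite /rpair opprD addrACA -!raddfB.
by apply: sgD; apply: rsub_map.
Qed.

Lemma kterm_eq (B : rsub A) c a (s : A c) (t t' : A a) :
  B a (t - t') -> kterm B s t = kterm B s t'.
Proof.
have B0 (u : A c) : B c (u - u) by rewrite subrr; apply: sg0.
move=> h; exact: (congr2 (fun p q => << p >> - << q >> : {malg k[zquot (B (bip c a))]})
  (zpi_rpair_eq (B0 s) h) (zpi_rpair_eq (B0 0) h)).
Qed.

Lemma mlift_mean_shift (V : lmodType k) x y (h : hom x y -> V) f :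
  mlift h (mean ktr (sgfull (hom x y))) = mlift (fun u => h (f + u)) (mean ktr (sgfull (hom x y))).
Proof. by rewrite -{1}(mean_shift ktr (K := sgfull (hom x y)) (b := f)) // mlift_map. Qed.

(** Let s be the coordinate at the first object. If s lies in B, the difference [s, t] - [0, t]
    vanishes modulo B. Otherwise the mean over u of t + u s makes the result depend on t only modulo
    B + <s>, above which chains are one step shorter. *)
Lemma deltabars_op_zero n (B : rsub A) : ~ chainin (rsub_top A) B n ->
  forall l b t, size l = n -> malg_map (zpi (B _)) (kz l b t) = 0.
Proof.
elim: n B => [|n IH] B nc; first by case: nc.
case=> // c l b t0 [ln]; rewrite (rpairE t0).
set s := rmap A _ t0; set t := rmap A _ t0; rewrite deltabars_op_cons.
have [Bs|nBs] := pselect (B c s).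
  apply: mlift0 => t'; apply: mlift0 => u; apply/eqP; rewrite /kterm subr_eq0; apply/eqP.
  by congr << _ >>; apply: zpi_rpair_eq; rewrite ?subr0 ?subrr //; apply: sg0.
have nc' : ~ chainin (rsub_top A) (rsub_add B (cyc s)) n.
  by move=> c'; apply: nc; exists (rsub_add B (cyc s)); split=> //; apply: rsub_lt_add_cyc.
apply: (mlift_coset (B := rsub_add B (cyc s) _)); last exact: IH nc' l b t ln.
move=> t1 t2 [v [_ [Bv [f ->] tE]]].
apply: etrans _ (esym (mlift_mean_shift _ f)); apply: eq_mlift => u; apply: kterm_eq.
by rewrite rmapD [t2 + _]addrA opprD addrACA subrr addr0 opprD addrA tE addrK.
Qed.

(* Detects the summand of [k[A/B (iter_bip (c :: l) b)]] indexed by the class of [v] in [A/B c]. *)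
Definition slice (B : rsub A) c (v : A c) a : {malg k[zquot (B (bip c a))]} ->
    {malg k[zquot (rsub_add B (cyc v) a)]} :=
  mlift (fun w => if rmap (rquot B) (pr1 c a) w == zpi (B c) v
                  then << zpi (rsub_add B (cyc v) a) (repr (rmap (rquot B) (pr2 c a) w)) >> else 0).

Lemma slice_linear (B : rsub A) c (v : A c) a : linear (@slice B c v a).
Proof. exact: linear_funP. Qed.

Lemma slice_rpair (B : rsub A) c (v s : A c) a (t : A a) :
  slice v << zpi (B _) (rpair s t) >> =
  if zpi (B c) s == zpi (B c) v then << zpi (rsub_add B (cyc v) a) t >> else 0.
Proof.
rewrite /slice mliftU.
have e1 : rmap (rquot B) (pr1 c a) (zpi (B _) (rpair s t)) = zpi (B c) s.
  by apply: etrans (esym (rnat (rpi B) (pr1 c a) (rpair s t))) _; rewrite rpair1.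
have e2 : rmap (rquot B) (pr2 c a) (zpi (B _) (rpair s t)) = zpi (B a) t.
  by apply: etrans (esym (rnat (rpi B) (pr2 c a) (rpair s t))) _; rewrite rpair2.
rewrite e1; case: ifP => // _; congr << _ >>; rewrite e2.
by apply/zpi_eq; apply: rsub_add_l; apply/zpi_eq; rewrite /zpi reprK.
Qed.

Lemma slice_kterm (B : rsub A) c (v s : A c) a (t : A a) : ~ B c v ->
  slice v (kterm B s t) =
  if zpi (B c) s == zpi (B c) v then << zpi (rsub_add B (cyc v) a) t >> else 0.
Proof.
move=> nBv; apply: etrans (linear_funB _ _ (@slice_linear B c v a)) _.
rewrite !slice_rpair.
rewrite [X in _ - X]ifF ?subr0 //; apply/negP => /eqP/zpi_eq h; apply: nBv.
by rewrite -[v]opprK -[- v]sub0r; apply: sgN.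
Qed.

Lemma slice_deltabars_op (B : rsub A) c (v s : A c) l b t : ~ B c v ->
  slice v (malg_map (zpi (B _)) (fop (F := klin k A) (deltabars_op (c :: l) b) << rpair s t >>)) =
  if zpi (B c) s == zpi (B c) v then malg_map (zpi (rsub_add B (cyc v) (iter_bip l b))) (kz l b t) else 0.
Proof.
move=> nBv; rewrite deltabars_op_cons.
rewrite (linear_mlift _ _ (@slice_linear B c v _)).
case: ifP => sv; last first.
  apply: mlift0 => t'; apply: etrans (linear_mlift _ _ (@slice_linear B c v _)) _; apply: mlift0 => u.
  by rewrite -[LHS]/(slice v (kterm B s _)) slice_kterm // sv.
rewrite [RHS]/malg_map; apply: eq_mlift => t'; apply: etrans (linear_mlift _ _ (@slice_linear B c v _)) _.
apply: mlift_mean => u _; rewrite -[LHS]/(slice v (kterm B s _)) slice_kterm // sv.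
congr << _ >>; apply/zpi_eq; rewrite addrAC subrr add0r.
have Bsv : B c (s - v) by apply/zpi_eq/eqP.
exists (rmap A u (s - v)), (rmap A u v); split; first exact: rsub_map.
  by exists u.
by rewrite raddfB subrK.
Qed.

(** An element v of the first jump of the chain is taken as first coordinate. [slice] then reads the
    remaining operator modulo B + <v>, which still lies below the next term of the chain. *)
Lemma deltabars_op_nonzero n (B : rsub A) : chainin (rsub_top A) B n ->
  exists l b t, size l = n /\ malg_map (zpi (B _)) (kz l b t) <> 0.
Proof.
elim: n B => [|n IH] B.
  move=> _; exists [::], (zob C), 0; split=> //.
  rewrite fop_idm malg_mapU => /(congr1 (mcoeff (zpi (B _) 0))).
  by rewrite mcoeffUU mcoeff0 => /eqP; rewrite oner_eq0.
move=> [D [[BD nDB] _ cD]].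
have [c [v [Dv nBv]]] := not_rle nDB.
have [|l [b [t [ln h]]]] := IH (rsub_add B (cyc v)).
  by apply: chainin_mono cD; apply: rsub_add_le => //; apply: cyc_le.
exists (c :: l), b, (rpair v t); split; first by rewrite /= ln.
move=> /(congr1 (@slice B c v _)); rewrite slice_deltabars_op // eqxx => e; apply: h; rewrite e.
exact: (linear_fun0 (@slice_linear B c v _)).
Qed.

Lemma Qup_rpairl x a (t : A a) (q : {malg k[A x]}) :
  Qup_sub k A x q -> Qup_sub k A (bip x a) (malg_map (fun s => rpair s t) q).
Proof.
move=> /Qup_subP hq; apply/Qup_subP => B nB.
rewrite malg_map_comp (eq_malg_map (g := (fun s => rpair (A := rquot B) s (zpi (B a) t)) \o zpi (B x))).
  by rewrite -malg_map_comp hq // linear0.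
by move=> s; apply: (rhom_rpair (rpi B)).
Qed.

Lemma Qup_translate a (t : A a) (q : {malg k[A a]}) :
  Qup_sub k A a q -> Qup_sub k A a (malg_map (fun s => s - t) q).
Proof.
move=> /Qup_subP hq; apply/Qup_subP => B nB.
rewrite malg_map_comp (eq_malg_map (g := (fun s => s - zpi (B a) t) \o zpi (B a))).
  by rewrite -malg_map_comp hq // linear0.
by move=> s /=; rewrite raddfB.
Qed.

(* [Q^A] absorbs tensor products: the witness is [q1 (x) t], where [t] is a strict flag in
   the quotient of [A] by an element of the support of [q1]. *)
Lemma deltabars_op_Qup n : Qup_ne k A -> chainin (rsub_top A) (rsub_bot A) n ->
  exists l b (q : {malg k[A (iter_bip l b)]}),
    [/\ size l = n, Qup_sub k A _ q & fop (F := klin k A) (deltabars_op l b) q <> 0].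
Proof.
move=> [a [q' [hq' q'0]]]; case: n => [_|n [D [[_ nD] _ cD]]].
  by exists [::], a, q'; split=> //; rewrite fop_idm.
have [c [v [Dv nv]]] := not_rle nD.
have [t0 qt0] := malg_neq0_coef q'0.
(* Translation by [t0] brings 0 into the support, so [q1] has the nonzero coefficient of [q'] at
   [t0] as its coefficient at v0 = (v, 0). This v0 generates a subobject inside the first term D of
   the chain, and slicing at v0 isolates that coefficient. *)
pose q1 := malg_map (rpair v) (malg_map (fun s => s - t0) q').
have hq1 : Qup_sub k A _ q1 by apply: Qup_rpair; apply: Qup_translate.
pose v0 := rpair v (0 : A a).
have nv0 : ~ rsub_bot A _ v0 by move=> /(congr1 (rmap A (pr1 c a))); rewrite rpair1 raddf0.
have [|l [b [t [ln h]]]] := @deltabars_op_nonzero n (rsub_add (rsub_bot A) (cyc v0)).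
  apply: chainin_mono cD; apply: rsub_add_le; first exact: rsub_bot_le.
  apply: cyc_le; rewrite /v0 /rpair raddf0 addr0; exact: rsub_map.
exists (bip c a :: l), b, (malg_map (fun w => rpair w t) q1); split.
- by rewrite /= ln.
- exact: Qup_rpairl.
pose G (z : {malg k[A (bip (bip c a) (iter_bip l b))]}) := slice v0 (malg_map (zpi (rsub_bot A _)) z).
have Gl : linear G.
  exact: (linear_comp (@slice_linear (rsub_bot A) _ v0 _) (linear_funP (malg_map _))).
have GE s : G (fop (F := klin k A) (deltabars_op (bip c a :: l) b) << rpair (rpair v (s - t0)) t >>) =
    if s == t0 then malg_map (zpi (rsub_add (rsub_bot A) (cyc v0) _)) (kz l b t) else 0.
  rewrite /G slice_deltabars_op //; have [->|st0] := eqVneq s t0; first by rewrite subrr eqxx.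
  rewrite ifF //; apply/negP => /eqP/zpi_eq /= e.
  have := congr1 (rmap A (pr2 c a)) e; rewrite raddf0 raddfB /= !rpair2 subr0 => /eqP.
  by rewrite subr_eq0 (negPf st0).
move=> /(congr1 G); rewrite (linear_fun0 Gl) fop_klinE (linear_mlift _ _ Gl) /q1 !mlift_map.
rewrite (mlift_single (x := t0)) => [|s st0]; last by rewrite /= GE (negPf st0).
by rewrite /= GE eqxx => /eqP; rewrite scaler_eq0 (negPf qt0) /= => /eqP.
Qed.

End Kap.

Lemma malg_rsub_bot (A : rep C) a (z : {malg k[A a]}) : malg_map (zpi (rsub_bot A a)) z = 0 -> z = 0.
Proof.
move=> h; rewrite -[z]mlift_idE; apply: (mlift_coset (B := rsub_bot A a)) h => u v /= e.
by congr << _ >>; apply/eqP; rewrite -subr_eq0; apply/eqP.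
Qed.

Lemma Q_poly (A : rep C) (M : autmod k A) n : ~ chainin (rsub_top A) (rsub_bot A) n -> poly_lt n (Q M).
Proof.
move=> nc; apply/poly_ltP => l x b w ln; apply: lval_inj; rewrite raddf0 lval_fop.
have /pure_ten_span h : fimage (Qmap M) _ (lval w) by apply: (lvalP w).
move: h; apply: span_linear_eq0 => [|_ [m [q [hq ->]]]]; first exact: fopPr.
rewrite pure_ten_fop (_ : fop _ q = 0); first exact: (linear_fun0 (@pure_ten_linearr k C A M _ m)).
rewrite fop_klinE; apply: mlift0 => v; rewrite (rpairE v) tau_klin.
by rewrite (malg_rsub_bot (deltabars_op_zero nc _ ln)) linear0.
Qed.

(** The shift in [poly_lt] is taken at y: pairing with s makes all points (s, t) generators, in
    distinct orbits for distinct t, so none is lost in Q_A and the component at (s, t) recovers m up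
    to a nonzero coefficient. *)
Lemma poly_Q (A : rep C) (M : autmod k A) y (s : A y) n : gens s -> Qup_ne k A ->
  (exists m : M, m != 0) -> poly_lt n (Q M) -> ~ chainin (rsub_top A) (rsub_bot A) n.
Proof.
move=> gs nQ [m /eqP m0] /poly_ltP h /(deltabars_op_Qup nQ)[l [b [q [ln hq kq]]]].
have [w wE] := Q_elt m (Qup_rpair s hq).
have : fop (tau_op y (deltabars_op l b)) (pure_ten m (malg_map (rpair s) q) : gten M (Qlow_aut k A) _) = 0.
  by rewrite -wE -(lval_fop (S := fimage (Qmap M))) h // raddf0.
rewrite pure_ten_fop; set z := fop (F := klin k A) _ q in kq.
have -> : fop (F := klin k A) (tau_op y (deltabars_op l b)) (malg_map (rpair s) q) =
    malg_map (rpair s) z.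
  rewrite fop_klinE mlift_map /z fop_klinE (mlift_linear_fun (malg_map _)).
  by apply: eq_mlift => t; apply: tau_klin.
have [t zt] := malg_neq0_coef kq.
have gst : gens (rpair s t) by apply: gens_rpairl.
move=> /(congr1 (comp M (rpair s t))).
rewrite (linear_fun0 (linear_funP (comp M (rpair s t)))) (compE _ _ gst) mlift_map.
rewrite (mlift_single (x := t)) => [/eqP|t' tt'].
  rewrite scaler_eq0 (negPf zt) /= => /eqP; rewrite coord_id //.
apply: coord_out => -[g]; rewrite rhom_rpair => /rpair_inj[gs1 gt].
have gid := @gens_aut C A y s (aut1 A) g gs gs1.
by move: tt'; rewrite gt -(gid _ t) /= eqxx.
Qed.

End Degree.

(** * The bijections *)

Section IsoClasses.
Variables (T : Type) (iso : T -> T -> Prop).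
Hypothesis iso_refl : forall S, iso S S.
Hypothesis iso_sym : forall S S', iso S S' -> iso S' S.
Hypothesis iso_trans : forall S S' S'', iso S S' -> iso S' S'' -> iso S S''.

Lemma iso_class_eq S S' : iso_class iso S = iso_class iso S' <-> iso S S'.
Proof.
split=> [e|h]; first by rewrite -[iso S S']/(iso_class iso S S') e; apply: iso_refl.
apply/funext => R; apply/propext; split; last exact: iso_trans h.
exact/iso_trans/iso_sym.
Qed.
End IsoClasses.

Lemma autmod_iso_refl (k : fieldType) C (A : rep C) (M : autmod k A) : autmod_iso M M.
Proof. by exists idfun, idfun. Qed.

Lemma autmod_iso_sym (k : fieldType) C (A : rep C) (M N : autmod k A) :
  autmod_iso M N -> autmod_iso N M.
Proof.
by move=> [f [g [fK gK fA]]]; exists g, f; split=> // h m; apply: (can_inj fK); rewrite fA !gK.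
Qed.

Lemma autmod_iso_trans (k : fieldType) C (A : rep C) (M N P : autmod k A) :
  autmod_iso M N -> autmod_iso N P -> autmod_iso M P.
Proof.
move=> [f [g [fK gK fA]]] [f' [g' [fK' gK' fA']]]; exists (f' \o f), (g \o g').
by split=> [m|m|h m] /=; rewrite ?fK' ?fK ?gK ?gK' ?fA ?fA'.
Qed.

Lemma inj_surj_bijective (T U : Type) (f : T -> U) :
  (forall x y, f x = f y -> x = y) -> (forall u, exists x, u = f x) -> bijective f.
Proof.
move=> fI fS; pose g u := sval (cid (fS u)).
have gE u : f (g u) = u by rewrite /g; case: cid.
by exists g => // x; apply: fI; rewrite gE.
Qed.

Lemma sval_inj (T : Type) (P : T -> Prop) (u v : sig P) : sval u = sval v -> u = v.
Proof.
by case: u v => [x Px] [y Py] /= e; case: y / e Py => Py; rewrite (Prop_irrelevance Px Py).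
Qed.

Section Length.
Variable C : addcat.

Lemma chain_iso (A B : rep C) m : rep_iso A B ->
  chainin (rsub_top A) (rsub_bot A) m -> chainin (rsub_top B) (rsub_bot B) m.
Proof.
move=> [f [g fg]] c; apply: chainin_mono (chain_image (h := g) _ c); first exact: rsub_bot_le.
by move=> a v _; exists (f a v); rewrite (fg a).1.
Qed.

Lemma rep_iso_sym (A B : rep C) : rep_iso A B -> rep_iso B A.
Proof. by move=> [f [g fg]]; exists g, f => a; have [] := fg a. Qed.

Lemma length_iso (A B : rep C) n : rep_iso A B -> has_length A n -> has_length B n.
Proof.
move=> AB /length_chain[c nc]; apply/length_chain; split; first exact: chain_iso c.
by move=> c'; apply: nc; apply: chain_iso c'; apply: rep_iso_sym.
Qed.

Lemma gens_fg (A : rep C) y (s : A y) : gens s -> finitely_generated A.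
Proof.
move=> gs D [[B0 DB0] dir] hS.
pose P a v := exists2 B, D B & B a v.
have P0 a : P a 0 by exists B0 => //; apply: sg0.
have PB a u v : P a u -> P a v -> P a (u - v).
  move=> [B DB Bu] [B' DB' Bv]; have [B'' DB'' [le le']] := dir _ _ DB DB'.
  by exists B'' => //; apply: sgB; [apply: le | apply: le'].
have PM a b (f : hom a b) v : P a v -> P b (rmap A f v).
  by move=> [B DB Bv]; exists B => //; apply: rsub_map.
have [|B DB Bs] := hS (@RSub C A (fun a => SubGrp (P0 a) (@PB a)) PM) _ y s.
  by move=> B DB a v Bv; exists B.
exists B => // a v; have [f ->] := gs a v; exact: rsub_map.
Qed.

(** For each of the finitely many nonzero u in A(x), some member of the family avoids u; a common
    lower bound is zero at x, hence zero. *)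
Lemma cogens_fc (A : rep C) x (l : seq (A x)) : cogens A x -> (forall v, v \in l) ->
  finitely_cogenerated A.
Proof.
move=> cg hl D [[B0 DB0] dir] h0.
have [B DB hB] : exists2 B, D B & forall u, u \in l -> u <> 0 -> ~ B x u.
  elim: {hl} l => [|u r [B DB hB]]; first by exists B0.
  have [u0|nu0] := pselect (u = 0).
    by exists B => // v; rewrite inE => /orP[/eqP->|]; [rewrite u0 | apply: hB].
  have [B' [DB' nB'u]] : exists B', D B' /\ ~ B' x u.
    apply: contrapT => h; apply: nu0; apply: h0 => B' DB'; apply: contrapT => nB'u.
    by apply: h; exists B'.
  have [B'' DB'' [le le']] := dir _ _ DB DB'; exists B'' => // v.
  rewrite inE => /orP[/eqP-> _|vr v0] Bv; first exact/nB'u/le'.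
  exact: (hB v vr v0 (le _ _ Bv)).
exists B => // a v Bv; apply: contrapT => v0; have [f fv] := cg a v v0.
by apply: (hB _ (hl _) fv); apply: rsub_map.
Qed.

Variable k : fieldType.
Hypothesis ktr : k_trivial k C.

Lemma length_good (A : rep C) n : has_length A n ->
  (exists y (s : A y), gens s) /\ Qup_ne k A.
Proof.
move=> hn; have [y [s gs]] := length_gens hn; split; first by exists y, s.
have [x cx] := length_cogens hn; have [l hl] := gens_covered ktr x gs.
exact: (Qup_nonzero k cx hl).
Qed.

Lemma Q_simple_length (A : rep C) (M : autmod k A) : finite_length A -> simple_autmod M ->
  simple_in (@all_fct k C) (Q M).
Proof. by move=> [n /length_good[[y [s gs]] nQ]] sM; apply: (Q_simple ktr gs nQ). Qed.

(** Degree passes to subfunctors, so every subfunctor of an object of F_d counts as a subobject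
    there. *)
Lemma simple_poly d (F : fct k C) : simple_in (@poly_le k C d) F <->
  simple_in (@all_fct k C) F /\ poly_le d F.
Proof.
split=> [[pF nz sF]|[[_ nz sF] pF]]; split=> //.
  by split=> // S _; apply: sF; apply: (poly_lt_sub ktr).
by move=> S _; apply: sF.
Qed.

Variable L : nat -> rep C -> Prop.
Hypothesis repL : length_representatives L.

(** Common to both bijections: [nn] is the inclusion of ['I_d.+1] in one and the identity of [nat]
    in the other. *)
Lemma Q_bijection (I : Type) (nn : I -> nat) (P : fct k C -> Prop) :
  injective nn ->
  (forall i (A : rep C) (M : autmod k A), L (nn i) A -> simple_autmod M -> simple_in P (Q M)) ->
  (forall F, simple_in P F -> simple_in (@all_fct k C) F) ->
  (forall F, simple_in P F -> exists i (A : rep C), L (nn i) A /\ recognizes ktr F A) ->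
  exists f : {i : I & {A : {A : rep C | L (nn i) A} & IrrMod k (sval A)}} -> IrrFct P,
    bijective f /\
    forall (i : I) (A : {A : rep C | L (nn i) A}) (M : autmod k (sval A))
      (hM : simple_autmod M),
      sval (f (existT _ i (existT _ A (mk_class _ hM)))) = iso_class (@fct_iso k C) (Q M).
Proof.
move=> nnI hQ hP hF.
have fE := iso_class_eq (@fct_iso_refl k C) (@fct_iso_sym k C) (@fct_iso_trans k C).
have aE A := iso_class_eq (@autmod_iso_refl k C A) (@autmod_iso_sym k C A)
  (@autmod_iso_trans k C A).
pose T := {i : I & {A : {A : rep C | L (nn i) A} & IrrMod k (sval A)}}.
(* A class has no preferred member: its image is specified through all the modules M of the class at
   once, consistently by [Q_mod_iso]. *)
have hc (z : T) : exists c : IrrFct P, forall M : autmod k (sval (projT1 (projT2 z))),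
    sval (projT2 (projT2 z)) = iso_class (@autmod_iso k C _) M ->
    sval c = iso_class (@fct_iso k C) (Q M).
  case: z => i [[A LA] [c [M sM cM]]] /=.
  exists (mk_class _ (hQ i A M LA sM)) => M' cM' /=.
  by apply/fE/(Q_mod_iso ktr)/aE; rewrite -cM -cM'.
have [f hf] := choice hc.
exists f; split; last by move=> i A M hM; apply: (hf (existT _ i (existT _ A (mk_class _ hM)))).
apply: inj_surj_bijective.
- move=> [i [[A LA] c]] [i' [[A' LA'] c']] ff'.
  have [M sM cM] := svalP c; have [M' sM' cM'] := svalP c'.
  have e1 := hf (existT _ i (existT _ (exist _ A LA) c)) M cM.
  have e2 := hf (existT _ i' (existT _ (exist _ A' LA') c')) M' cM'.
  have QQ : fct_iso (Q M) (Q M') by apply/fE; exact: etrans (esym e1) (etrans (congr1 sval ff') e2).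
  have lA : has_length A (nn i) by have [h _ _] := repL (nn i); apply: h.
  have lA' : has_length A' (nn i') by have [h _ _] := repL (nn i'); apply: h.
  have [[y [s gs]] nQ] := length_good lA; have [[y' [s' gs']] nQ'] := length_good lA'.
  have AA' : rep_iso A A' by apply: (Q_iso_rep ktr gs gs' nQ nQ' sM.1 sM'.1 QQ).
  have ii' : i = i' by apply: nnI; apply: (length_uniq (length_iso AA' lA) lA').
  (* Only once the indices and the representatives are identified do [c] and [c'] have the same
     type. *)
  case: i' / ii' LA' c' lA' M' sM' cM' ff' e2 QQ => LA' c' lA' M' sM' cM' ff' e2 QQ.
  have eA : A = A' by have [_ h _] := repL (nn i); apply: h.
  case: A' / eA LA' c' lA' M' sM' cM' ff' e2 QQ s' gs' nQ' AA' =>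
    LA' c' lA' M' sM' cM' ff' e2 QQ s' gs' nQ' AA'.
  rewrite (Prop_irrelevance LA' LA) in c' cM' ff' e2 *.
  have MM' := Q_iso_mod ktr gs nQ QQ.
  suff -> : c = c' by [].
  by apply: sval_inj; apply: etrans cM (etrans _ (esym cM')); apply/aE.
- move=> [c [F sF cF]].
  have [i [A [LA rA]]] := hF F sF.
  have [M sM QF] := recognizes_mod (hP F sF) rA.
  exists (existT _ i (existT _ (exist _ A LA) (mk_class _ sM))).
  apply: sval_inj; apply: etrans cF _.
  apply: etrans _ (esym (hf (existT _ i (existT _ (exist _ A LA) (mk_class _ sM))) M erefl)).
  exact/fE/fct_iso_sym.
Qed.

End Length.

Theorem mainTheorem5 (k : fieldType) (C : addcat)
    (L : nat -> rep C -> Prop) :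
  essentially_small C ->
  k_trivial k C ->
  length_representatives L ->
  (forall (A : rep C) (M : autmod k A),
     finite_length A -> simple_autmod M -> simple_in (@all_fct k C) (Q M))
  /\
  (forall d : nat,
     exists f : {n : 'I_d.+1 & {A : {A : rep C | L n A} & IrrMod k (sval A)}} ->
                IrrFct (@poly_le k C d),
       bijective f /\
       forall (n : 'I_d.+1) (A : {A : rep C | L n A}) (M : autmod k (sval A))
              (hM : simple_autmod M),
         sval (f (existT _ n (existT _ A (mk_class _ hM))))
         = iso_class (@fct_iso k C) (Q M))
  /\
  ((forall A : rep C, finitely_generated A -> finitely_cogenerated A ->
      finite_length A) ->
   exists f : {n : nat & {A : {A : rep C | L n A} & IrrMod k (sval A)}} ->
              IrrFct (@all_fct k C),
     bijective f /\
     forall (n : nat) (A : {A : rep C | L n A}) (M : autmod k (sval A))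
            (hM : simple_autmod M),
       sval (f (existT _ n (existT _ A (mk_class _ hM))))
       = iso_class (@fct_iso k C) (Q M))
  /\
  (locally_finite C ->
   forall A : rep C, finitely_generated A -> finitely_cogenerated A ->
     finite_length A).
Proof.
move=> _ ktr repL.
have repLn n A : L n A -> has_length A n by have [h _ _] := repL n; apply: h.
have recL F (A : rep C) n : has_length A n -> recognizes ktr F A ->
    exists2 B, L n B & recognizes ktr F B.
  have [_ _ h] := repL n => /h[B LB AB] rA; exists B => //; exact: recognizes_iso AB rA.
split; last split; last split.
- by move=> A M; apply: Q_simple_length.
- move=> d; apply: (Q_bijection (ktr := ktr) repL (nn := @nat_of_ord d.+1) (P := @poly_le k C d)).
  + exact: ord_inj.
  + move=> n A M /repLn hn sM; apply/(simple_poly ktr); split.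
      by apply: (Q_simple_length ktr) => //; exists n.
    apply: (Q_poly ktr) => c; have /length_chain[_ nc] := hn; apply: nc.
    by apply: chainin_leq c; apply: ltn_ord.
  + by move=> F /(simple_poly ktr)[].
  + move=> F /(simple_poly ktr)[sF pF].
    have [A [x [s [gs cg rA]]]] := simple_recognized ktr sF.
    have nQ := recognizes_Qup rA; have [M sM [p [q pq]]] := recognizes_mod sF rA.
    (* The degree of F passes to the isomorphic Q(A, M), where degree at most d forbids strict
       chains of d + 1 steps in A. *)
    have pQ : poly_lt d.+1 (Q M).
      by apply: (poly_lt_inj ktr (f := p)) pF => a; apply: can_inj (pq a).1.
    have [n [nd hn]] := length_exists (poly_Q ktr gs nQ sM.1 pQ).
    have [B LB rB] := recL F A n hn rA.
    have nd' : (n < d.+1)%N by [].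
    by exists (Ordinal nd'), B.
- move=> hfin; apply: (Q_bijection (ktr := ktr) repL (nn := id)) => //.
  + by move=> n A M /repLn hn sM; apply: (Q_simple_length ktr) => //; exists n.
  + move=> F sF; have [A [x [s [gs cg rA]]]] := simple_recognized ktr sF.
    (* One generator gives finite generation; cogeneration at x, where A(x) is finite, gives finite
       cogeneration. *)
    have [l hl] := gens_covered ktr x gs.
    have [n hn] := hfin A (gens_fg gs) (cogens_fc cg hl).
    by have [B LB rB] := recL F A n hn rA; exists n, B.
- by move=> lf A fg _; apply: locally_finite_fg.
Qed.
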